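(* Let LICQ, MFCQ, ACQ, GCQ be the four constraint qualifications at $0$ and let Lists A, B, C be the lists of constraint map-germs, all as defined in the context. ''Class'' means $\mathcal K[G]$-equivalence class of constraint map-germs. Then the following hold. (1) (LICQ) Only the fully regular class (with $n=q+r$ and constraints locally equivalent to $(g,h)$ with $g(x)=(x_1,\dots,x_q)$ and $h(x)=(x_{q+1},\dots,x_{q+r})$) satisfies LICQ. All the other constraint classes, especially those in Lists A, B, C, violate LICQ. (2) (MFCQ) MFCQ fails whenever a singular equality constraint is present (that is, whenever the Jacobian matrix of $h$ at $0$ has positive corank); in particular all the classes in Lists A and C violate MFCQ. For the classes consisting of only inequalities (List B), MFCQ holds if and only if the parameter $l_1$ in the normal form is positive. (3) (List A) Every germ in List A violates ACQ. GCQ holds for a germ in List A exactly under the following condition: - type $(1,k)$: ($k=2$ and one of $\epsilon_2,\dots,\epsilon_n$ is $-1$) or ($k\ge3$ and $\{\epsilon_2,\dots,\epsilon_n\}=\{1,-1\}$); - type $(2)$: one of $\epsilon_4,\dots,\epsilon_n$ is $-1$. (4) (List B) If $l_1>0$, both ACQ and GCQ hold. If $l_1=0$, then ACQ and GCQ hold exactly under the following conditions: - type $(1,k)$: ACQ iff ($\epsilon_q=\dots=\epsilon_n=-1$) or ($k\ge3$ and $\epsilon_{q+1}=\dots=\epsilon_n=-1$); GCQ iff ($k=2$ and $(\epsilon_q,\dots,\epsilon_n)\ne(1,\dots,1)$) or $(\epsilon_{q+1},\dots,\epsilon_n)\neq(1,\dots,1)$. - type $(2)$: ACQ iff $\epsilon_{q+2}=\dots=\epsilon_n=-1$;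 GCQ iff $(\epsilon_{q+2},\dots,\epsilon_n)\ne(1,\dots,1)$. - type $(3,k)$: ACQ iff ($\epsilon_{q-1}=\dots=\epsilon_n=-1$) or ($k\ge3$ and $\epsilon_q=\dots=\epsilon_n=-1$); GCQ iff $(\epsilon_q,\dots,\epsilon_n)\ne(1,\dots,1)$. - type $(4,k)$: ACQ never holds; GCQ iff $(\epsilon_{q+1},\dots,\epsilon_n)\ne(1,\dots,1)$ or $\epsilon_q=(-1)^{k+1}$. - type $(5)$: ACQ iff $\epsilon_{q-1}=\epsilon_{q+1}=\dots=\epsilon_n=-1$; GCQ iff $(\epsilon_{q+1},\dots,\epsilon_n)\ne(1,\dots,1)$. - type $(6)$: ACQ iff $\delta_1=\delta_2=-1$, $\alpha<2$ and $\epsilon_q=\dots=\epsilon_n=-1$; GCQ iff $(\epsilon_q,\dots,\epsilon_n)\ne(1,\dots,1)$. - type $(7)$: ACQ iff $\epsilon_{q-2}=\epsilon_q=\dots=\epsilon_n=-1$; GCQ iff $(\epsilon_q,\dots,\epsilon_n)\ne(1,\dots,1)$. - type $(8)$: ACQ iff $\epsilon_{q-1}=\epsilon_{q-1}'=\epsilon_q=\dots=\epsilon_n=-1$; GCQ iff $(\epsilon_q,\dots,\epsilon_n)\ne(1,\dots,1)$. - type $(9)$: ACQ never holds; GCQ iff $(\epsilon_{q+1},\dots,\epsilon_n)\ne(1,\dots,1)$ or $\epsilon_{01}=1$ or $\epsilon_{02}=1$. - type $(10)$: ACQ iff $\delta_1=\delta_2=\delta_3=-1$, $\epsilon_q=\dots=\epsilon_n=-1$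 and there exist distinct $i,j,k\in\{1,2,3\}$ such that either ($\alpha_{ij}\le0$, $\alpha_{ik}\le0$ and $\alpha_{jk}<2$) or ($0<\alpha_{ij}<2$, $0<\alpha_{ik}<2$ and $\alpha_{jk}+\frac{\alpha_{ij}\alpha_{ik}}2<2\sqrt{(1-\frac{\alpha_{ij}^2}4)(1-\frac{\alpha_{ik}^2}4)}$), where $\alpha_{ji}:=\alpha_{ij}$; GCQ iff $(\epsilon_q,\dots,\epsilon_n)\ne(1,\dots,1)$. (5) (List C) Every germ in List C violates ACQ. GCQ holds for a germ in List C exactly under the following condition: - type $(1,k)$: $\{\epsilon_2,\dots,\epsilon_n\}=\{1,-1\}$; - type $(2)$: $\{\epsilon_3,\dots,\epsilon_n\}=\{1,-1\}$; - type $(3,k)$: ($k$ is even and one of $\epsilon_3,\dots,\epsilon_n$ is $-1$) or ($k$ is odd and ($\epsilon_1=1$ or $\{\epsilon_3,\dots,\epsilon_n\}=\{1,-1\}$)); - types $(4)$, $(5)$, $(6)$: $\{\epsilon_3,\dots,\epsilon_n\}=\{1,-1\}$; - types $(7)$, $(8)$: $\{\epsilon_4,\dots,\epsilon_n\}=\{1,-1\}$.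
   Context: **Constraint map-germs and CQs.** A constraint map-germ is a smooth ($C^\infty$) map-germ $(g,h):(\mathbb R^n,0)\to\mathbb R^q\times\mathbb R^r$ with $h(0)=0$ and (so that the feasible set-germ contains $0$) $g_j(0)\le0$ for all $j$; $q=0$ or $r=0$ is allowed. Its feasible set-germ $M(g,h)$ is the germ at $0$ of $\{x: g_i(x)\le0\ \forall i,\ h_j(x)=0\ \forall j\}$. Let $I=\{j: g_j(0)=0\}$, $g_I=(g_j)_{j\in I}$. - LICQ: the Jacobian matrix of $(g_I,h)$ at $0$ has corank $0$, i.e. rank $|I|+r$. - MFCQ: the Jacobian matrix of $h$ at $0$ has corank $0$ (rank $r$) and there is $d\in\mathbb R^n$ with $dg_{j,0}(d)<0$ for all $j\in I$ and $dh_0(d)=0$. - Tangent cone: $C^+(g,h)=\{d\in\mathbb R^n:\exists x_m\in M(g,h),\ x_m\to0,\ \exists t_m>0,\ t_mx_m\to d\}$. Linearized cone: $L^+(g,h)=\{d: dg_{j,0}(d)\le0\ \forall j\in I,\ dh_0(d)=0\}$. - ACQ: $C^+(g,h)=L^+(g,h)$. GCQ: $C^+(g,h)^\circ=L^+(g,h)^\circ$, where $X^\circ=\{v\in\mathbb R^n: v\cdot d\le0\ \forall d\in X\}$. **$\mathcal K[G]$-equivalence.** $(g,h)$ and $(g',h')$ (same $n,q,r$) are $\mathcal K[G]$-equivalent if there are a diffeomorphism-germ $\Phi:(\mathbb R^n,0)\to(\mathbb R^n,0)$ and smooth germs at $0$ of matrix-valued maps $C$ ($q\times q$, each $C(x)$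 a product of a diagonal matrix with positive diagonal entries and a permutation matrix), $B$ ($q\times r$, arbitrary), $A$ ($r\times r$, invertible) with $g(x)=C(x)g'(\Phi^{-1}(x))+B(x)h'(\Phi^{-1}(x))$, $h(x)=A(x)h'(\Phi^{-1}(x))$. ''Locally equivalent'' in the claim refers to this equivalence. All four CQs are invariant under it. **Lists.** All $\epsilon_j,\epsilon'_j,\epsilon_{ij},\delta_j$ lie in $\{1,-1\}$, and $\alpha,\alpha_{ij}\in\mathbb R$. For the germs in the lists it is assumed that $n$ is sufficiently large, so that every sum of terms $\epsilon_jx_j^2$ running up to $j=n$ below is non-empty. Condition $(\ast)$: $4\delta_1\delta_2-\alpha^2\ne0$. Condition $(\ast\ast)$: $4\delta_i\delta_j-\alpha_{ij}^2\ne0$ for all $1\le i<j\le3$ and $4\delta_1\delta_2\delta_3+\alpha_{12}\alpha_{13}\alpha_{23}-\delta_3\alpha_{12}^2-\delta_2\alpha_{13}^2-\delta_1\alpha_{23}^2\ne0$. *List A* (no inequality, one equality constraint $h$, i.e. $q=0$, $r=1$): - $(1,k)$, $2\le k\le5$: $h=x_1^k+\sum_{j=2}^n\epsilon_jx_j^2$; - $(2)$: $h=x_1^3+\epsilon_2x_1x_2^2+x_3^2+\sum_{j=4}^n\epsilon_jx_j^2$. *List B* (no equality, $q$ inequality constraints): $g(x)=\bigl(x_1,\dots,x_{q-1},\ \sum_{j=1}^{l_1}x_j-\sum_{j=l_1+1}^{l}x_j+\tilde g(x_{l+1},\dots,x_n)\bigr)$ with $0\le l_1\le\lceil l/2\rceil$,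 where $l\ge 0$ and $\tilde g$ are: - $(1,k)$, $2\le k\le5$, $l=q-1$: $\epsilon_qx_q^k+\sum_{j=q+1}^n\epsilon_jx_j^2$; - $(2)$, $l=q-1$: $x_q^3+\epsilon_{q+1}x_qx_{q+1}^2+\sum_{j=q+2}^n\epsilon_jx_j^2$; - $(3,k)$, $2\le k\le4$, $l=q-2$: $\epsilon_{q-1}x_{q-1}^k+\sum_{j=q}^n\epsilon_jx_j^2$; - $(4,k)$, $k=3,4$, $l=q-2$: $\epsilon_qx_q^k+x_{q-1}x_q+\sum_{j=q+1}^n\epsilon_jx_j^2$; - $(5)$, $l=q-2$: $\epsilon_{q-1}x_{q-1}^2+x_q^3+\sum_{j=q+1}^n\epsilon_jx_j^2$; - $(6)$, $l=q-3$: $\delta_1x_{q-1}^2+\delta_2x_{q-2}^2+\alpha x_{q-2}x_{q-1}+\sum_{j=q}^n\epsilon_jx_j^2$, with $(\ast)$; - $(7)$, $l=q-3$: $\epsilon_{q-2}(x_{q-2}+\epsilon_{q-1}'x_{q-1})^2+\epsilon_{q-1}x_{q-1}^3+\sum_{j=q}^n\epsilon_jx_j^2$; - $(8)$, $l=q-3$: $\epsilon_{q-2}x_{q-2}^3+\epsilon_{q-1}x_{q-1}^2+\epsilon_{q-1}'x_{q-2}x_{q-1}+\sum_{j=q}^n\epsilon_jx_j^2$; - $(9)$, $l=q-3$: $x_q^3+\epsilon_{01}x_{q-1}x_q+\epsilon_{02}x_{q-2}x_q+\epsilon_{12}x_{q-2}x_{q-1}+\sum_{j=q+1}^n\epsilon_jx_j^2$;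 - $(10)$, $l=q-4$: $\sum_{j=1}^3\delta_jx_{q-4+j}^2+\sum_{1\le i<j\le3}\alpha_{ij}x_{q-4+i}x_{q-4+j}+\epsilon_0x_{q-3}x_{q-2}x_{q-1}+\sum_{j=q}^n\epsilon_jx_j^2$, with $(\ast\ast)$. *List C* (one equality constraint, $g(x)=(x_1,\dots,x_q)$): - $(1,k)$, $2\le k\le4$, $q=1$: $h=x_1^k+\sum_{j=2}^n\epsilon_jx_j^2$; - $(2)$, $q=1$: $h=x_2^3+x_1^2+\sum_{j=3}^n\epsilon_jx_j^2$; - $(3,k)$, $3\le k\le4$, $q=1$: $h=x_2^k+\epsilon_1x_1x_2+\sum_{j=3}^n\epsilon_jx_j^2$; - $(4)$, $q=2$: $h=\delta_1x_1^2+\delta_2x_2^2+\alpha x_1x_2+\sum_{j=3}^n\epsilon_jx_j^2$, with $(\ast)$; - $(5)$, $q=2$: $h=x_1^3+\epsilon_1x_2^2+\epsilon_2x_1x_2+\sum_{j=3}^n\epsilon_jx_j^2$; - $(6)$, $q=2$: $h=(x_1+\epsilon_1x_2)^2+\epsilon_2x_2^3+\sum_{j=3}^n\epsilon_jx_j^2$; - $(7)$, $q=2$: $h=x_3^3+\epsilon_1x_2x_3+\epsilon_2x_3x_1+\epsilon_3x_1x_2+\sum_{j=4}^n\epsilon_jx_j^2$; - $(8)$, $q=3$: $h=\sum_{j=1}^3\delta_jx_j^2+\sum_{1\le i<j\le3}\alpha_{ij}x_ix_j+\epsilon_1x_1x_2x_3+\sum_{j=4}^n\epsilon_jx_j^2$,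 with $(\ast\ast)$.
   Formalization: List C type (7) is corrected: GCQ iff {ε_4,…,ε_n}={1,−1} or ε_1=1 or ε_2=1. In (1), LICQ iff |I|+r≤n and (g_I,h) is equivalent to the regular germ; the form with n=q+r is stated for g(0)=0, since inactive constraints and n>q+r also allow LICQ. *)

(* Defs.v *)
From HB Require Import structures.
From mathcomp Require Import all_boot all_order all_algebra perm.
From mathcomp Require Import all_classical all_reals all_analysis.

Set Implicit Arguments.
Unset Strict Implicit.
Unset Printing Implicit Defensive.

Import Order.TTheory GRing.Theory Num.Theory.
Import numFieldNormedType.Exports.

Local Open Scope classical_set_scope.
Local Open Scope ring_scope.

(* A germ at 0 is represented by a total function; the constraint
   qualifications, the cones and the equivalence below depend only on its
   restriction to a small neighbourhood of 0 ([feasible] is a representative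
   of the feasible set-germ).  Points of R^n and values of the constraint maps
   are row vectors, so that the Jacobian of the library is the transpose of
   the usual one. *)

Section Germs.
Context {R : realType}.

Fixpoint Ck_on n (W : normedModType R) (k : nat) (U : set 'rV[R]_n)
    (f : 'rV[R]_n -> W) : Prop :=
  if k is k'.+1 then
    (forall x, U x -> differentiable f x) /\
    (forall i : 'I_n, Ck_on k' U (fun x => 'D_(delta_mx 0 i) f x))
  else forall x, U x -> {for x, continuous f}.

Definition smooth_germ n (W : normedModType R) (f : 'rV[R]_n -> W) : Prop :=
  exists U : set 'rV[R]_n,
    open_nbhs (0 : 'rV[R]_n) U /\ forall k, Ck_on k U f.

Definition constraint_germ n q r (g : 'rV[R]_n -> 'rV[R]_q)
    (h : 'rV[R]_n -> 'rV[R]_r) : Prop :=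
  [/\ smooth_germ g, smooth_germ h, h 0 = 0 & forall i, g 0 0 i <= 0].

Definition feasible n q r (g : 'rV[R]_n -> 'rV[R]_q)
    (h : 'rV[R]_n -> 'rV[R]_r) : set 'rV[R]_n :=
  [set x | (forall i, g x 0 i <= 0) /\ (forall j, h x 0 j = 0)].

Definition active n q (g : 'rV[R]_n -> 'rV[R]_q) : {set 'I_q} :=
  [set i : 'I_q | g 0 0 i == 0]%SET.

Definition active_part n q (g : 'rV[R]_n -> 'rV[R]_q) (x : 'rV[R]_n) :
    'rV[R]_#|active g| :=
  \row_k g x 0 (enum_val k).

Definition LICQ n q r (g : 'rV[R]_n -> 'rV[R]_q)
    (h : 'rV[R]_n -> 'rV[R]_r) : Prop :=
  \rank ('J (fun x => row_mx (active_part g x) (h x)) 0) = (#|active g| + r)%N.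

Definition MFCQ n q r (g : 'rV[R]_n -> 'rV[R]_q)
    (h : 'rV[R]_n -> 'rV[R]_r) : Prop :=
  \rank ('J h 0) = r /\
  exists d : 'rV[R]_n,
    (forall i, i \in active g -> ('d g (0 : 'rV[R]_n) d : 'rV[R]_q) 0 i < 0) /\
    ('d h (0 : 'rV[R]_n) d : 'rV[R]_r) = 0.

Definition tangent_cone n q r (g : 'rV[R]_n -> 'rV[R]_q)
    (h : 'rV[R]_n -> 'rV[R]_r) : set 'rV[R]_n :=
  [set d | exists (x : nat -> 'rV[R]_n) (t : nat -> R),
    [/\ forall m, feasible g h (x m), x @ \oo --> (0 : 'rV[R]_n),
        forall m, 0 < t m & (fun m => t m *: x m) @ \oo --> d]].

Definition linearized_cone n q r (g : 'rV[R]_n -> 'rV[R]_q)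
    (h : 'rV[R]_n -> 'rV[R]_r) : set 'rV[R]_n :=
  [set d |
    (forall i, i \in active g -> ('d g (0 : 'rV[R]_n) d : 'rV[R]_q) 0 i <= 0) /\
    ('d h (0 : 'rV[R]_n) d : 'rV[R]_r) = 0].

Definition polar n (X : set 'rV[R]_n) : set 'rV[R]_n :=
  [set v | forall d, X d -> \sum_(i < n) v 0 i * d 0 i <= 0].

Definition ACQ n q r (g : 'rV[R]_n -> 'rV[R]_q)
    (h : 'rV[R]_n -> 'rV[R]_r) : Prop :=
  tangent_cone g h = linearized_cone g h.

Definition GCQ n q r (g : 'rV[R]_n -> 'rV[R]_q)
    (h : 'rV[R]_n -> 'rV[R]_r) : Prop :=
  polar (tangent_cone g h) = polar (linearized_cone g h).

(* [Psi] is the inverse of the diffeomorphism germ [Phi]. *)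
Definition KG_equiv n q r
    (g : 'rV[R]_n -> 'rV[R]_q) (h : 'rV[R]_n -> 'rV[R]_r)
    (g' : 'rV[R]_n -> 'rV[R]_q) (h' : 'rV[R]_n -> 'rV[R]_r) : Prop :=
  exists (Phi Psi : 'rV[R]_n -> 'rV[R]_n)
    (C : 'rV[R]_n -> 'M[R]_q) (B : 'rV[R]_n -> 'M[R]_(q, r))
    (A : 'rV[R]_n -> 'M[R]_r),
    [/\ [/\ smooth_germ Phi, smooth_germ Psi, Phi 0 = 0, Psi 0 = 0 &
            \forall x \near (0 : 'rV[R]_n),
              Psi (Phi x) = x /\ Phi (Psi x) = x],
        [/\ smooth_germ C, smooth_germ B & smooth_germ A],
        \forall x \near (0 : 'rV[R]_n),
          exists (c : 'rV[R]_q) (s : 'S_q),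
            (forall i, 0 < c 0 i) /\ C x = diag_mx c *m perm_mx s,
        \forall x \near (0 : 'rV[R]_n), A x \in unitmx &
        \forall x \near (0 : 'rV[R]_n),
          (g x)^T = C x *m (g' (Psi x))^T + B x *m (h' (Psi x))^T /\
          (h x)^T = A x *m (h' (Psi x))^T].

(* The coordinate x_j, numbered from 1 (and 0 when j is not in 1..n). *)
Definition co n (x : 'rV[R]_n) (j : nat) : R := \sum_(i < n | i.+1 == j) x 0 i.

Definition reg_ineq n q (x : 'rV[R]_n) : 'rV[R]_q := \row_(i < q) co x i.+1.

Definition reg_eq n q r (x : 'rV[R]_n) : 'rV[R]_r :=
  \row_(i < r) co x (q + i.+1).

Definition no_constraint n (x : 'rV[R]_n) : 'rV[R]_0 := 0.

Definition one_constraint n (f : 'rV[R]_n -> R) (x : 'rV[R]_n) : 'rV[R]_1 :=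
  const_mx (f x).

Definition sgn (e : R) : Prop := e = 1 \/ e = -1.

Definition sgns (eps : nat -> R) : Prop := forall j, sgn (eps j).

Definition all_eq (eps : nat -> R) (a b : nat) (c : R) : Prop :=
  forall j, (a <= j <= b)%N -> eps j = c.

Definition both_signs (eps : nat -> R) (a b : nat) : Prop :=
  [set eps j | j in [set j | (a <= j <= b)%N]] = [set 1; -1].

Definition cond1 (d1 d2 a : R) : Prop := 4 * d1 * d2 - a ^+ 2 != 0.

Definition cond2 (d : nat -> R) (a : nat -> nat -> R) : Prop :=
  (forall i j, (1 <= i < j)%N && (j <= 3)%N ->
     4 * d i * d j - a i j ^+ 2 != 0) /\
  4 * d 1%N * d 2%N * d 3%N + a 1%N 2%N * a 1%N 3%N * a 2%N 3%N
    - d 3%N * a 1%N 2%N ^+ 2 - d 2%N * a 1%N 3%N ^+ 2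
    - d 1%N * a 2%N 3%N ^+ 2 != 0.

(* sum_{j = a}^n eps_j x_j^2 *)
Definition sq n (eps : nat -> R) (a : nat) (x : 'rV[R]_n) : R :=
  \sum_(a <= j < n.+1) eps j * co x j ^+ 2.

(* One equality constraint, no inequality. *)

Definition A1 n k (eps : nat -> R) (x : 'rV[R]_n) : R :=
  co x 1 ^+ k + sq eps 2 x.

Definition A2 n (eps : nat -> R) (x : 'rV[R]_n) : R :=
  co x 1 ^+ 3 + eps 2%N * co x 1 * co x 2 ^+ 2 + co x 3 ^+ 2 + sq eps 4 x.

Inductive listA n : ('rV[R]_n -> 'rV[R]_1) -> Prop :=
| LA1 k eps of (2 <= k <= 5)%N & (2 <= n)%N & sgns eps :
    listA (one_constraint (@A1 n k eps))
| LA2 eps of (4 <= n)%N & sgns eps :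
    listA (one_constraint (@A2 n eps)).

(* No equality, q inequality constraints; [gt] is the nonlinear part of the
   last one. *)

Definition gB n q (l1 l : nat) (gt : 'rV[R]_n -> R) (x : 'rV[R]_n) :
    'rV[R]_q :=
  \row_(i < q)
    if (i.+1 < q)%N then co x i.+1
    else \sum_(1 <= j < l1.+1) co x j - \sum_(l1.+1 <= j < l.+1) co x j + gt x.

Definition B1 n q k (eps : nat -> R) (x : 'rV[R]_n) : R :=
  eps q * co x q ^+ k + sq eps q.+1 x.

Definition B2 n q (eps : nat -> R) (x : 'rV[R]_n) : R :=
  co x q ^+ 3 + eps q.+1 * co x q * co x q.+1 ^+ 2 + sq eps q.+2 x.

Definition B3 n q k (eps : nat -> R) (x : 'rV[R]_n) : R :=
  eps (q - 1)%N * co x (q - 1) ^+ k + sq eps q x.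

Definition B4 n q k (eps : nat -> R) (x : 'rV[R]_n) : R :=
  eps q * co x q ^+ k + co x (q - 1) * co x q + sq eps q.+1 x.

Definition B5 n q (eps : nat -> R) (x : 'rV[R]_n) : R :=
  eps (q - 1)%N * co x (q - 1) ^+ 2 + co x q ^+ 3 + sq eps q.+1 x.

Definition B6 n q (d1 d2 a : R) (eps : nat -> R) (x : 'rV[R]_n) : R :=
  d1 * co x (q - 1) ^+ 2 + d2 * co x (q - 2) ^+ 2
    + a * co x (q - 2) * co x (q - 1) + sq eps q x.

(* In the next two, [e'] stands for epsilon'_{q-1}. *)
Definition B7 n q (e' : R) (eps : nat -> R) (x : 'rV[R]_n) : R :=
  eps (q - 2)%N * (co x (q - 2) + e' * co x (q - 1)) ^+ 2
    + eps (q - 1)%N * co x (q - 1) ^+ 3 + sq eps q x.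

Definition B8 n q (e' : R) (eps : nat -> R) (x : 'rV[R]_n) : R :=
  eps (q - 2)%N * co x (q - 2) ^+ 3 + eps (q - 1)%N * co x (q - 1) ^+ 2
    + e' * co x (q - 2) * co x (q - 1) + sq eps q x.

Definition B9 n q (e01 e02 e12 : R) (eps : nat -> R) (x : 'rV[R]_n) : R :=
  co x q ^+ 3 + e01 * co x (q - 1) * co x q + e02 * co x (q - 2) * co x q
    + e12 * co x (q - 2) * co x (q - 1) + sq eps q.+1 x.

Definition B10 n q (d : nat -> R) (a : nat -> nat -> R) (e0 : R)
    (eps : nat -> R) (x : 'rV[R]_n) : R :=
  \sum_(1 <= j < 4) d j * co x (q - 4 + j) ^+ 2
    + \sum_(1 <= i < 4) \sum_(i.+1 <= j < 4)
        a i j * co x (q - 4 + i) * co x (q - 4 + j)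
    + e0 * co x (q - 3) * co x (q - 2) * co x (q - 1) + sq eps q x.

Inductive listB n q (l1 : nat) : ('rV[R]_n -> 'rV[R]_q) -> Prop :=
| LB1 k eps of (2 <= k <= 5)%N & (1 <= q)%N & (q.+1 <= n)%N & sgns eps
    & (l1 <= uphalf (q - 1))%N :
    listB l1 (@gB n q l1 (q - 1) (B1 q k eps))
| LB2 eps of (1 <= q)%N & (q.+2 <= n)%N & sgns eps
    & (l1 <= uphalf (q - 1))%N :
    listB l1 (@gB n q l1 (q - 1) (B2 q eps))
| LB3 k eps of (2 <= k <= 4)%N & (2 <= q)%N & (q <= n)%N & sgns eps
    & (l1 <= uphalf (q - 2))%N :
    listB l1 (@gB n q l1 (q - 2) (B3 q k eps))
| LB4 k eps of (3 <= k <= 4)%N & (2 <= q)%N & (q.+1 <= n)%N & sgns eps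
    & (l1 <= uphalf (q - 2))%N :
    listB l1 (@gB n q l1 (q - 2) (B4 q k eps))
| LB5 eps of (2 <= q)%N & (q.+1 <= n)%N & sgns eps
    & (l1 <= uphalf (q - 2))%N :
    listB l1 (@gB n q l1 (q - 2) (B5 q eps))
| LB6 d1 d2 a eps of (3 <= q)%N & (q <= n)%N & sgn d1 & sgn d2 & cond1 d1 d2 a
    & sgns eps & (l1 <= uphalf (q - 3))%N :
    listB l1 (@gB n q l1 (q - 3) (B6 q d1 d2 a eps))
| LB7 e' eps of (3 <= q)%N & (q <= n)%N & sgn e' & sgns eps
    & (l1 <= uphalf (q - 3))%N :
    listB l1 (@gB n q l1 (q - 3) (B7 q e' eps))
| LB8 e' eps of (3 <= q)%N & (q <= n)%N & sgn e' & sgns eps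
    & (l1 <= uphalf (q - 3))%N :
    listB l1 (@gB n q l1 (q - 3) (B8 q e' eps))
| LB9 e01 e02 e12 eps of (3 <= q)%N & (q.+1 <= n)%N
    & sgn e01 & sgn e02 & sgn e12 & sgns eps & (l1 <= uphalf (q - 3))%N :
    listB l1 (@gB n q l1 (q - 3) (B9 q e01 e02 e12 eps))
| LB10 d a e0 eps of (4 <= q)%N & (q <= n)%N & sgns d & cond2 d a & sgn e0
    & sgns eps & (l1 <= uphalf (q - 4))%N :
    listB l1 (@gB n q l1 (q - 4) (B10 q d a e0 eps)).

(* One equality constraint, inequality constraints x_1, ..., x_q <= 0. *)

Definition C1 n k (eps : nat -> R) (x : 'rV[R]_n) : R :=
  co x 1 ^+ k + sq eps 2 x.

Definition C2 n (eps : nat -> R) (x : 'rV[R]_n) : R :=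
  co x 2 ^+ 3 + co x 1 ^+ 2 + sq eps 3 x.

Definition C3 n k (eps : nat -> R) (x : 'rV[R]_n) : R :=
  co x 2 ^+ k + eps 1%N * co x 1 * co x 2 + sq eps 3 x.

Definition C4 n (d1 d2 a : R) (eps : nat -> R) (x : 'rV[R]_n) : R :=
  d1 * co x 1 ^+ 2 + d2 * co x 2 ^+ 2 + a * co x 1 * co x 2 + sq eps 3 x.

Definition C5 n (eps : nat -> R) (x : 'rV[R]_n) : R :=
  co x 1 ^+ 3 + eps 1%N * co x 2 ^+ 2 + eps 2%N * co x 1 * co x 2 + sq eps 3 x.

Definition C6 n (eps : nat -> R) (x : 'rV[R]_n) : R :=
  (co x 1 + eps 1%N * co x 2) ^+ 2 + eps 2%N * co x 2 ^+ 3 + sq eps 3 x.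

Definition C7 n (eps : nat -> R) (x : 'rV[R]_n) : R :=
  co x 3 ^+ 3 + eps 1%N * co x 2 * co x 3 + eps 2%N * co x 3 * co x 1
    + eps 3%N * co x 1 * co x 2 + sq eps 4 x.

Definition C8 n (d : nat -> R) (a : nat -> nat -> R) (eps : nat -> R)
    (x : 'rV[R]_n) : R :=
  \sum_(1 <= j < 4) d j * co x j ^+ 2
    + \sum_(1 <= i < 4) \sum_(i.+1 <= j < 4) a i j * co x i * co x j
    + eps 1%N * co x 1 * co x 2 * co x 3 + sq eps 4 x.

Inductive listC n : nat -> ('rV[R]_n -> 'rV[R]_1) -> Prop :=
| LC1 k eps of (2 <= k <= 4)%N & (2 <= n)%N & sgns eps :
    listC 1 (one_constraint (@C1 n k eps))
| LC2 eps of (3 <= n)%N & sgns eps :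
    listC 1 (one_constraint (@C2 n eps))
| LC3 k eps of (3 <= k <= 4)%N & (3 <= n)%N & sgns eps :
    listC 1 (one_constraint (@C3 n k eps))
| LC4 d1 d2 a eps of (3 <= n)%N & sgn d1 & sgn d2 & cond1 d1 d2 a & sgns eps :
    listC 2 (one_constraint (@C4 n d1 d2 a eps))
| LC5 eps of (3 <= n)%N & sgns eps :
    listC 2 (one_constraint (@C5 n eps))
| LC6 eps of (3 <= n)%N & sgns eps :
    listC 2 (one_constraint (@C6 n eps))
| LC7 eps of (4 <= n)%N & sgns eps :
    listC 2 (one_constraint (@C7 n eps))
| LC8 d a eps of (4 <= n)%N & sgns d & cond2 d a & sgns eps :
    listC 3 (one_constraint (@C8 n d a eps)).

End Germs.

(* Main.v *)
(* LICQ is the rank condition of the implicit function theorem, which is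
   obtained here from an inverse function theorem for smooth germs (contraction
   argument, then induction on the order of differentiability).  LICQ and MFCQ
   transport along K[G]-equivalence because the two Jacobians differ by
   invertible factors, a positive monomial one for the inequalities.

   For the normal forms with degenerate part f ~ Q (2-jet) the tangent cone T
   lies in the linearized cone L.  Every d in T satisfies Q d <= 0 (inequality)
   or Q d = 0 (equality); conversely d in L with Q d < 0 is tangent, and so is
   d in L near which Q changes sign within L.  Hence ACQ is a sign condition on
   Q over L.  For GCQ, the quadratic variables on which the form is indefinite
   (resp. negative) let one move any d in L along a free axis in both
   directions into T; if the free part is definite, a suitable linear form
   x_n + K (sum of the inequality variables) separates T from L.  The types with
   a product of an inequality variable and the cubic or quartic variable x_c are
   decided by the curves tangent to the axis +-e_c. *)

Require Import Defs.
From HB Require Import structures.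
From mathcomp Require Import all_boot all_order all_algebra perm.
From mathcomp Require Import all_classical all_reals all_analysis.
From mathcomp Require Import ring lra zify.

Set Implicit Arguments.
Unset Strict Implicit.
Unset Printing Implicit Defensive.

Import Order.TTheory GRing.Theory Num.Theory.
Import numFieldNormedType.Exports.

Local Open Scope classical_set_scope.
Local Open Scope ring_scope.

(** * Differential calculus of smooth germs *)

(** Every quadratic part is written as [P + sq eps a] with [P] blind to x_a, ..., x_n, so each
    criterion is proved once, from the signs [eps] and a bound on [P] over L. The constant K of the
    separating form comes from dominating -P (for an equality, |P|) by the square of a linear form
    that is nonpositive on L: on T this form bounds x_n, while e_n itself lies in L. The equality
    case is the harder one. The condition Q d = 0 is not open, and dh vanishes at 0, so the implicit
    function theorem gives no feasible points there. They are produced by the intermediate value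
    theorem on a segment joining points where Q has opposite signs; convexity of the orthant keeps
    the segment admissible. Where x_c enters the quadratic part only through products with
    inequality variables, the 2-jet cannot tell whether e_c and -e_c are both tangent. There the
    cubic or quartic term is balanced against the quadratic part along explicit curves. *)

Section MatrixNorm.
Context {R : realType}.

Lemma coord_norm_le m n (x : 'M[R]_(m, n)) i j : `|x i j| <= `|x|.
Proof. by rewrite [leRHS]/Num.Def.normr/= mx_normrE (le_bigmax _ _ (i, j)). Qed.

Lemma norm_le_coord m n (x : 'M[R]_(m, n)) e :
  0 <= e -> (forall i j, `|x i j| <= e) -> `|x| <= e.
Proof.
move=> e0 H; rewrite [leLHS]/Num.Def.normr/= mx_normrE.
by rewrite bigmax_le // => i _; exact: H.
Qed.

Lemma cvg_rV (T : Type) (F : set_system T) (FF : Filter F) n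
    (f : T -> 'rV[R]_n) (l : 'rV[R]_n) :
  (forall i, (fun y => f y 0 i) @ F --> l 0 i) -> f @ F --> l.
Proof.
move=> H; apply/cvgrPdist_le => e e0; near=> y.
apply: norm_le_coord => [|i j]; first exact: ltW.
rewrite ord1 !mxE; move: j; near: y; apply: filter_forall => j.
by have /cvgrPdist_le/(_ e e0) := H j.
Unshelve. all: by end_near. Qed.

End MatrixNorm.

Section Coordinates.
Context {R : realType}.

Lemma differentiable_rVP (V : normedModType R) n (f : V -> 'rV[R]_n) x :
  differentiable f x <-> forall i, differentiable (fun y => f y 0 i) x.
Proof.
split=> [df i|H].
  by apply: (@differentiable_comp _ _ _ _ f (fun y : 'rV[R]_n => y 0 i)) => //;
     exact: differentiable_coord.
have -> : f = \sum_(i < n) (fun y => f y 0 i *: delta_mx 0 i).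
  by apply/funext => y; rewrite fct_sumE -row_sum_delta.
apply: differentiable_sum => i; exact: differentiableZl.
Qed.

Lemma derive_rV (V : normedModType R) n (f : V -> 'rV[R]_n) x v i :
  differentiable f x -> ('D_v f x) 0 i = 'D_v (fun y => f y 0 i) x.
Proof. by move=> df; rewrite derive_mx ?mxE//; exact: diff_derivable. Qed.

(** The chain rule is put in coordinates so that, in [Ck_comp], a partial derivative of a composite
    is a sum of products to which [CkM] and the induction hypothesis apply. *)
Lemma derive_comp_rV m n (f : 'rV[R]_m -> R) (phi : 'rV[R]_n -> 'rV[R]_m) x v :
  differentiable phi x -> differentiable f (phi x) ->
  'D_v (f \o phi) x =
  \sum_(j < m) 'D_v (fun y => phi y 0 j) x * 'D_(delta_mx 0 j) f (phi x).
Proof.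
move=> dp df; rewrite deriveE; last exact: differentiable_comp.
rewrite diff_comp // /=; set w : 'rV[R]_m := 'd phi x v.
rewrite [w]row_sum_delta linear_sum /=.
by apply: eq_bigr => j _; rewrite linearZ /= -derive_rV // !deriveE.
Qed.

End Coordinates.

Section CkCalculus.
Context {R : realType}.
Implicit Types (n k : nat).

Lemma CkS n (W : normedModType R) k U (f : 'rV[R]_n -> W) : Ck_on k.+1 U f -> Ck_on k U f.
Proof.
elim: k f => [|k IH] f [df Df].
  by move=> x Ux; apply: differentiable_continuous; exact: df.
by split=> // i; apply: IH; exact: Df.
Qed.

Lemma Ck_sub n (W : normedModType R) k U V (f : 'rV[R]_n -> W) :
  V `<=` U -> Ck_on k U f -> Ck_on k V f.
Proof.
move=> VU; elim: k f => [|k IH] f; first by move=> H x /VU; exact: H.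
by case=> df Df; split=> [x /VU|i]; [exact: df|apply: IH; exact: Df].
Qed.

(** The first-order expansion at [x] sees [f] only near [x], so it is also one for [g];
    [diff_unique] then identifies the differential. *)
Lemma near_eq_differentiable (V W : normedModType R) (f g : V -> W) x :
  (\near x, f x = g x) -> differentiable f x -> differentiable g x.
Proof.
move=> fg; have fgx : f x = g x by exact: nbhs_singleton fg.
have fg0 : \forall h \near (0 : V), f (h + x) = g (h + x).
  by move: fg; rewrite (near_shift 0 x (fun y => f y = g y)) /= subr0.
move=> /diff_locallyP[dfc dff]; apply/diff_locallyP.
suff E : g \o shift x = cst (g x) + 'd f x +o_ 0 id.
  by rewrite (diff_unique dfc E).
apply/eqaddoP => e e0; have /eqaddoP/(_ _ e0) H := dff.
near=> h; rewrite /= !fctE -fgx.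
have <- : f (h + x) = g (h + x) by near: h.
by near: h; exact: H.
Unshelve. all: by end_near. Qed.

(** The rules of differentiation identify a derivative only at the points of [U]. The closure lemmas
    below therefore exhibit it up to equality on [U], which suffices because [U] is open. *)
Lemma Ck_ext n (W : normedModType R) k U (f g : 'rV[R]_n -> W) :
  open U -> (forall x, U x -> f x = g x) -> Ck_on k U f -> Ck_on k U g.
Proof.
move=> oU; have nU x : U x -> \near x, U x by move=> Ux; exact: open_nbhs_nbhs.
elim: k f g => [|k IH] f g fg.
  move=> H x Ux; have := H x Ux.
  rewrite /prop_for /continuous_at -fg // => fc.
  have FG : \forall y \near nbhs x, f y = g y.
    near=> y; apply: fg; near: y; exact: nU.
  by apply: cvg_trans fc; exact: (near_eq_cvg FG).
case=> df Df; split=> [x Ux|i].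
  apply: near_eq_differentiable (df _ Ux).
  near=> y; apply: fg; near: y; exact: nU.
apply: IH (Df i) => x Ux; apply: near_eq_derive; near=> y; apply: fg; near: y; exact: nU.
Unshelve. all: by end_near. Qed.

Lemma Ck_cst n (W : normedModType R) k U (c : W) : Ck_on k U (fun _ : 'rV[R]_n => c).
Proof.
elim: k c => [|k IH] c; first by move=> x _; exact: cst_continuous.
split=> [x _|i]; first exact: differentiable_cst.
have -> : (fun x => 'D_(delta_mx 0 i) (fun _ : 'rV[R]_n => c) x) = fun=> 0.
  by apply/funext => x; rewrite (derive_cst c).
exact: IH.
Qed.

Lemma Ck_coord n k U (j : 'I_n) : Ck_on k U (fun x : 'rV[R]_n => x 0 j).
Proof.
have dc (x : 'rV[R]_n) : differentiable (fun x : 'rV[R]_n => x 0 j) x.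
  exact: differentiable_coord.
case: k => [|k]; first by move=> x _; apply: differentiable_continuous.
split=> // i.
have -> : (fun x => 'D_(delta_mx 0 i) (fun x : 'rV[R]_n => x 0 j) x) =
          fun=> (delta_mx 0 i : 'rV[R]_n) 0 j.
  apply/funext => x; rewrite -(@derive_rV _ _ _ id) ?derive_id //.
exact: Ck_cst.
Qed.

Lemma CkD n (W : normedModType R) k U (f g : 'rV[R]_n -> W) : open U ->
  Ck_on k U f -> Ck_on k U g -> Ck_on k U (fun x => f x + g x).
Proof.
move=> oU; elim: k f g => [|k IH] f g.
  by move=> F G x Ux; apply: continuousD; [exact: F|exact: G].
case=> df Df [dg Dg]; split=> [x Ux|i].
  by apply: differentiableD; [exact: df|exact: dg].
apply: (Ck_ext oU _ (IH _ _ (Df i) (Dg i))) => x Ux.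
by rewrite deriveD //; apply: diff_derivable; [exact: df|exact: dg].
Qed.

Lemma CkM n k U (f g : 'rV[R]_n -> R) : open U ->
  Ck_on k U f -> Ck_on k U g -> Ck_on k U (fun x => f x * g x).
Proof.
move=> oU; elim: k f g => [|k IH] f g.
  by move=> F G x Ux; apply: (@continuousM _ _ f g); [exact: F|exact: G].
move=> Cf Cg; have [df Df] := Cf; have [dg Dg] := Cg; split=> [x Ux|i].
  by apply: (@differentiableM _ _ f g); [exact: df|exact: dg].
apply: (Ck_ext oU _ (CkD oU (IH _ _ (CkS Cf) (Dg i)) (IH _ _ (CkS Cg) (Df i)))).
move=> x Ux; rewrite (@deriveM _ _ f g) //.
  by apply: diff_derivable; exact: df.
by apply: diff_derivable; exact: dg.
Qed.

Lemma CkN n k U (f : 'rV[R]_n -> R) : open U ->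
  Ck_on k U f -> Ck_on k U (fun x => - f x).
Proof.
move=> oU Cf; apply: (Ck_ext oU _ (CkM oU (Ck_cst k U (-1 : R)) Cf)) => x _.
by rewrite mulN1r.
Qed.

Lemma Ck_sum n (W : normedModType R) k U (I : Type) (r : seq I) (P : pred I)
    (f : I -> 'rV[R]_n -> W) : open U ->
  (forall i, P i -> Ck_on k U (f i)) -> Ck_on k U (fun x => \sum_(i <- r | P i) f i x).
Proof.
move=> oU H; elim: r => [|a r IH].
  by apply: (Ck_ext oU _ (Ck_cst k U 0)) => x _; rewrite big_nil.
have [Pa|Pa] := boolP (P a).
  by apply: (Ck_ext oU _ (CkD oU (H _ Pa) IH)) => x _; rewrite big_cons Pa.
by apply: (Ck_ext oU _ IH) => x _; rewrite big_cons (negbTE Pa).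
Qed.

Lemma Ck_prod n k U (I : Type) (r : seq I) (P : pred I)
    (f : I -> 'rV[R]_n -> R) : open U ->
  (forall i, P i -> Ck_on k U (f i)) -> Ck_on k U (fun x => \prod_(i <- r | P i) f i x).
Proof.
move=> oU H; elim: r => [|a r IH].
  by apply: (Ck_ext oU _ (Ck_cst k U (1 : R))) => x _; rewrite big_nil.
have [Pa|Pa] := boolP (P a).
  by apply: (Ck_ext oU _ (CkM oU (H _ Pa) IH)) => x _; rewrite big_cons Pa.
by apply: (Ck_ext oU _ IH) => x _; rewrite big_cons (negbTE Pa).
Qed.

Lemma CkV n k U (f : 'rV[R]_n -> R) : open U -> (forall x, U x -> f x != 0) ->
  Ck_on k U f -> Ck_on k U (fun x => (f x)^-1).
Proof.
move=> oU f0; elim: k => [|k IH].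
  by move=> F x Ux; apply: (@continuousV _ _ f); [exact: f0|exact: F].
move=> Cf; have [df Df] := Cf; split=> [x Ux|i].
  by apply: (@differentiableV _ _ f); [exact: df|exact: f0].
have Cv := IH (CkS Cf).
apply: (Ck_ext oU _ (CkN oU (CkM oU (CkM oU Cv Cv) (Df i)))) => x Ux.
rewrite (@deriveV _ _ f) ?f0//; last by apply: diff_derivable; exact: df.
by rewrite scaleNr expr2 invfM.
Qed.

Lemma Ck_rVP n m k U (f : 'rV[R]_n -> 'rV[R]_m) : open U ->
  Ck_on k U f <-> forall i, Ck_on k U (fun x => f x 0 i).
Proof.
move=> oU; elim: k f => [|k IH] f; split.
- move=> H i x Ux; apply: (@continuous_comp _ _ _ f (fun y : 'rV[R]_m => y 0 i)).
    exact: H.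
  exact: coord_continuous.
- by move=> H x Ux; apply: (@cvg_rV _ _ (nbhs x) _ _ f) => i; exact: (H i x Ux).
- case=> df Df i; split=> [x Ux|j].
    by move/differentiable_rVP : (df _ Ux).
  have /IH/(_ i) := Df j; apply: Ck_ext => // x Ux.
  by rewrite derive_rV //; exact: df.
- move=> H; have df x : U x -> differentiable f x.
    by move=> Ux; apply/differentiable_rVP => i; have [+ _] := H i; apply.
  split=> // j; apply/IH => i; have [_ /(_ j)] := H i; apply: Ck_ext => // x Ux.
  by rewrite derive_rV //; exact: df.
Qed.

Lemma Ck_comp n m k U V (f : 'rV[R]_m -> R) (phi : 'rV[R]_n -> 'rV[R]_m) :
  open U -> (forall x, U x -> V (phi x)) ->
  Ck_on k V f -> Ck_on k U phi -> Ck_on k U (f \o phi).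
Proof.
move=> oU UV; elim: k f => [|k IH] f.
  move=> F P x Ux; apply: (@continuous_comp _ _ _ phi f); first exact: P.
  by apply: F; exact: UV.
move=> Cf Cp; have [df Df] := Cf; have [dp Dp] := Cp; split=> [x Ux|i].
  by apply: differentiable_comp; [exact: dp|apply: df; exact: UV].
have H : Ck_on k U (fun x => \sum_(j < m) 'D_(delta_mx 0 i) (fun y => phi y 0 j) x *
                               ('D_(delta_mx 0 j) f \o phi) x).
  apply: Ck_sum => // j _; apply: CkM => //.
    by have /(Ck_rVP _ _ oU)/(_ j)[_] := Cp; exact.
  by apply: IH; [exact: Df|exact: CkS].
apply: (Ck_ext oU _ H) => x Ux; rewrite derive_comp_rV //; first exact: dp.
by apply: df; exact: UV.
Qed.

End CkCalculus.

(** * Inverse function theorem for smooth germs *)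

Section InverseFunction.
Context {R : realType}.

Lemma norm_mulmx_le m n (v : 'rV[R]_m) (A : 'M[R]_(m, n)) :
  `|v *m A| <= m%:R * `|A| * `|v|.
Proof.
apply: norm_le_coord => [|i j]; first by rewrite !mulr_ge0.
rewrite mxE (le_trans (ler_norm_sum _ _ _))//.
rewrite (_ : m%:R = \sum_(k < m) 1); last by rewrite sumr_const card_ord.
rewrite 2!mulr_suml; apply: ler_sum => k _; rewrite mul1r normrM mulrC.
by rewrite ler_pM // coord_norm_le.
Qed.

Lemma mulmx_bound m n (A : 'M[R]_(m, n)) :
  exists2 K : R, 0 < K & forall v : 'rV[R]_m, `|v *m A| <= K * `|v|.
Proof.
exists (1 + m%:R * `|A|) => [|v]; first by rewrite ltr_pwDl // mulr_ge0.
by rewrite (le_trans (norm_mulmx_le _ _))// ler_wpM2r // lerDr.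
Qed.

Lemma mulmxr_continuous m n (A : 'M[R]_(m, n)) :
  continuous (fun y : 'rV[R]_m => y *m A).
Proof.
move=> z; apply: differentiable_continuous; apply/differentiable_rVP => i.
have -> : (fun y : 'rV[R]_m => (y *m A) 0 i) =
          \sum_(k < m) (fun y : 'rV[R]_m => y 0 k * A k i).
  by apply/funext => y; rewrite fct_sumE mxE.
apply: differentiable_sum => k; apply: differentiableM => //.
exact: differentiable_coord.
Qed.

Lemma open_norm_lt m n (f : 'rV[R]_m -> 'rV[R]_n) (r : R) :
  continuous f -> open [set x | `|f x| < r].
Proof.
move=> cf; apply: (@open_comp _ _ (fun x => `|f x|) [set z : R | z < r]).
  by move=> x _; apply: (@continuous_comp _ _ _ f); [exact: cf|exact: norm_continuous].
exact: open_lt.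
Qed.

Lemma jacobianE n m (f : 'rV[R]_n -> 'rV[R]_m) x i j :
  differentiable f x -> 'J f x i j = 'D_(delta_mx 0 i) f x 0 j.
Proof. by move=> df; rewrite deriveEjacobian // -rowE [RHS]mxE. Qed.

Lemma Ck_det n m k (U : set 'rV[R]_n) (M : 'rV[R]_n -> 'M[R]_m) : open U ->
  (forall i j, Ck_on k U (fun x => M x i j)) -> Ck_on k U (fun x => \det (M x)).
Proof.
move=> oU H; apply: Ck_sum => // s _; apply: CkM => //; first exact: Ck_cst.
by apply: Ck_prod => // i _; exact: H.
Qed.

(** Cramer's rule: the entries of the inverse are cofactors divided by the determinant. *)
Lemma Ck_invmx n m k (U : set 'rV[R]_n) (M : 'rV[R]_n -> 'M[R]_m) i j : open U ->
  (forall x, U x -> M x \in unitmx) ->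
  (forall i j, Ck_on k U (fun x => M x i j)) -> Ck_on k U (fun x => invmx (M x) i j).
Proof.
move=> oU MU H.
have Cd : Ck_on k U (fun x => (\det (M x))^-1).
  apply: CkV => // [x /MU|]; first by rewrite unitmxE unitfE.
  exact: Ck_det.
have Ca : Ck_on k U (fun x => (-1) ^+ (j + i) * \det (row' j (col' i (M x)))).
  apply: CkM => //; first exact: Ck_cst.
  apply: Ck_det => // a b; apply: (Ck_ext oU _ (H (lift j a) (lift i b))) => x _.
  by rewrite !mxE.
by apply: (Ck_ext oU _ (CkM oU Cd Ca)) => x Ux; rewrite /invmx MU // !mxE.
Qed.

Lemma derive_rV_sum n m (f : 'rV[R]_n -> 'rV[R]_m) x v j :
  differentiable f x ->
  ('D_v f x) 0 j = \sum_(i < n) v 0 i * ('D_(delta_mx 0 i) f x) 0 j.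
Proof.
move=> df; rewrite deriveEjacobian // mxE; apply: eq_bigr => i _.
by rewrite jacobianE.
Qed.

Lemma is_derive_segment n m (G : 'rV[R]_n -> 'rV[R]_m) y v (t : R) j :
  differentiable G (y + t *: v) ->
  is_derive t 1 (fun s : R => G (y + s *: v) 0 j) (('D_v G (y + t *: v)) 0 j).
Proof.
move=> dG; rewrite derive_rV //; set g := fun z => G z 0 j.
have dg : derivable g (y + t *: v) v.
  by apply: diff_derivable; move/differentiable_rVP : dG; exact.
have E : (fun h : R => h^-1 *: (g (y + (h *: 1 + t) *: v) - g (y + t *: v))) =
         (fun h => h^-1 *: (g (h *: v + (y + t *: v)) - g (y + t *: v))).
  by apply/funext => h; rewrite scalerDl [h *: 1]mulr1 addrCA.
by apply: DeriveDef; rewrite /derivable /derive /= E.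
Qed.

(** Near 0 the partial derivatives are small by continuity; the mean value theorem along a segment,
    applied to one coordinate at a time, turns this into the contraction constant 1/2 for the sup
    norm. *)
Lemma C1_lipschitz n m (U : set 'rV[R]_n) (G : 'rV[R]_n -> 'rV[R]_m) :
  open_nbhs (0 : 'rV[R]_n) U -> Ck_on 1 U G -> (forall i, 'D_(delta_mx 0 i) G 0 = 0) ->
  exists2 r : R, 0 < r &
    [/\ forall x, `|x| <= r -> U x,
        forall x v, `|x| <= r -> `|'D_v G x| <= 2^-1 * `|v| &
        forall x y, `|x| <= r -> `|y| <= r -> `|G x - G y| <= 2^-1 * `|x - y|].
Proof.
move=> [oU U0] [dG cG] G0.
(* If each of the [n] partial derivatives is at most [e], the derivative along [v] is at most half
   of the norm of [v]; the successor avoids dividing by 0 when [n] is 0. *)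
pose e : R := (2 * n.+1%:R)^-1.
have e0 : 0 < e by rewrite invr_gt0 mulr_gt0.
have [r r0 Hr] : exists2 r : R, 0 < r & forall x, `|x| <= r ->
    U x /\ forall i, `|'D_(delta_mx 0 i) G x| <= e.
  have /nbhs_normP[r r0 Hr] : \forall x \near (0 : 'rV[R]_n),
      U x /\ forall i, `|'D_(delta_mx 0 i) G x| <= e.
    near=> x; split; first by near: x; exact: open_nbhs_nbhs.
    near: x; apply: filter_forall => i.
    have /cvgrPdist_le/(_ e e0) := cG i 0 U0.
    by apply: filterS => x /=; rewrite G0 sub0r normrN.
  exists (r / 2); first by rewrite divr_gt0.
  move=> x xr; apply: Hr; rewrite /= sub0r normrN (le_lt_trans xr)//.
  by rewrite ltr_pdivrMr // ltr_pMr // ltr1n.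
have bD x v : `|x| <= r -> `|'D_v G x| <= 2^-1 * `|v|.
  move=> /Hr[Ux Dx]; apply: norm_le_coord => [|i j]; first by rewrite mulr_ge0.
  rewrite ord1 derive_rV_sum; last exact: dG.
  rewrite (le_trans (ler_norm_sum _ _ _))//.
  apply: (@le_trans _ _ (\sum_(k < n) `|v| * e)).
    apply: ler_sum => k _; rewrite normrM ler_pM ?coord_norm_le //.
    exact: le_trans (coord_norm_le _ _ _) (Dx k).
  rewrite -mulr_sumr sumr_const card_ord -(mulr_natl e) mulrC ler_wpM2r //.
  by rewrite /e invfM mulrCA ler_piMr // ler_pdivrMr // mul1r ler_nat.
exists r => //; split=> // [x /Hr[]//|x y xr yr].
apply: norm_le_coord => [|i j]; first by rewrite mulr_ge0.
rewrite ord1 {i}.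
pose c (t : R) : 'rV[R]_n := y + t *: (x - y).
have cr t : 0 <= t <= 1 -> `|c t| <= r.
  move=> /andP[t0 t1]; have -> : c t = t *: x + (1 - t) *: y.
    by rewrite /c scalerBr scalerBl scale1r addrCA.
  rewrite (le_trans (ler_normD _ _))// !normrZ !ger0_norm ?subr_ge0//.
  rewrite [leRHS](_ : r = t * r + (1 - t) * r); last by ring.
  by rewrite lerD // ler_wpM2l // subr_ge0.
pose f (t : R) : R := G (c t) 0 j.
have df (t : R) : 0 <= t <= 1 -> is_derive t 1 f (('D_(x - y) G (c t)) 0 j).
  by move=> tt; apply: is_derive_segment; apply: dG; have [] := Hr _ (cr _ tt).
have [t tt E] : exists2 t, t \in `[0, 1]%R & f 1 - f 0 = ('D_(x - y) G (c t)) 0 j * (1 - 0).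
  apply: (@MVT_segment R f (fun t => ('D_(x - y) G (c t)) 0 j)) => //.
    by move=> t; rewrite in_itv /= => /andP[/ltW a /ltW b]; apply: df; rewrite a.
  apply: derivable_within_continuous => t; rewrite in_itv /= => tt.
  by have [] := df t tt.
have -> : (G x - G y) 0 j = f 1 - f 0.
  by rewrite /f /c !mxE scale1r scale0r addr0 addrCA subrr addr0.
rewrite E subr0 mulr1 (le_trans (coord_norm_le _ _ _))// bD // cr //.
Unshelve. all: by end_near. Qed.

(** No iteration: |T x - x| has a minimiser on the compact ball, and replacing [x] by [T x] at least
    halves this quantity, so the minimum is 0. *)
Lemma contraction_ball_fixpoint n (r : R) (T : 'rV[R]_n -> 'rV[R]_n) : 0 < r ->
  (forall x, `|x| <= r -> `|T x| <= r) ->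
  (forall x y, `|x| <= r -> `|y| <= r -> `|T x - T y| <= 2^-1 * `|x - y|) ->
  exists2 x, `|x| <= r & T x = x.
Proof.
move=> r0 TB Tl; pose B := closed_ball (0 : 'rV[R]_n) r.
have BE x : (x \in B) = (`|x| <= r).
  by rewrite /B closed_ballE // /closed_ball_; apply/idP/idP; rewrite inE /= sub0r normrN.
have cB : compact B.
  apply: bounded_closed_compact; last exact: closed_ball_closed.
  exists r; split=> [|M rM x]; first exact: num_real.
  by move/mem_set; rewrite BE => /le_trans; apply; exact: ltW.
have [||x xB xmin] := @EVT_min_rV R n (fun x => `|T x - x|) B _ cB.
- by exists 0; apply/set_mem; rewrite BE normr0 ltW.
- apply/subspace_continuousP => x /mem_set; rewrite BE => xr.
  apply/cvgrPdist_lt => e e0; rewrite near_withinE; near=> y => /mem_set; rewrite BE => yr.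
  have xy : `|x - y| < e / 2 by near: y; apply: cvgr_dist_lt; rewrite ?divr_gt0.
  rewrite (le_lt_trans (ler_dist_dist _ _))//.
  have -> : (T x - x) - (T y - y) = (T x - T y) - (x - y) by rewrite !opprB addrACA [- x + _]addrC -addrACA.
  rewrite (le_lt_trans (ler_normB _ _))//.
  have := Tl x y xr yr; lra.
exists x; first by rewrite -BE.
apply/eqP; rewrite -subr_eq0 -normr_le0.
have xr : `|x| <= r by rewrite -BE.
have := xmin (T x); rewrite BE TB // => /(_ isT).
have := Tl (T x) x (TB _ xr) xr; have := normr_ge0 (T x - x); lra.
Unshelve. all: by end_near. Qed.

Lemma unitmx_injective n (A : 'M[R]_n) :
  (forall v : 'rV[R]_n, v *m A = 0 -> v = 0) -> A \in unitmx.
Proof.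
move=> H; rewrite -row_free_unit -kermx_eq0; apply/eqP/row_matrixP => i.
by rewrite row0; apply: H; apply: sub_kermxP; exact: row_sub.
Qed.

Lemma inverse_function n (P : 'rV[R]_n -> 'rV[R]_n) :
  smooth_germ P -> P 0 = 0 -> 'J P 0 \in unitmx ->
  exists Phi : 'rV[R]_n -> 'rV[R]_n,
    [/\ smooth_germ Phi, Phi 0 = 0 &
        \forall x \near (0 : 'rV[R]_n), Phi (P x) = x /\ P (Phi x) = x].
Proof.
move=> [U [[oU U0] CP]] P0 JU; pose N := invmx ('J P 0).
have dP x : U x -> differentiable P x by move=> Ux; have [+ _] := CP 1%N; exact.
(* The derivative of [G] vanishes at 0, and [P x = y] holds exactly when [x] is a fixed point of
   [x |-> G x + y *m N]. *)
pose G (x : 'rV[R]_n) := x - P x *m N.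
have JPE k i j : Ck_on k U (fun x => 'J P x i j).
  have [_ /(_ i)] := CP k.+1; move/(Ck_rVP _ _ oU)/(_ j).
  by apply: Ck_ext => // x Ux; rewrite jacobianE //; exact: dP.
have PNE x j : (P x *m N) 0 j = \sum_(k < n) N k j * P x 0 k.
  by rewrite mxE; apply: eq_bigr => k _; rewrite mulrC.
have GE x j : G x 0 j = x 0 j - \sum_(i < n) N i j * P x 0 i.
  by rewrite -PNE !mxE.
have CG k : Ck_on k U G.
  apply/Ck_rVP => // j.
  have C1 : Ck_on k U (fun x => x 0 j - \sum_(i < n) N i j * P x 0 i).
    apply: CkD => //; first exact: Ck_coord.
    apply: CkN => //; apply: Ck_sum => // i _; apply: CkM => //; first exact: Ck_cst.
    by have /(Ck_rVP _ _ oU) := CP k; exact.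
  by apply: (Ck_ext oU _ C1) => x Ux; rewrite GE.
have DG x v : U x -> 'D_v G x = v - v *m 'J P x *m N.
  move=> Ux; have dGx : differentiable G x.
    by have [dG _] := CG 1%N; exact: dG.
  have dPx := dP _ Ux.
  apply/rowP => j; rewrite derive_rV //.
  have -> : (fun y => G y 0 j) = (fun y : 'rV[R]_n => y 0 j) - \sum_(i < n) (N i j \*: (fun y => P y 0 i)).
    by apply/funext => y; rewrite GE !fctE fct_sumE.
  have dPi i : derivable (fun y => P y 0 i) x v.
    by apply: diff_derivable; move/differentiable_rVP : dPx => /(_ i).
  rewrite deriveB; last 2 first.
  - by apply: diff_derivable; exact: differentiable_coord.
  - by apply: derivable_sum => i; exact: derivableZ.
  rewrite derive_sum; last by move=> i; exact: derivableZ.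
  rewrite -(@derive_rV _ _ _ id) // derive_id !mxE; congr (_ - _).
  apply: eq_bigr => i _; rewrite deriveZ // mulrC; congr (_ * _).
  by rewrite -derive_rV // deriveEjacobian.
have [|r r0 [BU bD lip]] := @C1_lipschitz n n U G (conj oU U0) (CG 1%N).
  by move=> i; rewrite DG // /N mulmxK // subrr.
have inj x y : `|x| <= r -> `|y| <= r -> `|x - y| <= 2 * `|(P x - P y) *m N|.
  move=> xr yr; have := lip x y xr yr.
  have E : x - y = (G x - G y) + (P x - P y) *m N.
    rewrite mulmxBl /G; move: (P x *m N) (P y *m N) => a b.
    by apply/rowP => i; rewrite !mxE; ring.
  have := ler_normD (G x - G y) ((P x - P y) *m N); rewrite -E; lra.
(* The bound r/2 on [y *m N], added to the bound r/2 on [G] over the ball, makes this map send the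
   ball of radius [r] into itself. *)
pose V := [set y : 'rV[R]_n | `|y *m N| < r / 2].
have oV : open V by apply: open_norm_lt; exact: mulmxr_continuous.
have V0 : V 0 by rewrite /V /= mul0mx normr0 divr_gt0.
have solv y : V y -> exists x, `|x| <= r /\ P x = y.
  move=> Vy; have [x|x z xr zr|x xr xE] := @contraction_ball_fixpoint n r (fun x => G x + y *m N) r0.
  - move=> xr; have := lip x 0 xr; rewrite normr0 => /(_ (ltW r0)).
    rewrite /G P0 mul0mx !subr0 => lx.
    have := ler_normD (x - P x *m N) (y *m N); move: Vy; rewrite /V /=; lra.
  - by rewrite opprD addrACA subrr addr0; exact: lip.
  exists x; split=> //; have : (y - P x) *m N = 0.
    transitivity (G x + y *m N - x); last by rewrite xE subrr.
    rewrite mulmxBl /G; move: (P x *m N) (y *m N) => a b.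
    by apply/rowP => i; rewrite !mxE; ring.
  move=> /(congr1 (fun z => z *m 'J P 0)); rewrite -mulmxA mulVmx // mulmx1 mul0mx.
  by move=> /eqP; rewrite subr_eq0 => /eqP.
(* Where [y] has no preimage in the ball the value is the default 0; only the values on [V] are
   used. *)
pose Phi y := xget (0 : 'rV[R]_n) [set x | `|x| <= r /\ P x = y].
have PhiP y : V y -> `|Phi y| <= r /\ P (Phi y) = y.
  by move=> /solv[x Hx]; rewrite /Phi; case: xgetP => [_ -> //|/(_ x)].
have PhiB y : V y -> `|Phi y| < r.
  move=> Vy; have [b PE] := PhiP y Vy; have := inj (Phi y) 0 b.
  rewrite normr0 P0 PE !subr0 => /(_ (ltW r0)); move: Vy; rewrite /V /=; lra.
have PhiE x : `|x| <= r -> V (P x) -> Phi (P x) = x.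
  move=> xr Vx; have [b PE] := PhiP _ Vx; have := inj _ _ b xr.
  rewrite PE subrr mul0mx normr0 mulr0 normr_le0 subr_eq0 => /eqP //.
(* If [v] is killed by the Jacobian at [x], then the derivative of [G] along [v] is [v] itself,
   against the bound 1/2. *)
have JUx x : `|x| <= r -> 'J P x \in unitmx.
  move=> xr; apply: unitmx_injective => v vJ; have := bD x v xr.
  rewrite (DG _ _ (BU _ xr)) vJ mul0mx subr0 => H; apply/eqP; rewrite -normr_le0.
  have := normr_ge0 v; lra.
have PhiD y : V y -> is_diff y Phi (fun h => h *m invmx ('J P (Phi y))).
  move=> Vy; have [b PE] := PhiP y Vy; set A := 'J P (Phi y).
  pose L : {linear 'rV[R]_n -> 'rV[R]_n} := mulmxr (invmx A).
  have cA : continuous L.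
    exact: mulmxr_continuous.
  have E : Phi \o shift y = cst (Phi y) + L +o_ (0 : 'rV[R]_n) id.
    apply/eqaddoP => e e0.
    have [KA KA0 HKA] := mulmx_bound (invmx A).
    have [KN KN0 HKN] := mulmx_bound N.
    (* The increment [w] of [Phi] is at most [2 * KN] times that of [y], and inverting the Jacobian
       costs a factor [KA]; this choice leaves [e]. *)
    have e'0 : 0 < e / (KA * (2 * KN)) by rewrite divr_gt0 // !mulr_gt0.
    have /diff_locally/eqaddoP/(_ _ e'0)/nbhs_norm0P[d /= d0 Hd] := dP _ (BU _ b).
    have Nd : \forall h \near (0 : 'rV[R]_n), `|h| < (2 * KN)^-1 * d.
      apply/nbhs_norm0P; exists ((2 * KN)^-1 * d) => //=.
      by rewrite mulr_gt0 // invr_gt0 mulr_gt0.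
    have NV : \forall h \near (0 : 'rV[R]_n), V (y + h).
      by have NyV := open_nbhs_nbhs (conj oV Vy); move/nbhs0P : NyV.
    apply: filterS2 Nd NV => h hd; rewrite [y + h]addrC => Vh; rewrite !fctE /=.
    have [bh PEh] := PhiP _ Vh.
    pose w := Phi (h + y) - Phi y.
    have wh : `|w| <= 2 * KN * `|h|.
      have := inj _ _ bh b; rewrite PEh PE addrK -/w -mulrA => /le_trans; apply.
      by have := HKN h; lra.
    have wd : `|w| < d.
      by rewrite (le_lt_trans wh)// -ltr_pdivlMl ?mulr_gt0.
    have := Hd w wd; rewrite /= !fctE /= {1}/w subrK PEh PE.
    have -> : ('d P (Phi y) w : 'rV[R]_n) = w *m A.
      by rewrite -deriveE ?deriveEjacobian //; apply: dP; exact: BU.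
    have -> : h + y - (y + w *m A) = h - w *m A by rewrite opprD addrA addrK.
    move=> zw.
    have -> : Phi (h + y) - (Phi y + h *m invmx A) = - ((h - w *m A) *m invmx A).
      by rewrite mulmxBl mulmxK ?JUx // opprB opprD addrA.
    rewrite normrN (le_trans (HKA _))// (@le_trans _ _ (KA * (e / (KA * (2 * KN)) * (2 * KN * `|h|))))//.
      by rewrite ler_pM2l // (le_trans zw)// ler_pM2l.
    rewrite le_eqVlt; apply/orP; left; apply/eqP; field.
    by rewrite !gt_eqF.
  have dE := diff_unique cA E.
  by apply: DiffDef; [apply/diff_locallyP; rewrite dE|rewrite dE].
(* Bootstrap: the derivative of [Phi] is the inverse Jacobian of [P] composed with [Phi], so it is
   as regular as [Phi] is already known to be. *)
have CPhi k : Ck_on k V Phi.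
  have dPhi y : V y -> differentiable Phi y by move=> /PhiD[].
  elim: k => [|k IH]; first by move=> y Vy; apply: differentiable_continuous; exact: dPhi.
  split=> // i; apply/Ck_rVP => // j.
  pose W := [set x : 'rV[R]_n | `|x| < r].
  have oW : open W by apply: (@open_norm_lt _ _ id) => x; exact: cvg_id.
  have WU : W `<=` U by move=> x /ltW; exact: BU.
  have C1 : Ck_on k W (fun x => invmx ('J P x) i j).
    apply: (@Ck_invmx _ _ _ W (fun x => 'J P x)) oW _ _ => [x xr|a c].
      by apply: JUx; exact: ltW.
    exact: Ck_sub WU (JPE k a c).
  apply: (Ck_ext oV _ (Ck_comp oV PhiB C1 IH)) => y Vy /=.
  by have [d dE] := PhiD y Vy; rewrite deriveE // dE /= -rowE mxE.
exists Phi; split; first by exists V; split.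
  by rewrite -P0 PhiE // ?normr0 ?ltW // P0.
have N1 : \forall x \near (0 : 'rV[R]_n), `|x| < r by apply/nbhs_norm0P; exists r.
have N2 : nbhs (0 : 'rV[R]_n) V := open_nbhs_nbhs (conj oV V0).
have N3 : \forall x \near (0 : 'rV[R]_n), V (P x).
  have cP := differentiable_continuous (dP _ U0).
  by apply: (cP V); rewrite P0.
apply: filterS3 N1 N2 N3 => x xr Vx VPx; split; last exact: (PhiP x Vx).2.
by apply: PhiE => //; exact: ltW.
Qed.

End InverseFunction.

(** * Jacobians under K[G]-equivalence *)

Section KGInvariance.
Context {R : realType}.

Lemma smooth_differentiable n (W : normedModType R) (f : 'rV[R]_n -> W) :
  smooth_germ f -> differentiable f 0.
Proof. by move=> [U [[_ U0] /(_ 1%N)[df _]]]; exact: df. Qed.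

Lemma smooth_continuous n (W : normedModType R) (f : 'rV[R]_n -> W) :
  smooth_germ f -> {for 0, continuous f}.
Proof. by move=> /smooth_differentiable; exact: differentiable_continuous. Qed.

Lemma diffJ n m (f : 'rV[R]_n -> 'rV[R]_m) (x d : 'rV[R]_n) :
  ('d f x d : 'rV[R]_m) = d *m 'J f x.
Proof. by rewrite /jacobian mul_rV_lin1. Qed.

Lemma jacobian_comp m n p (u : 'rV[R]_m -> 'rV[R]_n) (f : 'rV[R]_n -> 'rV[R]_p) x :
  differentiable u x -> differentiable f (u x) ->
  'J (f \o u) x = 'J u x *m 'J f (u x).
Proof.
move=> du df; apply/row_matrixP => i; rewrite !rowE mulmxA.
rewrite -(diffJ (f \o u)) -(diffJ u) -(diffJ f).
by rewrite (diff_comp du df).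
Qed.

Lemma jacobian_coordE m n (f : 'rV[R]_m -> 'rV[R]_n) x i j :
  differentiable f x -> 'J f x i j = 'D_(delta_mx 0 i) (fun y => f y 0 j) x.
Proof. by move=> df; rewrite jacobianE // derive_rV. Qed.

Lemma cvg_fin_sum (T : Type) (F : set_system T) (FF : Filter F) (I : Type)
    (r : seq I) (f : I -> T -> R) (a : I -> R) :
  (forall i, f i @ F --> a i) ->
  (fun t => \sum_(i <- r) f i t) @ F --> \sum_(i <- r) a i.
Proof.
move=> H; elim: r => [|i r IH].
  rewrite big_nil (_ : (fun t => _) = cst 0); first exact: cvg_cst.
  by apply/funext => t; rewrite big_nil.
rewrite big_cons (_ : (fun t => _) = f i \+ (fun t => \sum_(j <- r) f j t)).
  by apply: cvgD.
by apply/funext => t; rewrite big_cons.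
Qed.

Lemma cvg_dir_deriv n m (f : 'rV[R]_n -> 'rV[R]_m) (d : 'rV[R]_n) j :
  differentiable f 0 -> f 0 = 0 ->
  (fun t : R => t^-1 * f (t *: d) 0 j) @ (0 : R)^' --> (d *m 'J f 0) 0 j.
Proof.
move=> df f0; rewrite -deriveEjacobian // derive_rV //.
have dj : derivable (fun y => f y 0 j) 0 d.
  by apply: diff_derivable; move/differentiable_rVP : df; exact.
suff -> : (fun t : R => t^-1 * f (t *: d) 0 j) =
          (fun t => t^-1 *: (f (t *: d + 0) 0 j - f 0 0 j)) by exact: dj.
by apply/funext => t; rewrite addr0 f0 mxE subr0.
Qed.

Lemma near0W n (P : set 'rV[R]_n) : (forall x, P x) -> \forall x \near (0 : 'rV[R]_n), P x.
Proof. by move=> H; near=> x; exact: H. Unshelve. all: by end_near. Qed.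

Lemma near_line n (d : 'rV[R]_n) (P : set 'rV[R]_n) :
  (\forall x \near (0 : 'rV[R]_n), P x) -> \forall t \near (0 : R)^', P (t *: d).
Proof.
move=> HP; apply: cvg_within.
have c : {for (0 : R), continuous (fun t : R => t *: d)} by exact: scalel_continuous.
by apply: (c P); rewrite scale0r.
Qed.

(** Since [u] vanishes at 0, the variation of [C] contributes only at higher order, and the limit
    sees [C 0] alone. *)
Lemma cvg_mulmx_dir n q q' (C : 'rV[R]_n -> 'M[R]_(q, q')) (u : 'rV[R]_n -> 'rV[R]_q')
    (d : 'rV[R]_n) i :
  {for 0, continuous C} -> differentiable u 0 -> u 0 = 0 ->
  (fun t : R => t^-1 * (C (t *: d) *m (u (t *: d))^T) i 0) @ (0 : R)^' -->
  (C 0 *m (d *m 'J u 0)^T) i 0.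
Proof.
move=> cC du u0; rewrite mxE.
rewrite (_ : (fun t => _) =
   (fun t : R => \sum_(k < q') C (t *: d) i k * (t^-1 * u (t *: d) 0 k))); last first.
  by apply/funext => t; rewrite mxE mulr_sumr; apply: eq_bigr => k _; rewrite mxE mulrCA.
apply: cvg_fin_sum => k; apply: cvgM; last by rewrite mxE; exact: cvg_dir_deriv.
have c0 : (fun t : R => t *: d) @ (0 : R)^' --> (0 : 'rV[R]_n).
  move=> P HP; exact: near_line.
have cCk : (fun x => C x i k) @ (0 : 'rV[R]_n) --> C 0 i k.
  by apply: (@continuous_comp _ _ _ C (fun M : 'M[R]_(q, q') => M i k)) => //; exact: coord_continuous.
exact: (cvg_comp _ _ c0 cCk).
Qed.

Lemma diffeo_jacobian_unit n (Phi Psi : 'rV[R]_n -> 'rV[R]_n) :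
  differentiable Phi 0 -> differentiable Psi 0 -> Psi 0 = 0 ->
  (\forall x \near (0 : 'rV[R]_n), Phi (Psi x) = x) -> 'J Psi 0 \in unitmx.
Proof.
move=> dPhi dPsi Psi0 H.
have dPhi' : differentiable Phi (Psi 0) by rewrite Psi0.
apply: unitmx_injective => v vJ.
have : 'D_v (Phi \o Psi) 0 = 'D_v id 0 by apply: near_eq_derive.
rewrite derive_id deriveE; last exact: differentiable_comp.
by rewrite diffJ (jacobian_comp dPsi dPhi') mulmxA vJ mul0mx.
Qed.

Variables (n q r : nat) (g g' : 'rV[R]_n -> 'rV[R]_q) (h h' : 'rV[R]_n -> 'rV[R]_r).
Hypotheses (dg : differentiable g 0) (dh : differentiable h 0).
Hypotheses (dg' : differentiable g' 0) (dh' : differentiable h' 0).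
Hypotheses (g'0 : g' 0 = 0) (h'0 : h' 0 = 0).
Hypothesis KG : KG_equiv g h g' h'.

(** Both sides of the equivalence are compared through their difference quotients along lines. As
    [g'] and [h'] vanish at 0, only the values at 0 of the coefficient matrices survive; they appear
    transposed because Jacobians act on row vectors from the right. *)
Lemma KG_jacobian : [/\ g 0 = 0, h 0 = 0 &
  exists (L : 'M[R]_n) (c : 'rV[R]_q) (s : 'S_q) (B : 'M[R]_(q, r)) (A : 'M[R]_r),
    [/\ L \in unitmx, A \in unitmx, forall i, 0 < c 0 i,
        'J g 0 = L *m ('J g' 0 *m (diag_mx c *m perm_mx s)^T + 'J h' 0 *m B^T) &
        'J h 0 = L *m ('J h' 0 *m A^T)]].
Proof.
have [Phi [Psi [C [B [A [[sPhi sPsi Phi0 Psi0 Hd] [sC sB sA] HC HA HE]]]]]] := KG.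
have [E1 E2] := nbhs_singleton HE.
have g0 : g 0 = 0.
  by apply: trmx_inj; rewrite E1 Psi0 g'0 h'0 !trmx0 !mulmx0 addr0.
have h0 : h 0 = 0 by apply: trmx_inj; rewrite E2 Psi0 h'0 !trmx0 mulmx0.
split=> //; have [c [s [c0 Cs]]] := nbhs_singleton HC.
exists ('J Psi 0), c, s, (B 0), (A 0).
have dPsi := smooth_differentiable sPsi.
have du : differentiable (g' \o Psi) 0 by apply: differentiable_comp => //; rewrite Psi0.
have dw : differentiable (h' \o Psi) 0 by apply: differentiable_comp => //; rewrite Psi0.
have u0 : (g' \o Psi) 0 = 0 by rewrite /= Psi0.
have w0 : (h' \o Psi) 0 = 0 by rewrite /= Psi0.
have Ju m (f : 'rV[R]_n -> 'rV[R]_m) : differentiable f 0 ->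
    'J (f \o Psi) 0 = 'J Psi 0 *m 'J f 0.
  move=> df; have df' : differentiable f (Psi 0) by rewrite Psi0.
  by rewrite (jacobian_comp dPsi df') Psi0.
have eqJ m (f1 f2 : 'M[R]_(n, m)) :
    (forall d i, ((d : 'rV_n) *m f1) 0 i = (d *m f2) 0 i) -> f1 = f2.
  by move=> H; apply/row_matrixP => i; rewrite !rowE; apply/rowP => j; exact: H.
have lim_uniq (a : R) (b : R) (f1 f2 : R -> R) :
   (\forall t \near (0 : R)^', f1 t = f2 t) -> f1 t @[t --> 0^'] --> a -> f2 t @[t --> 0^'] --> b -> a = b.
  move=> H12 H1 H2; have H1' : f2 t @[t --> 0^'] --> a.
    apply: cvg_trans H1; exact: (near_eq_cvg H12).
  have <- : lim (f2 @ 0^') = a by apply/cvg_lim.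
  by apply/cvg_lim.
split=> //.
- apply: (@diffeo_jacobian_unit _ Phi Psi) => //; first exact: smooth_differentiable.
  by apply: filterS Hd => x [].
- exact: nbhs_singleton HA.
- apply: eqJ => d i; rewrite -Cs.
  have H1 := @cvg_dir_deriv _ _ g d i dg g0.
  have H2 := @cvg_mulmx_dir _ _ _ C (g' \o Psi) d i (smooth_continuous sC) du u0.
  have H3 := @cvg_mulmx_dir _ _ _ B (h' \o Psi) d i (smooth_continuous sB) dw w0.
  have H4 := cvgD H2 H3.
  rewrite (lim_uniq _ _ _ _ _ H1 (H4 _)).
    transitivity ((C 0 *m (d *m 'J (g' \o Psi) 0)^T + B 0 *m (d *m 'J (h' \o Psi) 0)^T)^T 0 i).
      by rewrite [RHS]mxE [RHS]mxE.
    by rewrite linearD /= !trmx_mul !trmxK !Ju // !mulmxDr !mulmxA.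
  have := near_line d HE; apply: filterS => t [+ _].
  move=> /(congr1 (fun M : 'cV[R]_q => M i 0)); rewrite mxE => ->.
  by rewrite mxE mulrDr.
- apply: eqJ => d i.
  have H1 := @cvg_dir_deriv _ _ h d i dh h0.
  have H2 := @cvg_mulmx_dir _ _ _ A (h' \o Psi) d i (smooth_continuous sA) dw w0.
  rewrite (lim_uniq _ _ _ _ _ H1 H2).
    transitivity ((A 0 *m (d *m 'J (h' \o Psi) 0)^T)^T 0 i); first by rewrite [RHS]mxE.
    by rewrite !trmx_mul !trmxK !Ju // !mulmxA.
  have := near_line d HE; apply: filterS => t [_].
  by move=> /(congr1 (fun M : 'cV[R]_r => M i 0)); rewrite mxE => ->.
Qed.

Lemma KG_rank : \rank (row_mx ('J g 0) ('J h 0)) = \rank (row_mx ('J g' 0) ('J h' 0)).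
Proof.
have [_ _ [L [c [s [B [A [uL uA c0 -> ->]]]]]]] := KG_jacobian.
rewrite -mul_mx_row eqmxMfull; last by rewrite row_full_unit.
set D := (diag_mx c *m perm_mx s)^T.
have uD : D \in unitmx.
  rewrite unitmx_tr unitmx_mul unitmx_perm andbT unitmxE det_diag unitfE.
  by apply/prodf_neq0 => i _; rewrite gt_eqF.
(* The two Jacobians side by side are multiplied by one block triangular matrix with invertible
   diagonal blocks. *)
have -> : row_mx ('J g' 0 *m D + 'J h' 0 *m B^T) ('J h' 0 *m A^T) =
          row_mx ('J g' 0) ('J h' 0) *m block_mx D 0 B^T A^T.
  by rewrite mul_row_block mulmx0 add0r.
rewrite mxrankMfree // row_free_unit unitmxE det_lblock unitrM -!unitmxE uD.
by rewrite unitmx_tr uA.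
Qed.

End KGInvariance.

(** * Regular normal form; LICQ and MFCQ read off a normal form *)

Section Jacobians.
Context {R : realType}.

Lemma jacobian_row_mx n p q (f : 'rV[R]_n -> 'rV[R]_p) (g : 'rV[R]_n -> 'rV[R]_q) x :
  differentiable f x -> differentiable g x ->
  differentiable (fun x => row_mx (f x) (g x)) x /\
  'J (fun x => row_mx (f x) (g x)) x = row_mx ('J f x) ('J g x).
Proof.
move=> df dg.
have dr : differentiable (fun x => row_mx (f x) (g x)) x.
  apply/differentiable_rVP => i; case: (split_ordP i) => j ->.
    rewrite (_ : (fun y => _) = (fun y => f y 0 j)); last by apply/funext => y; rewrite row_mxEl.
    by move/differentiable_rVP : df; exact.
  rewrite (_ : (fun y => _) = (fun y => g y 0 j)); last by apply/funext => y; rewrite row_mxEr.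
  by move/differentiable_rVP : dg; exact.
split; first exact: dr.
apply/matrixP => i j; rewrite (jacobian_coordE i j dr).
case: (split_ordP j) => k ->.
  have -> : (fun y => row_mx (f y) (g y) 0 (lshift q k)) = (fun y => f y 0 k).
    by apply/funext => y; rewrite row_mxEl.
  by rewrite -(jacobian_coordE i k df) [RHS]row_mxEl.
have -> : (fun y => row_mx (f y) (g y) 0 (rshift p k)) = (fun y => g y 0 k).
  by apply/funext => y; rewrite row_mxEr.
by rewrite -(jacobian_coordE i k dg) [RHS]row_mxEr.
Qed.

Lemma coE n (x : 'rV[R]_n) (i : 'I_n) : co x i.+1 = x 0 i.
Proof.
rewrite /co (bigD1 i) //= big1 ?addr0 // => j /andP[/eqP[ji] /eqP]; case.
exact: val_inj.
Qed.

Lemma jacobian_mulmxr n m (E : 'M[R]_(n, m)) x :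
  differentiable (fun x : 'rV[R]_n => x *m E) x /\
  'J (fun x : 'rV[R]_n => x *m E) x = E.
Proof.
have cE := @mulmxr_continuous R _ _ E.
have d := @linear_differentiable _ _ _ (mulmxr E) x cE.
split; first exact: d.
apply/row_matrixP => i; rewrite !rowE -diffJ.
by rewrite (@diff_lin _ _ _ (mulmxr E)).
Qed.

Lemma smooth_germ_rVP n m (f : 'rV[R]_n -> 'rV[R]_m) :
  smooth_germ f <-> forall i, smooth_germ (fun x => f x 0 i).
Proof.
split=> [[U [[oU U0] H]] i|H].
  by exists U; split=> // k; have /(Ck_rVP _ _ oU) := H k; exact.
have [U HU] := choice H; pose V := (\bigcap_i U i)^°.
have oV : open V by exact: open_interior.
have VU i : V `<=` U i by move=> x /interior_subset/(_ i I).
exists V; split=> [|k].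
  split=> //; have : \forall x \near (0 : 'rV[R]_n), forall i, U i x.
    near=> x; near: x.
    apply: filter_forall => i; apply: open_nbhs_nbhs; exact: (HU i).1.
  by apply: filterS => x Ux i _; exact: Ux.
by apply/Ck_rVP => // i; apply: Ck_sub (VU i) (proj2 (HU i) k).
Unshelve. all: by end_near. Qed.

Lemma smooth_germ_cst n (W : normedModType R) (c : W) : smooth_germ (fun _ : 'rV[R]_n => c).
Proof.
exists setT; split=> [|k]; first by split=> //; exact: openT.
exact: Ck_cst.
Qed.

Lemma smooth_germ_mulmxr n m (E : 'M[R]_(n, m)) : smooth_germ (fun x : 'rV[R]_n => x *m E).
Proof.
apply/smooth_germ_rVP => i; exists setT; split=> [|k]; first by split=> //; exact: openT.
have oT : open [set: 'rV[R]_n] by exact: openT.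
apply: (Ck_ext oT (f := fun x : 'rV[R]_n => \sum_(k < n) x 0 k * E k i)).
  by move=> x _; rewrite mxE.
by apply: Ck_sum => // j _; apply: CkM => //; [exact: Ck_coord|exact: Ck_cst].
Qed.

Lemma exists_row_basis m n p (X : 'M[R]_(m, n)) :
  \rank X = p -> exists N : 'M[R]_(p, n), (N :=: X)%MS.
Proof. by move=> <-; exists (row_base X); exact: eq_row_base. Qed.

(** The map (g, h) is completed by linear forms [x *m N] to a local diffeomorphism [Psi]. In the
    coordinates [Psi] the constraints are coordinate functions, so the equivalence holds with
    identity matrices and [B = 0]. *)
Lemma KG_regular_normal_form n q r (g : 'rV[R]_n -> 'rV[R]_q) (h : 'rV[R]_n -> 'rV[R]_r) :
  smooth_germ g -> smooth_germ h -> g 0 = 0 -> h 0 = 0 ->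
  \rank (row_mx ('J g 0) ('J h 0)) = (q + r)%N ->
  KG_equiv g h (@reg_ineq R n q) (@reg_eq R n q r).
Proof.
move=> sg sh g0 h0 rk.
have le : (q + r <= n)%N by rewrite -rk rank_leq_row.
have [p np] : exists p, n = (q + r + p)%N by exists (n - (q + r))%N; rewrite subnKC.
subst n; set M := row_mx _ _ in rk.
(* The columns of [N] complete those of the Jacobian to a basis; they come from a complement of the
   row space of the transpose. *)
have [N [NE uN]] : exists N : 'M[R]_(q + r + p, p), True /\ row_mx M N \in unitmx.
  have rC : \rank (M^T)^C%MS = p by rewrite mxrank_compl mxrank_tr rk addKn.
  have [N eN] : exists N : 'M[R]_(p, q + r + p), (N :=: (M^T)^C)%MS.
    exact: exists_row_basis.
  exists N^T; split=> //; rewrite -unitmx_tr tr_row_mx trmxK -row_full_unit.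
  rewrite -sub1mx -addsmxE (adds_eqmx (eqmx_refl _) eN) sub1mx.
  exact: addsmx_compl_full.
pose Psi (x : 'rV[R]_(q + r + p)) : 'rV[R]_(q + r + p) := row_mx (row_mx (g x) (h x)) (x *m N).
have sPsi : smooth_germ Psi.
  apply/smooth_germ_rVP => i; case: (split_ordP i) => j ->.
    rewrite (_ : (fun y => _) = (fun y => row_mx (g y) (h y) 0 j)); last first.
      by apply/funext => y; rewrite row_mxEl.
    case: (split_ordP j) => k ->.
      rewrite (_ : (fun y => _) = (fun y => g y 0 k)); last by apply/funext => y; rewrite row_mxEl.
      by move/smooth_germ_rVP : sg; exact.
    rewrite (_ : (fun y => _) = (fun y => h y 0 k)); last by apply/funext => y; rewrite row_mxEr.
    by move/smooth_germ_rVP : sh; exact.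
  rewrite (_ : (fun y => _) = (fun y => (y *m N) 0 j)); last by apply/funext => y; rewrite row_mxEr.
  by have /smooth_germ_rVP := smooth_germ_mulmxr N; exact.
have Psi0 : Psi 0 = 0 by rewrite /Psi g0 h0 mul0mx !row_mx0.
have JPsi : 'J Psi 0 \in unitmx.
  have [dN JN] := jacobian_mulmxr N 0.
  have [d1 J1] := jacobian_row_mx (smooth_differentiable sg) (smooth_differentiable sh).
  by have [_ ->] := jacobian_row_mx d1 dN; rewrite J1 JN.
have [Phi [sPhi Phi0 HPhi]] := inverse_function sPsi Psi0 JPsi.
exists Phi, Psi, (fun=> 1%:M), (fun=> 0), (fun=> 1%:M); split.
- by split=> //; apply: filterS HPhi => x [].
- by split; exact: smooth_germ_cst.
- apply: near0W => x; exists (const_mx 1), 1%g; split=> [i|]; first by rewrite mxE.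
  by rewrite perm_mx1 mulmx1 diag_const_mx.
- by apply: near0W => x; exact: unitmx1.
- apply: near0W => x; rewrite !mul1mx mul0mx addr0; split; congr (_^T).
    apply/rowP => i; rewrite mxE -[i.+1]/((lshift p (lshift r i) : 'I__).+1) coE.
    by rewrite /Psi !row_mxEl.
  apply/rowP => i; rewrite mxE addnS -[(q + i).+1%N]/((lshift p (rshift q i) : 'I__).+1) coE.
  by rewrite /Psi row_mxEl row_mxEr.
Qed.

Lemma reg_jacobian n q r : (q + r <= n)%N ->
  [/\ differentiable (@reg_ineq R n q) 0, differentiable (@reg_eq R n q r) 0 &
      \rank (row_mx ('J (@reg_ineq R n q) 0) ('J (@reg_eq R n q r) 0)) = (q + r)%N].
Proof.
move=> le; have [dI JI] := @jacobian_mulmxr n (q + r) (pid_mx (q + r)) 0.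
have E : (fun x : 'rV[R]_n => x *m pid_mx (q + r)) =
         (fun x => row_mx (@reg_ineq R n q x) (@reg_eq R n q r x)).
  apply/funext => x; apply/rowP => j.
  have jn : (j < n)%N by exact: leq_trans le.
  have -> : (x *m pid_mx (q + r)) 0 j = co x j.+1.
    rewrite -[j.+1]/((Ordinal jn).+1) coE mxE (bigD1 (Ordinal jn)) //=.
    rewrite big1 => [|k kj]; first by rewrite mxE /= eqxx ltn_ord mulr1 addr0.
    rewrite mxE (_ : (k == j :> nat) = false) ?mulr0 //.
    by apply/negbTE; apply: contra kj => /eqP kj; apply/eqP/val_inj.
  case: (split_ordP j) => k ->; first by rewrite row_mxEl mxE.
  by rewrite row_mxEr mxE addnS.
have d1 : differentiable (@reg_ineq R n q) 0.
  apply/differentiable_rVP => i; rewrite E in dI.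
  have /differentiable_rVP/(_ (lshift r i)) := dI.
  rewrite (_ : (fun y => _ _ (lshift r i)) = (fun y => reg_ineq q y 0 i)) //.
  by apply/funext => y; rewrite row_mxEl.
have d2 : differentiable (@reg_eq R n q r) 0.
  apply/differentiable_rVP => i; rewrite E in dI.
  have /differentiable_rVP/(_ (rshift q i)) := dI.
  rewrite (_ : (fun y => _ _ (rshift q i)) = (fun y => reg_eq q r y 0 i)) //.
  by apply/funext => y; rewrite row_mxEr.
split=> //; have [_ <-] := jacobian_row_mx d1 d2.
by rewrite -E JI rank_pid_mx.
Qed.

Lemma active_part_smooth n q (g : 'rV[R]_n -> 'rV[R]_q) :
  smooth_germ g -> smooth_germ (active_part g).
Proof.
move=> /smooth_germ_rVP sg; apply/smooth_germ_rVP => i.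
rewrite (_ : (fun y => _) = (fun y => g y 0 (enum_val i))); first exact: sg.
by apply/funext => y; rewrite mxE.
Qed.

Lemma active_part0 n q (g : 'rV[R]_n -> 'rV[R]_q) : active_part g 0 = 0.
Proof.
apply/rowP => i; rewrite !mxE; have := enum_valP i.
by rewrite inE => /eqP.
Qed.

Lemma LICQE n q r (g : 'rV[R]_n -> 'rV[R]_q) (h : 'rV[R]_n -> 'rV[R]_r) :
  smooth_germ g -> smooth_germ h ->
  LICQ g h <->
  \rank (row_mx ('J (active_part g) 0) ('J h 0)) = (#|active g| + r)%N.
Proof.
move=> sg sh; rewrite /LICQ.
have dg := smooth_differentiable (active_part_smooth sg).
by have [_ ->] := jacobian_row_mx dg (smooth_differentiable sh).
Qed.

Lemma active_all n q (g : 'rV[R]_n -> 'rV[R]_q) : g 0 = 0 -> active g = [set: 'I_q]%SET.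
Proof. by move=> g0; apply/setP => i; rewrite !inE g0 mxE eqxx. Qed.

(** When every inequality is active, [active_part g] lists the components of [g] in the order of
    [enum_val]; the Jacobians differ by an invertible selection of columns. *)
Lemma LICQ_all_activeE n q r (g : 'rV[R]_n -> 'rV[R]_q) (h : 'rV[R]_n -> 'rV[R]_r) :
  smooth_germ g -> smooth_germ h -> g 0 = 0 ->
  LICQ g h <-> \rank (row_mx ('J g 0) ('J h 0)) = (q + r)%N.
Proof.
move=> sg sh g0; rewrite LICQE //.
have aT := active_all g0.
have ca : #|active g| = q by rewrite aT cardsT card_ord.
have dg := smooth_differentiable sg.
have da := smooth_differentiable (active_part_smooth sg).
have iA (i : 'I_q) : i \in active g by rewrite aT inE.
pose er (i : 'I_q) : 'I_#|active g| := enum_rank_in (iA i) i.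
have erK (i : 'I_q) : enum_val (er i) = i by exact: enum_rankK_in.
have E : row_mx ('J (active_part g) 0) ('J h 0) =
  row_mx ('J g 0) ('J h 0) *m block_mx (colsub enum_val 1%:M) 0 0 1%:M.
  rewrite mul_row_block !mulmx0 mulmx1 addr0 add0r mulmx_colsub mulmx1; congr row_mx.
  apply/matrixP => i j; rewrite [RHS]mxE (jacobian_coordE _ _ da).
  have -> : (fun y => active_part g y 0 j) = (fun y => g y 0 (enum_val j)).
    by apply/funext => y; rewrite mxE.
  by rewrite -(jacobian_coordE _ _ dg).
rewrite E mxrankMfree; first by rewrite ca.
apply/row_freeP.
exists (block_mx (colsub er 1%:M) 0 0 1%:M).
rewrite mulmx_block !mulmx0 !mul0mx !addr0 !add0r mulmx1 mulmx_colsub mulmx1 [RHS]scalar_mx_block.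
congr block_mx; apply/matrixP => i j; rewrite !mxE erK //.
Qed.

(** [LICQ] sees the inequalities only through [active_part g], which vanishes at 0 as the normal
    form requires, whatever the values of the inactive ones. *)
Lemma LICQ_iff_regular n q r (g : 'rV[R]_n -> 'rV[R]_q) (h : 'rV[R]_n -> 'rV[R]_r) :
  constraint_germ g h ->
  LICQ g h <->
  (#|active g| + r <= n)%N /\
  KG_equiv (active_part g) h (@reg_ineq R n #|active g|) (@reg_eq R n #|active g| r).
Proof.
move=> [sg sh h0 _]; rewrite LICQE //; have sa := active_part_smooth sg.
split=> [rk|[le KG]].
  split; first by rewrite -rk rank_leq_row.
  by apply: KG_regular_normal_form => //; exact: active_part0.
have [d1 d2 rk] := reg_jacobian le; apply: etrans rk.
apply: KG_rank => //; try exact: smooth_differentiable.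
- by apply/rowP => i; rewrite !mxE /co big1 // => j _; rewrite mxE.
- by apply/rowP => i; rewrite !mxE /co big1 // => j _; rewrite mxE.
Qed.

Lemma LICQ_iff_regular_all_active n q r (g : 'rV[R]_n -> 'rV[R]_q)
    (h : 'rV[R]_n -> 'rV[R]_r) :
  constraint_germ g h -> n = (q + r)%N -> g 0 = 0 ->
  LICQ g h <-> KG_equiv g h (@reg_ineq R n q) (@reg_eq R n q r).
Proof.
move=> [sg sh h0 _] nE g0; rewrite LICQ_all_activeE //.
split=> [rk|KG]; first exact: KG_regular_normal_form.
have le : (q + r <= n)%N by rewrite nE.
have [d1 d2 rk] := reg_jacobian le; apply: etrans rk.
apply: KG_rank => //; try exact: smooth_differentiable.
- by apply/rowP => i; rewrite !mxE /co big1 // => j _; rewrite mxE.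
- by apply/rowP => i; rewrite !mxE /co big1 // => j _; rewrite mxE.
Qed.

Section NormalForm.
Variables (n q r : nat) (g g' : 'rV[R]_n -> 'rV[R]_q) (h h' : 'rV[R]_n -> 'rV[R]_r).
Hypothesis germ : constraint_germ g h.
Hypotheses (dg' : differentiable g' 0) (dh' : differentiable h' 0).
Hypotheses (g'0 : g' 0 = 0) (h'0 : h' 0 = 0).
Hypothesis KG : KG_equiv g h g' h'.

(** [LICQ] makes the joint differential of the normal form onto, so a single value (u, w) that is
    never taken refutes it. *)
Lemma KG_not_LICQ (u : 'rV[R]_q) (w : 'rV[R]_r) :
  (forall d : 'rV[R]_n, d *m 'J g' 0 = u -> d *m 'J h' 0 = w -> False) -> ~ LICQ g h.
Proof.
have [sg sh h0 _] := germ.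
have dg := smooth_differentiable sg; have dh := smooth_differentiable sh.
have [g0 _ _] := KG_jacobian dg dh dg' dh' g'0 h'0 KG.
rewrite LICQ_all_activeE // (KG_rank dg dh dg' dh' g'0 h'0 KG) => H rk.
have /row_fullP[D DE] : row_full (row_mx ('J g' 0) ('J h' 0)) by rewrite /row_full rk.
have E : (row_mx u w *m D) *m row_mx ('J g' 0) ('J h' 0) = row_mx u w.
  by rewrite -mulmxA DE mulmx1.
by move: E; rewrite mul_mx_row => /eq_row_mx[/H]; exact.
Qed.

Lemma KG_not_MFCQ : (0 < r)%N -> 'J h' 0 = 0 -> ~ MFCQ g h.
Proof.
have [sg sh h0 _] := germ.
have dg := smooth_differentiable sg; have dh := smooth_differentiable sh.
have [_ _ [L [c [s [B [A [_ _ _ _ JE]]]]]]] := KG_jacobian dg dh dg' dh' g'0 h'0 KG.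
by move=> r0 h'E [rk _]; move: rk; rewrite JE h'E mul0mx mulmx0 mxrank0 => E; rewrite -E in r0.
Qed.

(** Without equalities, the Jacobians differ by a change of directions [L] and a positive monomial
    matrix, which only permutes the signs of the components. *)
Lemma KG_MFCQ : r = 0%N ->
  MFCQ g h <-> exists d : 'rV[R]_n, forall i, (d *m 'J g' 0) 0 i < 0.
Proof.
move=> r0; have [sg sh h0 _] := germ.
have dg := smooth_differentiable sg; have dh := smooth_differentiable sh.
have [g0 _ [L [c [s [B [A [uL _ c0 JE _]]]]]]] := KG_jacobian dg dh dg' dh' g'0 h'0 KG.
have aT := active_all g0.
have JE' : 'J g 0 = L *m ('J g' 0 *m (diag_mx c *m perm_mx s)^T).
  rewrite JE; congr (_ *m _); rewrite -[RHS]addr0; congr (_ + _).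
  by apply/matrixP => i j; rewrite !mxE big1 // => k; have := ltn_ord k; rewrite {2}r0.
have sgnE (d : 'rV[R]_n) i : (('d g (0 : 'rV[R]_n) d : 'rV[R]_q) 0 i < 0) =
    (((d *m L) *m 'J g' 0) 0 (s i) < 0).
  rewrite diffJ JE' !mulmxA trmx_mul tr_diag_mx tr_perm_mx mulmxA mul_mx_diag mxE.
  by rewrite pmulr_llt0 // -col_permE mxE.
split=> [[_ [d [Hd _]]]|[d Hd]].
  exists (d *m L) => i; rewrite -[i](permKV s) -sgnE; apply: Hd.
  by rewrite aT inE.
split; first by have := rank_leq_col ('J h 0); lia.
exists (d *m invmx L); split=> [i _|]; first by rewrite sgnE mulmxKV.
by apply/rowP => i; have := ltn_ord i; rewrite {2}r0.
Qed.

End NormalForm.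

End Jacobians.

(** * Tangent cones and 2-jets *)

Section TangentCone.
Context {R : realType}.
Implicit Types (n : nat).

(** The tangent cone without sequences: the feasible point is [t *: y], so [t] is the inverse of the
    factor t_m and [y] the rescaled point. *)
Definition tcone n (F : set 'rV[R]_n) : set 'rV[R]_n :=
  [set d | forall e : R, 0 < e -> exists (t : R) (y : 'rV[R]_n),
    [/\ 0 < t, F (t *: y), `|t *: y| < e & `|y - d| < e]].

Lemma tangent_coneE n q r (g : 'rV[R]_n -> 'rV[R]_q) (h : 'rV[R]_n -> 'rV[R]_r) :
  tangent_cone g h = tcone (feasible g h).
Proof.
apply/seteqP; split=> d.
  move=> [x [t [Fx x0 t0 txd]]] e e0.
  have H1 : \forall m \near \oo, `|x m| < e.
    by move/cvgrPdist_lt : x0 => /(_ e e0); apply: filterS => m; rewrite sub0r normrN.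
  have H2 : \forall m \near \oo, `|t m *: x m - d| < e.
    by move/cvgrPdist_lt : txd => /(_ e e0); apply: filterS => m; rewrite distrC.
  have [N _ HN] := filterI H1 H2; have [h1 h2] := HN N (leqnn N).
  exists (t N)^-1, (t N *: x N); rewrite invr_gt0 t0 scalerA mulVf ?gt_eqF // scale1r.
  by split.
move=> H; have e0 (m : nat) : 0 < (m.+1%:R : R)^-1 by rewrite invr_gt0.
have /choice[ty Hty] : forall m : nat, exists ty : R * 'rV[R]_n,
    [/\ 0 < ty.1, feasible g h (ty.1 *: ty.2), `|ty.1 *: ty.2| < m.+1%:R^-1 &
        `|ty.2 - d| < m.+1%:R^-1].
  by move=> m; have [t [y Hy]] := H _ (e0 m); exists (t, y).
have small e : 0 < e -> \forall m \near \oo, (m.+1%:R : R)^-1 < e.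
  by move=> e1; have := near_infty_natSinv_lt (PosNum e1).
exists (fun m => (ty m).1 *: (ty m).2), (fun m => (ty m).1^-1); split.
- by move=> m; have [] := Hty m.
- apply/cvgrPdist_lt => e e1; apply: filterS (small e e1) => m me.
  by rewrite sub0r normrN (lt_trans _ me) //; have [] := Hty m.
- by move=> m; rewrite invr_gt0; have [] := Hty m.
- apply/cvgrPdist_lt => e e1; apply: filterS (small e e1) => m me.
  have [t0 _ _ tyd] := Hty m.
  by rewrite scalerA mulVf ?gt_eqF // scale1r distrC (lt_trans tyd).
Qed.

Lemma tcone_closed n (F : set 'rV[R]_n) d :
  (forall e : R, 0 < e -> exists d', tcone F d' /\ `|d' - d| < e) -> tcone F d.
Proof.
move=> H e e0; have e2 : 0 < e / 2 by rewrite divr_gt0.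
have [d' [Td' dd']] := H _ e2; have [t [y [t0 Fy ty yd]]] := Td' _ e2.
exists t, y; split=> //; first by rewrite (lt_trans ty) // ltr_pdivrMr // ltr_pMr // ltr1n.
by rewrite (splitr e) -(subrKA d') (le_lt_trans (ler_normD _ _)) // ltrD.
Qed.

Lemma small_step n (b : 'rV[R]_n) (e : R) : 0 < e ->
  exists2 h : R, 0 < h & forall d, `|d + h *: b - d| < e.
Proof.
move=> e0; have K0 : 0 < `|b| + 1 by rewrite ltr_wpDl.
pose h := e / (`|b| + 1) / 2; have h0 : 0 < h by rewrite !divr_gt0.
have hE : h * (`|b| + 1) = e / 2 by rewrite /h; field; rewrite gt_eqF.
exists h => // d; rewrite addrAC subrr add0r normrZ gtr0_norm //.
by rewrite mulrDr mulr1 in hE; lra.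
Qed.

Lemma tcone_ray n (F : set 'rV[R]_n) d :
  (exists2 e : R, 0 < e & forall t, 0 < t < e -> F (t *: d)) -> tcone F d.
Proof.
move=> [a a0 H] e e0; have K0 : 0 < `|d| + 1 by rewrite ltr_wpDl.
have m0 : 0 < Num.min a (e / (`|d| + 1)) by rewrite lt_min a0 divr_gt0.
pose t := Num.min a (e / (`|d| + 1)) / 2.
have t0 : 0 < t by rewrite divr_gt0.
have tm : t < Num.min a (e / (`|d| + 1)) by rewrite ltr_pdivrMr // ltr_pMr // ltr1n.
have /andP[ta te] : (t < a) && (t < e / (`|d| + 1)) by rewrite -lt_min.
exists t, d; rewrite subrr normr0; split=> //; first by apply: H; rewrite t0.
rewrite normrZ gtr0_norm // (@le_lt_trans _ _ (t * (`|d| + 1))) //.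
  by rewrite ler_pM2l // lerDl.
by rewrite -ltr_pdivlMr.
Qed.

Definition dot n (v d : 'rV[R]_n) : R := \sum_(i < n) v 0 i * d 0 i.

Lemma dotDr n (v d e : 'rV[R]_n) : dot v (d + e) = dot v d + dot v e.
Proof. by rewrite -big_split; apply: eq_bigr => i _; rewrite mxE mulrDr. Qed.

Lemma dotZr n (v d : 'rV[R]_n) a : dot v (a *: d) = a * dot v d.
Proof. by rewrite mulr_sumr; apply: eq_bigr => i _; rewrite mxE mulrCA. Qed.

Lemma dotC n (v d : 'rV[R]_n) : dot v d = dot d v.
Proof. by apply: eq_bigr => i _; rewrite mulrC. Qed.

Lemma dotDl n (v w d : 'rV[R]_n) : dot (v + w) d = dot v d + dot w d.
Proof. by rewrite !(dotC _ d) dotDr. Qed.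

Lemma dotZl n (v d : 'rV[R]_n) a : dot (a *: v) d = a * dot v d.
Proof. by rewrite !(dotC _ d) dotZr. Qed.

Lemma dot0l n (d : 'rV[R]_n) : dot 0 d = 0.
Proof. by rewrite /dot big1 // => i _; rewrite mxE mul0r. Qed.

Lemma dot_le n (v d : 'rV[R]_n) : `|dot v d| <= n%:R * `|v| * `|d|.
Proof.
rewrite (le_trans (ler_norm_sum _ _ _))// (_ : n%:R = \sum_(k < n) 1); last first.
  by rewrite sumr_const card_ord.
rewrite 2!mulr_suml; apply: ler_sum => k _; rewrite mul1r normrM.
by rewrite ler_pM // coord_norm_le.
Qed.

Lemma dot_le0_closed n (v d : 'rV[R]_n) :
  (forall e : R, 0 < e -> exists d', dot v d' <= 0 /\ `|d' - d| < e) -> dot v d <= 0.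
Proof.
move=> H; apply/ler_addgt0Pl => e e0; rewrite addr0.
have K0 : 0 < 1 + n%:R * `|v| by rewrite ltr_pwDl // mulr_ge0.
have [d' [vd' dd']] := H (e / (1 + n%:R * `|v|)) (divr_gt0 e0 K0).
have -> : d = d' + (-1) *: (d' - d) by rewrite scaleN1r opprB addrCA subrr addr0.
rewrite dotDr -[e]add0r lerD //; apply: le_trans (ler_norm _) _.
rewrite (le_trans (dot_le _ _))// normrZ normrN normr1 mul1r.
rewrite (@le_trans _ _ ((1 + n%:R * `|v|) * `|d' - d|)) //.
  by rewrite ler_wpM2r // lerDr.
by rewrite mulrC -ler_pdivlMr // ltW.
Qed.

Lemma polar_eq n (C L : set 'rV[R]_n) : C `<=` L ->
  (forall v, polar C v -> forall d, L d -> dot v d <= 0) -> polar C = polar L.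
Proof.
move=> CL H; apply/seteqP; split=> v Hv d; first exact: H.
by move/CL; exact: Hv.
Qed.

Lemma polar_neq n (C L : set 'rV[R]_n) v w :
  (forall d, C d -> dot v d <= 0) -> L w -> 0 < dot v w -> polar C <> polar L.
Proof.
move=> Hv Lw vw E; have : polar C v by [].
by rewrite E => /(_ w Lw); rewrite leNgt vw.
Qed.

End TangentCone.

(** * Quadratic 2-jets and their trace on tangent cones *)

Section Jets.
Context {R : realType}.
Variable n : nat.
Implicit Types (x d : 'rV[R]_n) (Q f r : 'rV[R]_n -> R).

Lemma coD x y j : co (x + y) j = co x j + co y j.
Proof. by rewrite -big_split; apply: eq_bigr => i _; rewrite mxE. Qed.

Lemma coZ t x j : co (t *: x) j = t * co x j.
Proof. by rewrite mulr_sumr; apply: eq_bigr => i _; rewrite mxE. Qed.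

Lemma co_ord x j : (1 <= j <= n)%N -> {i : 'I_n | j = i.+1}.
Proof. by case: j => // j jn; exists (Ordinal (jn : (j < n)%N)). Qed.

Lemma co_out x j : ~~ (1 <= j <= n)%N -> co x j = 0.
Proof.
move=> H; rewrite /co big_pred0 // => i; apply/negbTE; apply: contra H => /eqP <-.
by rewrite ltn_ord.
Qed.

Lemma co_le x j : `|co x j| <= `|x|.
Proof.
have [jn|jn] := boolP (1 <= j <= n)%N; last by rewrite co_out // normr0.
by have [i ->] := co_ord x jn; rewrite coE coord_norm_le.
Qed.

Lemma co_continuous j : continuous (fun x => co x j).
Proof.
have [jn|jn] := boolP (1 <= j <= n)%N; last first.
  rewrite (_ : (fun x => _) = cst 0); first exact: cst_continuous.
  by apply/funext => x; rewrite co_out.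
have [i ->] := co_ord 0 jn; rewrite (_ : (fun x => _) = (fun x => x 0 i)).
  exact: coord_continuous.
by apply/funext => x; rewrite coE.
Qed.

Definition bv j : 'rV[R]_n := \row_(i < n) (i.+1 == j)%:R.

Lemma co_bv j i : (1 <= j <= n)%N -> co (bv j) i = (i == j)%:R.
Proof.
move=> jn; have [inn|inn] := boolP (1 <= i <= n)%N.
  by have [k ->] := co_ord 0 inn; rewrite coE mxE.
rewrite co_out //; case: eqVneq => // ij; by rewrite ij jn in inn.
Qed.

Lemma dot_bv j d : (1 <= j <= n)%N -> dot (bv j) d = co d j.
Proof.
move=> jn; have [k ->] := co_ord 0 jn; rewrite coE /dot (bigD1 k) //= big1 => [|i ik].
  by rewrite mxE eqxx mul1r addr0.
rewrite mxE eqSS (_ : (i == k :> nat) = false) ?mul0r //.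
by apply/negbTE; apply: contra ik => /eqP ik; apply/eqP/val_inj.
Qed.

Lemma norm_bv j : `|bv j| <= 1.
Proof.
by apply: norm_le_coord => // i k; rewrite mxE; case: eqP; rewrite ?normr1 ?normr0.
Qed.

(** Continuity, homogeneity of degree 2 and a quadratic bound are what the tangent cone arguments
    use of a quadratic form; no polynomial expression or bilinear form is carried along. *)
Definition qform Q := [/\ continuous Q, forall t x, Q (t *: x) = t ^+ 2 * Q x &
  exists2 K : R, 0 <= K & forall x, `|Q x| <= K * `|x| ^+ 2].

Definition order2 f := exists2 K : R, 0 <= K & forall x, `|x| <= 1 -> `|f x| <= K * `|x| ^+ 2.

Definition order3 r := continuous r /\
  exists2 K : R, 0 <= K & forall x, `|x| <= 1 -> `|r x| <= K * `|x| ^+ 3.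

Definition jet2 f Q := qform Q /\ order3 (fun x => f x - Q x).

Lemma qform0 : qform (fun=> 0).
Proof.
split; [exact: cst_continuous|by move=> t x; rewrite mulr0|].
by exists 0 => // x; rewrite normr0 mul0r.
Qed.

Lemma qformD Q1 Q2 : qform Q1 -> qform Q2 -> qform (fun x => Q1 x + Q2 x).
Proof.
move=> [c1 h1 [K1 K10 k1]] [c2 h2 [K2 K20 k2]]; split.
- by move=> x; apply: continuousD; [exact: c1|exact: c2].
- by move=> t x; rewrite h1 h2 mulrDr.
- exists (K1 + K2) => [|x]; first by rewrite addr_ge0.
  by rewrite (le_trans (ler_normD _ _))// mulrDl lerD.
Qed.

Lemma qformZ c Q : qform Q -> qform (fun x => c * Q x).
Proof.
move=> [c1 h1 [K1 K10 k1]]; split.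
- by move=> x; apply: (@continuousM _ _ (cst c) Q); [exact: cst_continuous|exact: c1].
- by move=> t x; rewrite h1 mulrCA.
- by exists (`|c| * K1) => [|x]; [rewrite mulr_ge0|rewrite normrM -mulrA ler_wpM2l].
Qed.

Lemma qform_co2 i j : qform (fun x => co x i * co x j).
Proof.
split.
- by move=> x; apply: (@continuousM _ _ (fun x => co x i)); exact: co_continuous.
- by move=> t x; rewrite !coZ; ring.
- by exists 1 => // x; rewrite mul1r normrM expr2 ler_pM // co_le.
Qed.

Lemma qform_ext Q1 Q2 : Q1 =1 Q2 -> qform Q1 -> qform Q2.
Proof. by move=> /funext ->. Qed.

Lemma qform_sum (I : Type) (s : seq I) (P : pred I) (F : I -> 'rV[R]_n -> R) :
  (forall i, P i -> qform (F i)) -> qform (fun x => \sum_(i <- s | P i) F i x).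
Proof.
move=> H; elim: s => [|a s IH].
  by apply: qform_ext qform0 => x; rewrite big_nil.
have [Pa|Pa] := boolP (P a).
  by apply: qform_ext (qformD (H _ Pa) IH) => x; rewrite big_cons Pa.
by apply: qform_ext IH => x; rewrite big_cons (negbTE Pa).
Qed.

Lemma qform_sqr i : qform (fun x => co x i ^+ 2).
Proof. by apply: qform_ext (qform_co2 i i) => x; rewrite expr2. Qed.

Lemma qform_sq eps a : qform (sq eps a).
Proof. by apply: qform_sum => j _; apply: qformZ; exact: qform_sqr. Qed.

Lemma order3D r1 r2 : order3 r1 -> order3 r2 -> order3 (fun x => r1 x + r2 x).
Proof.
move=> [c1 [K1 K10 k1]] [c2 [K2 K20 k2]]; split.
  by move=> x; apply: continuousD; [exact: c1|exact: c2].
exists (K1 + K2) => [|x x1]; first by rewrite addr_ge0.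
by rewrite (le_trans (ler_normD _ _))// mulrDl lerD // ?k1 ?k2.
Qed.

Lemma order3Z c r : order3 r -> order3 (fun x => c * r x).
Proof.
move=> [c1 [K1 K10 k1]]; split.
  by move=> x; apply: (@continuousM _ _ (cst c) r); [exact: cst_continuous|exact: c1].
exists (`|c| * K1) => [|x x1]; first by rewrite mulr_ge0.
by rewrite normrM -mulrA ler_wpM2l // k1.
Qed.

Lemma order3_exp i k : (3 <= k)%N -> order3 (fun x => co x i ^+ k).
Proof.
move=> k3; split.
  elim: k {k3} => [|k IH].
    rewrite (_ : (fun x => _) = cst 1); first exact: cst_continuous.
    by apply/funext => x; rewrite expr0.
  rewrite (_ : (fun x => _) = (fun x => co x i) \* (fun x => co x i ^+ k)).
    by move=> x; apply: continuousM; [exact: co_continuous|exact: IH].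
  by apply/funext => x; rewrite exprS.
exists 1 => // x x1; rewrite mul1r normrX.
rewrite (@le_trans _ _ (`|x| ^+ k)) // ?lerXn2r ?nnegrE ?co_le //.
by rewrite ler_wiXn2l.
Qed.

Lemma order3_co3 i j k : order3 (fun x => co x i * co x j * co x k).
Proof.
have [c _ [K K0 H]] := qform_co2 i j; split.
  by move=> x; apply: (@continuousM _ _ _ (fun x => co x k)); [exact: c|exact: co_continuous].
exists K => // x x1; rewrite normrM exprSr mulrA ler_pM // ?co_le //.
Qed.

Lemma order3_ext r1 r2 : r1 =1 r2 -> order3 r1 -> order3 r2.
Proof. by move=> /funext ->. Qed.

Lemma order3_0 : order3 (fun=> 0).
Proof.
split; first exact: cst_continuous.
by exists 0 => // x _; rewrite normr0 mul0r.
Qed.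

Lemma jet2_intro f Q r : qform Q -> order3 r -> (forall x, f x = Q x + r x) -> jet2 f Q.
Proof.
move=> qQ r3 E; split=> //; apply: order3_ext r3 => x.
by rewrite E addrC addKr.
Qed.

Lemma jet2_opp f Q : jet2 f Q -> jet2 (fun x => - f x) (fun x => - Q x).
Proof.
move=> [qQ rQ]; split.
  by apply: qform_ext (qformZ (-1) qQ) => x; rewrite mulN1r.
by apply: order3_ext (order3Z (-1) rQ) => x; rewrite mulN1r opprB opprK addrC.
Qed.

Lemma jet2_continuous f Q : jet2 f Q -> continuous f.
Proof.
move=> [[cQ _ _] [cr _]] x.
have -> : f = Q \+ (fun x => f x - Q x) by apply/funext => y; rewrite /= addrC subrK.
by apply: (@continuousD _ _ _ Q); [exact: cQ|exact: cr].
Qed.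

Lemma jet2_order2 f Q : jet2 f Q -> order2 f.
Proof.
move=> [[_ _ [K K0 HK]] [_ [K' K'0 HK']]]; exists (K + K'); first by rewrite addr_ge0.
move=> x x1; have := HK x; have := HK' x x1.
move=> h1 h2; rewrite (_ : f x = Q x + (f x - Q x)); last by rewrite addrC subrK.
rewrite (le_trans (ler_normD _ _))// mulrDl lerD // (le_trans h1)// ler_wpM2l // exprS.
by rewrite ler_piMl // exprn_ge0.
Qed.

(* The error of the 2-jet along [t *: y] is [O(t ^+ 3)], uniformly for [y] bounded. *)
Lemma jet2_scaled f Q d : jet2 f Q -> forall e : R, 0 < e -> exists2 a : R, 0 < a &
  forall t y, 0 < t -> `|t *: y| < a -> `|y - d| < a ->
    `|f (t *: y) - t ^+ 2 * Q d| < t ^+ 2 * e.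
Proof.
move=> [[cQ hQ _] [_ [K K0 HK]]] e e0.
have e2 : 0 < e / 2 by rewrite divr_gt0.
have /cvgrPdist_lt/(_ _ e2) := cQ d => /nbhs_normP[b /= b0 Hb].
pose M := `|d| + 1; have M0 : 0 < M by rewrite ltr_wpDl.
have K1 : 0 < (K + 1) * M ^+ 2 by rewrite mulr_gt0 ?ltr_wpDl // exprn_gt0.
(* The three bounds serve, in turn, the continuity of [Q] at [d], the validity of the cubic estimate
   together with the bound [M] on [y], and a cubic error of at most half of [e]. *)
pose a := Num.min b (Num.min 1 (e / 2 / ((K + 1) * M ^+ 2))).
exists a; first by rewrite !lt_min b0 ltr01 divr_gt0.
move=> t y t0; rewrite !lt_min => /and3P[_ ty1 tye] /and3P[yb y1 _].
have h1 : `|Q y - Q d| < e / 2 by rewrite distrC; apply: Hb; rewrite /= distrC.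
have yM : `|y| <= M.
  have -> : y = d + (y - d) by rewrite addrC subrK.
  by rewrite (le_trans (ler_normD _ _))// lerD2l ltW.
have h2 := HK _ (ltW ty1); rewrite hQ in h2.
have E : f (t *: y) - t ^+ 2 * Q d =
  (f (t *: y) - t ^+ 2 * Q y) + t ^+ 2 * (Q y - Q d) by ring.
rewrite E (le_lt_trans (ler_normD _ _))// [e]splitr [X in _ < X]mulrDr.
rewrite ler_ltD //; last by rewrite normrM gtr0_norm ?exprn_gt0 // ltr_pM2l ?exprn_gt0.
rewrite (le_trans h2)//.
have -> : K * `|t *: y| ^+ 3 = t ^+ 2 * (K * `|y| ^+ 2 * `|t *: y|).
  by rewrite !normrZ gtr0_norm //; ring.
rewrite ler_wpM2l ?exprn_ge0 //; first exact: ltW.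
rewrite (@le_trans _ _ ((K + 1) * M ^+ 2 * `|t *: y|)) //.
  by rewrite ler_wpM2r // ler_pM ?exprn_ge0 // ?lerDl // lerXn2r ?nnegrE // ltW.
by rewrite mulrC -ler_pdivlMr // ltW.
Qed.

Lemma jet2_le0 (F : set 'rV[R]_n) f Q d : jet2 f Q -> (forall x, F x -> f x <= 0) ->
  tcone F d -> Q d <= 0.
Proof.
move=> J FH T; rewrite leNgt; apply/negP => Qd.
have [a a0 Ha] := jet2_scaled d J Qd; have [t [y [t0 Fy ty yd]]] := T a a0.
have := Ha t y t0 ty yd; have := FH _ Fy => fle.
have tQ : 0 < t ^+ 2 * Q d by rewrite mulr_gt0 // exprn_gt0.
by rewrite ler0_norm ?subr_le0; [|rewrite (le_trans fle) // ltW]; lra.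
Qed.

Lemma jet2_eq0 (F : set 'rV[R]_n) f Q d : jet2 f Q -> (forall x, F x -> f x = 0) ->
  tcone F d -> Q d = 0.
Proof.
move=> J FH T; apply/eqP; rewrite eq_le; apply/andP; split.
  by apply: (jet2_le0 J _ T) => x /FH ->.
rewrite -oppr_le0; apply: (jet2_le0 (jet2_opp J) _ T) => x /FH ->.
by rewrite oppr0.
Qed.

Lemma jet2_lt0_ray f Q d : jet2 f Q -> Q d < 0 ->
  exists2 a : R, 0 < a & forall t, 0 < t < a -> f (t *: d) < 0.
Proof.
move=> J Qd; have nQ : 0 < - Q d by rewrite oppr_gt0.
have [a a0 Ha] := jet2_scaled d J nQ.
have K0 : 0 < `|d| + 1 by rewrite ltr_wpDl.
exists (a / (`|d| + 1)) => [|t /andP[t0 ta]]; first by rewrite divr_gt0.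
have := Ha t d t0 _ _; rewrite subrr normr0 => /(_ _ a0).
rewrite normrZ gtr0_norm // => H.
have /H : t * `|d| < a.
  rewrite (@le_lt_trans _ _ (t * (`|d| + 1))) // ?ler_pM2l // ?lerDl //.
  by rewrite -ltr_pdivlMr.
move=> /(le_lt_trans (ler_norm _)); lra.
Qed.

Lemma jet2_gt0_ray f Q d : jet2 f Q -> 0 < Q d ->
  exists2 a : R, 0 < a & forall t, 0 < t < a -> 0 < f (t *: d).
Proof.
move=> J Qd; have nQ : - Q d < 0 by rewrite oppr_lt0.
have [a a0 Ha] := jet2_lt0_ray (jet2_opp J) nQ; exists a => // t /Ha.
by rewrite oppr_lt0.
Qed.

End Jets.
Arguments bv {R n} j%_N.

(** * One singular equality constraint on an orthant *)

Section EqualityProblem.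
Context {R : realType}.
Variables (n q : nat).
Implicit Types (x d : 'rV[R]_n) (f Q : 'rV[R]_n -> R).

(** The linearised cone when the equality has zero differential at 0; for [q] = 0 it is the whole
    space, which is the case of List A. *)
Definition orthant : set 'rV[R]_n := [set x | forall i, (1 <= i <= q)%N -> co x i <= 0].

Definition eq_feasible f : set 'rV[R]_n := [set x | orthant x /\ f x = 0].

Lemma orthantD x y : orthant x -> orthant y -> orthant (x + y).
Proof.
move=> Hx Hy i iq; rewrite coD -[0]addr0 lerD //; [exact: Hx|exact: Hy].
Qed.

Lemma orthantZ t x : 0 <= t -> orthant x -> orthant (t *: x).
Proof. by move=> t0 Hx i iq; rewrite coZ mulr_ge0_le0 // Hx. Qed.

Lemma orthant_bv c a : (q < c <= n)%N -> orthant (a *: bv c).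
Proof.
move=> cn i iq; rewrite coZ co_bv; last by lia.
by rewrite (_ : (i == c) = false) ?mulr0 //; apply/eqP; lia.
Qed.

Lemma orthant_free x c a : (q < c <= n)%N -> orthant x -> orthant (x + a *: bv c).
Proof. by move=> cn Hx; apply: orthantD => //; exact: orthant_bv. Qed.

Lemma orthant_closed d (F : set 'rV[R]_n) : F `<=` orthant -> tcone F d -> orthant d.
Proof.
move=> FO T i iq; apply/ler_addgt0Pl => e e0; rewrite addr0.
have [t [y [t0 /FO Fy _ yd]]] := T e e0.
have yi : co y i <= 0 by have := Fy i iq; rewrite coZ pmulr_rle0.
have -> : d = y + (-1) *: (y - d) by rewrite scaleN1r opprB addrCA subrr addr0.
rewrite coD coZ -[e]add0r lerD //; apply: le_trans (ler_norm _) _.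
by rewrite normrM normrN normr1 mul1r (le_trans (co_le _ _)) // ltW.
Qed.

Variables (f Q : 'rV[R]_n -> R).
Hypothesis J : jet2 f Q.
Let T := tcone (eq_feasible f).

Lemma eq_tcone_sub : T `<=` orthant.
Proof. by move=> d; apply: orthant_closed => x []. Qed.

Lemma eq_tconeQ d : T d -> Q d = 0.
Proof. by apply: (jet2_eq0 J) => x []. Qed.

(** For small [t], [f] has opposite signs at [t *: u] and [t *: w], hence a zero on the segment
    between them. The segment stays in the orthant and, after division by [t], within [e] of [d]. *)
Lemma eq_tcone_sign d : (forall e : R, 0 < e -> exists u w,
    [/\ orthant u, orthant w, `|u - d| < e, `|w - d| < e & 0 < Q u /\ Q w < 0]) -> T d.
Proof.
move=> H e e0; have [u [w [Ou Ow ud wd [Qu Qw]]]] := H e e0.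
have [a1 a10 H1] := jet2_gt0_ray J Qu; have [a2 a20 H2] := jet2_lt0_ray J Qw.
pose M := `|d| + e; have M0 : 0 < M by rewrite ltr_wpDl.
pose m := Num.min a1 (Num.min a2 (e / M)); pose t := m / 2.
have m0 : 0 < m by rewrite !lt_min a10 a20 divr_gt0.
have t0 : 0 < t by rewrite divr_gt0.
have tm : t < m by rewrite ltr_pdivrMr // ltr_pMr // ltr1n.
have /and3P[t1 t2 t3] : [&& t < a1, t < a2 & t < e / M] by rewrite -!lt_min.
have fu : 0 < f (t *: u) by apply: H1; rewrite t0.
have fw : f (t *: w) < 0 by apply: H2; rewrite t0.
pose y (s : R) := w + s *: (u - w).
have cf := jet2_continuous J.
have cy : continuous (fun s : R => f (t *: y s)).
  move=> s; apply: (@continuous_comp _ _ _ (fun s : R => t *: y s) f); last exact: cf.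
  apply: (@continuous_comp _ _ _ y (fun z => t *: z)); last exact: scaler_continuous.
  apply: (@continuousD _ _ _ (cst w) (fun s : R => s *: (u - w))).
    exact: cst_continuous.
  exact: scalel_continuous.
have [s] : exists2 s, s \in `[0, 1]%R & f (t *: y s) = 0.
  apply: (@IVT R (fun s => f (t *: y s))) => //.
    exact: continuous_subspaceT.
  rewrite /y scale0r addr0 scale1r addrC subrK.
  by rewrite ge_min le_max (ltW fw) (ltW fu) orbT.
rewrite in_itv /= => /andP[s0 s1] fs.
have yE : y s = (1 - s) *: w + s *: u.
  by rewrite /y scalerBl scale1r scalerBr addrAC addrA.
have Oy : orthant (y s) by rewrite yE; apply: orthantD; apply: orthantZ; rewrite ?subr_ge0.
have yd : `|y s - d| < e.
  have -> : y s - d = (1 - s) *: (w - d) + s *: (u - d).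
    by rewrite yE !scalerBr addrACA -opprD -scalerDl subrK scale1r.
  rewrite (le_lt_trans (ler_normD _ _))// !normrZ !ger0_norm ?subr_ge0 //.
  have [->|sn] := eqVneq s 0; first by rewrite subr0 mul1r mul0r addr0.
  have s0' : 0 < s by rewrite lt_neqAle eq_sym sn.
  rewrite (@le_lt_trans _ _ ((1 - s) * e + s * `|u - d|)) //.
    by rewrite lerD2r ler_wpM2l ?subr_ge0 // ltW.
  have : s * `|u - d| < s * e by rewrite ltr_pM2l.
  by lra.
exists t, (y s); split=> //; first by split=> //; apply: orthantZ => //; exact: ltW.
rewrite normrZ gtr0_norm // (@lt_trans _ _ (t * M)) //; last by rewrite -ltr_pdivlMr.
rewrite ltr_pM2l // (_ : y s = d + (y s - d)); last by rewrite addrC subrK.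
by rewrite (le_lt_trans (ler_normD _ _))// ltrD2l.
Qed.

Lemma eq_not_ACQ j : (q < j <= n)%N -> Q (bv j) != 0 -> T <> orthant.
Proof.
move=> jn Qj E; have : T (bv j) by rewrite E -[bv j]scale1r; exact: orthant_bv.
by move=> /eq_tconeQ Q0; rewrite Q0 eqxx in Qj.
Qed.

Section BothSigns.
Variables i j : nat.
Hypotheses (iqn : (q < i <= n)%N) (jqn : (q < j <= n)%N).
Hypothesis Qi : forall x a, Q (x + a *: bv i) = Q x + a * (2 * co x i + a).
Hypothesis Qj : forall x a, Q (x + a *: bv j) = Q x - a * (2 * co x j + a).

Lemma eq_tcone_null d : orthant d -> Q d = 0 -> T d.
Proof.
move=> Od Qd; apply: eq_tcone_sign => e e0; pose h := e / 2.
have h0 : 0 < h by rewrite divr_gt0.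
have he : h < e by rewrite ltr_pdivrMr // ltr_pMr // ltr1n.
have small c a : `|a| = h -> `|d + a *: bv c - d| < e.
  move=> ah; rewrite addrAC subrr add0r normrZ ah (le_lt_trans _ he) //.
  by rewrite ler_piMr ?norm_bv // ltW.
(* The step has the sign of the coordinate, so s (2 x + s) is positive whatever the size of x;
   adding it along [i] raises [Q], along [j] lowers it. *)
pose s c : R := if 0 <= co d c then h else - h.
have sh c : `|s c| = h by rewrite /s; case: ifP; rewrite ?normrN gtr0_norm.
have pos c : 0 < s c * (2 * co d c + s c).
  have h2 : 0 < h * h by rewrite mulr_gt0.
  rewrite /s; case: ifP => [c0|/negbT]; first by have := mulr_ge0 (ltW h0) c0; lra.
  rewrite -ltNge => c0; have : h * co d c < 0 by rewrite pmulr_rlt0.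
  by lra.
exists (d + s i *: bv i), (d + s j *: bv j); split; try exact: small.
- exact: orthant_free.
- exact: orthant_free.
- by rewrite Qi Qj Qd add0r sub0r oppr_lt0.
Qed.

(** Moving [d] along the axis whose square has the sign opposite to [Q d] meets the cone Q = 0 on
    either side of [d]. So [d] lies between two tangent directions, and the polar condition passes
    to it. *)
Lemma eq_GCQ_both_signs : polar T = polar orthant.
Proof.
apply: polar_eq; first exact: eq_tcone_sub.
have key c (sg : R) v d : (q < c <= n)%N -> polar T v -> orthant d ->
    (forall x a, Q (x + a *: bv c) = Q x + sg * (a * (2 * co x c + a))) ->
    sg ^+ 2 = 1 -> sg * Q d <= 0 -> dot v d <= 0.
  move=> cn Pv Od Qc sg2 Qd.
  (* The points of the line through [d] along e_c where Q vanishes have c-th coordinate [r] and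
     [- r], and [r] is at least the absolute value of [co d c]. *)
  pose r := Num.sqrt (co d c ^+ 2 - sg * Q d).
  have D0 : 0 <= co d c ^+ 2 - sg * Q d by rewrite subr_ge0 (le_trans Qd) // sqr_ge0.
  have r2 : r ^+ 2 = co d c ^+ 2 - sg * Q d by rewrite sqr_sqrtr.
  have r0 : 0 <= r by rewrite sqrtr_ge0.
  have rd : `|co d c| <= r.
    by rewrite -(@ler_pXn2r _ 2) ?nnegrE // r2 real_normK ?num_real // lerDl oppr_ge0.
  have Td b : b ^+ 2 = r ^+ 2 -> T (d + (b - co d c) *: bv c).
    move=> br; apply: eq_tcone_null; first exact: orthant_free.
    rewrite Qc; have -> : (b - co d c) * (2 * co d c + (b - co d c)) = b ^+ 2 - co d c ^+ 2 by ring.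
    rewrite br r2; have -> : Q d + sg * (co d c ^+ 2 - sg * Q d - co d c ^+ 2) = (1 - sg ^+ 2) * Q d by ring.
    by rewrite sg2 subrr mul0r.
  have H1 : dot v d + (r - co d c) * dot v (bv c) <= 0.
    by rewrite -dotZr -dotDr; exact: (Pv _ (Td _ (erefl _))).
  have H2 : dot v d + (- r - co d c) * dot v (bv c) <= 0.
    by rewrite -dotZr -dotDr; apply: (Pv _ (Td _ _)); rewrite sqrrN.
  move: rd; rewrite ler_norml => /andP[ra rb].
  have [v0|v0] := lerP 0 (dot v (bv c)).
    have : 0 <= (r - co d c) * dot v (bv c) by rewrite mulr_ge0 // subr_ge0.
    lra.
  have : 0 <= (- r - co d c) * dot v (bv c) by apply: mulr_le0; [lra|exact: ltW].
  lra.
move=> v Pv d Od; have [Qd|Qd] := lerP (Q d) 0.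
  apply: (key i 1 v d) => //; last by rewrite mul1r.
    by move=> x a; rewrite mul1r Qi.
  by rewrite expr1n.
apply: (key j (-1) v d) => //; last by rewrite mulN1r oppr_le0 ltW.
  by move=> x a; rewrite mulN1r Qj.
by rewrite sqrrN expr1n.
Qed.

End BothSigns.

(* If both directions [bv c] and [- bv c] are tangent, every [v] in the polar
   vanishes on [bv c], so each direction of the orthant may be moved along
   [bv c] onto the cone [Q = 0]. *)
Lemma eq_GCQ_shear c (m : 'rV[R]_n -> R) b : (q < c <= n)%N ->
  T (bv c) -> T (- bv c) ->
  (forall x a, Q (x + a *: bv c) = Q x + a * m x) ->
  (forall x a, m (x + a *: b) = m x + a * m b) -> orthant b -> m b != 0 ->
  polar T = polar orthant.
Proof.
move=> cn T1 T2 Qc mb Ob mb0; apply: polar_eq; first exact: eq_tcone_sub.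
move=> v Pv.
have vc : dot v (bv c) = 0.
  apply/eqP; rewrite eq_le; apply/andP; split; first exact: (Pv _ T1).
  by have := Pv _ T2; rewrite -/(dot _ _) -scaleN1r dotZr mulN1r oppr_le0.
have main d : orthant d -> m d != 0 -> dot v d <= 0.
  (* This [a] brings [d] onto Q = 0; there [m d] is nonzero, so small steps along [bv c] make Q
     change sign. *)
  move=> Od md; pose a := - Q d / m d.
  have Td : T (d + a *: bv c).
    apply: eq_tcone_sign => e e0; pose h := e / 2 / Num.max 1 `|m d|.
    pose s : R := if 0 < m d then h else - h.
    have M1 : 0 < Num.max 1 `|m d| by rewrite lt_max ltr01.
    have h0 : 0 < h by rewrite !divr_gt0.
    have he : h < e.
      rewrite /h ltr_pdivrMr // (@lt_le_trans _ _ e) //.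
        by rewrite ltr_pdivrMr // ltr_pMr // ltr1n.
      by rewrite ler_peMr ?le_max ?lexx // ltW.
    have sh : `|s| = h by rewrite /s; case: ifP; rewrite ?normrN gtr0_norm.
    have sm : 0 < s * m d.
      rewrite /s; case: ifPn => m0; first by rewrite mulr_gt0.
      by rewrite nmulr_rgt0 ?oppr_lt0 // lt_neqAle md leNgt.
    have E (z : R) : d + (a + z) *: bv c - (d + a *: bv c) = z *: bv c.
      by rewrite scalerDl opprD addrACA subrr add0r addrAC subrr add0r.
    have QE (z : R) : Q (d + (a + z) *: bv c) = z * m d.
      by rewrite Qc /a mulrDl divfK // addrA subrr add0r.
    exists (d + (a + s) *: bv c), (d + (a - s) *: bv c); split.
    - exact: orthant_free.
    - exact: orthant_free.
    - by rewrite E normrZ sh (le_lt_trans _ he) // ler_piMr ?norm_bv // ltW.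
    - by rewrite E normrZ normrN sh (le_lt_trans _ he) // ler_piMr ?norm_bv // ltW.
    - by rewrite !QE mulNr oppr_lt0.
  by have := Pv _ Td; rewrite -/(dot _ _) dotDr dotZr vc mulr0 addr0.
(* Directions with [m d = 0] are limits of the directions [d + h *: b], already treated. *)
move=> d Od; have [md|] := eqVneq (m d) 0; last exact: main.
apply: dot_le0_closed => e e0; have [h h0 Hh] := small_step b e0.
exists (d + h *: b); split; last exact: Hh.
  apply: main; first by apply: orthantD => //; apply: orthantZ => //; exact: ltW.
  by rewrite mb md add0r mulf_neq0 // gt_eqF.
Qed.

End EqualityProblem.

(** * Inequality constraints with a degenerate last one, case l_1 = 0 *)

Section InequalityProblem.
Context {R : realType}.
Variables (n q l : nat).
Implicit Types (x d : 'rV[R]_n) (f Q : 'rV[R]_n -> R).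

Definition ineq_feasible f : set 'rV[R]_n :=
  [set x | (forall i, (1 <= i < q)%N -> co x i <= 0) /\
           - (\sum_(1 <= j < l.+1) co x j) + f x <= 0].

(** The linear part of the last inequality requires x_1 + ... + x_l >= 0; with all these coordinates
    nonpositive, they vanish. *)
Definition ineq_linear : set 'rV[R]_n :=
  [set x | (forall i, (1 <= i < q)%N -> co x i <= 0) /\
           forall j, (1 <= j <= l)%N -> co x j = 0].

Lemma ineq_linearD x y : ineq_linear x -> ineq_linear y -> ineq_linear (x + y).
Proof.
move=> [x1 x2] [y1 y2]; split=> i iq; last by rewrite coD x2 // y2 // addr0.
by rewrite coD -[0]addr0 lerD //; [exact: x1|exact: y1].
Qed.

Lemma ineq_linearZ t x : 0 <= t -> ineq_linear x -> ineq_linear (t *: x).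
Proof.
move=> t0 [x1 x2]; split=> i iq; rewrite coZ; first by rewrite mulr_ge0_le0 // x1.
by rewrite x2 // mulr0.
Qed.

Hypothesis lq : (l < q)%N.

Lemma ineq_linear_bv c a : (q <= c <= n)%N -> ineq_linear (a *: bv c).
Proof.
move=> cn; split=> i iq; rewrite coZ co_bv; try lia.
  by rewrite (_ : (i == c) = false) ?mulr0 //; apply/eqP; lia.
by rewrite (_ : (i == c) = false) ?mulr0 //; apply/eqP; lia.
Qed.

Lemma ineq_linear_neg c a : (l < c < q)%N -> (c <= n)%N -> 0 <= a ->
  ineq_linear (- a *: bv c).
Proof.
move=> cq cn a0; split=> i iq; rewrite coZ co_bv; try lia.
  by case: eqP; rewrite ?mulr1 ?mulr0 // oppr_le0.
by rewrite (_ : (i == c) = false) ?mulr0 //; apply/eqP; lia.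
Qed.

Lemma ineq_linear_free x c a : (q <= c <= n)%N -> ineq_linear x -> ineq_linear (x + a *: bv c).
Proof. by move=> cn Hx; apply: ineq_linearD => //; exact: ineq_linear_bv. Qed.

Variables (f Q : 'rV[R]_n -> R).
Hypothesis J : jet2 f Q.
Let T := tcone (ineq_feasible f).

(** The first l coordinates are nonpositive, so the last inequality bounds [f] by a nonpositive sum;
    hence the 2-jet test applies to [f] alone. *)
Lemma ineq_feasible_le0 x : ineq_feasible f x -> f x <= 0.
Proof.
move=> [x1 x2]; rewrite (le_trans (y := \sum_(1 <= j < l.+1) co x j)) //.
  by rewrite -subr_le0 addrC.
rewrite big_nat; apply: sumr_le0 => j jl; apply: x1; lia.
Qed.

Lemma ineq_tconeQ d : T d -> Q d <= 0.
Proof. by apply: (jet2_le0 J); exact: ineq_feasible_le0. Qed.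

Lemma ineq_tcone_sub : T `<=` ineq_linear.
Proof.
move=> d Td.
have near0 i (e : R) : 0 < e -> forall y, `|y - d| < e -> `|co d i - co y i| <= e.
  move=> e0 y yd; rewrite -mulN1r -coZ -coD scaleN1r (le_trans (co_le _ _)) //.
  by rewrite distrC ltW.
have le0 i : (1 <= i < q)%N -> co d i <= 0.
  move=> iq; apply/ler_addgt0Pl => e e0; rewrite addr0.
  have [t [y [t0 [Fy _] _ yd]]] := Td e e0.
  have yi : co y i <= 0 by have := Fy i iq; rewrite coZ pmulr_rle0.
  have := near0 i e e0 y yd; rewrite ler_norml => /andP[_]; lra.
split=> // j jl.
(* On feasible points the linear sum is at least [f], which is O(|x|^2); divided by [t], this error
   disappears in the limit. *)
have S0 : 0 <= \sum_(1 <= i < l.+1) co d i.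
  rewrite -oppr_le0; apply/ler_addgt0Pl => e e0; rewrite addr0.
  have [K K0 HK] := jet2_order2 J.
  pose M := `|d| + 1; have M0 : 0 < M by rewrite ltr_wpDl.
  (* [K * M] accounts for the quadratic error, [l%:R] for replacing [d] by [y] in l coordinates, and
     1 keeps the constant positive. *)
  have C0 : 0 < K * M + l%:R + 1 by rewrite ltr_wpDl // addr_ge0 ?ler0n // mulr_ge0 // ltW.
  pose a := Num.min 1 (e / (K * M + l%:R + 1)).
  have a0 : 0 < a by rewrite lt_min ltr01 divr_gt0.
  have [t [y [t0 [Fy1 Fy2] ty yd]]] := Td a a0.
  have [a1 ae] : a <= 1 /\ a <= e / (K * M + l%:R + 1).
    by rewrite /a !ge_min !lexx /= orbT.
  have fb : `|f (t *: y)| <= K * `|t *: y| ^+ 2.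
    by apply: HK; rewrite (le_trans (ltW ty)).
  have yM : `|y| <= M.
    have -> : y = d + (y - d) by rewrite addrC subrK.
    by rewrite (le_trans (ler_normD _ _))// lerD2l (le_trans (ltW yd)).
  have Sy : - (\sum_(1 <= i < l.+1) co y i) <= K * a * M.
    have E : \sum_(1 <= i < l.+1) co (t *: y) i = t * \sum_(1 <= i < l.+1) co y i.
      by rewrite mulr_sumr; apply: eq_bigr => i _; rewrite coZ.
    rewrite E in Fy2; rewrite -(ler_pM2l t0) mulrN.
    have := ler_norm (- f (t *: y)); rewrite normrN => fn.
    apply: (@le_trans _ _ (K * `|t *: y| ^+ 2)); first by lra.
    rewrite (_ : K * `|t *: y| ^+ 2 = t * (K * `|t *: y| * `|y|)); last first.
      by rewrite normrZ gtr0_norm //; ring.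
    by rewrite ler_pM2l // ler_pM ?mulr_ge0 // ler_wpM2l // ltW.
  have Sd : - (\sum_(1 <= i < l.+1) co d i) <= - (\sum_(1 <= i < l.+1) co y i) + l%:R * a.
    rewrite (_ : l%:R = \sum_(1 <= i < l.+1) 1); last by rewrite sumr_const_nat subn1.
    rewrite mulr_suml -!sumrN -big_split; apply: ler_sum => i _ /=.
    by have := near0 i a a0 y yd; rewrite ler_norml => /andP[]; lra.
  apply: (le_trans Sd); apply: (@le_trans _ _ ((K * M + l%:R + 1) * a)).
    by have := ltW a0; lra.
  by rewrite mulrC -ler_pdivlMr.
have Sj : \sum_(1 <= i < l.+1) co d i <= co d j.
  rewrite (bigD1_seq j) /= ?mem_index_iota ?iota_uniq //.
  rewrite -[leRHS]addr0 lerD2l big_seq_cond; apply: sumr_le0 => i /andP[].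
  by rewrite mem_index_iota => il _; apply: le0; lia.
by apply/eqP; rewrite eq_le le0 /= ?(le_trans S0) //; lia.
Qed.

Lemma ineq_tcone_ray d : ineq_linear d ->
  (exists2 a : R, 0 < a & forall t, 0 < t < a -> f (t *: d) <= 0) -> T d.
Proof.
move=> [d1 d2] [a a0 H]; apply: tcone_ray; exists a => // t ta; have /andP[t0 _] := ta.
split=> [i iq|]; first by rewrite coZ pmulr_rle0 // d1.
rewrite big_nat big1 ?oppr0 ?add0r; first exact: H.
by move=> j jl; rewrite coZ d2 ?mulr0 //; lia.
Qed.

Lemma ineq_tcone_neg d : ineq_linear d -> Q d < 0 -> T d.
Proof.
move=> Ld Qd; apply: ineq_tcone_ray => //.
by have [a a0 H] := jet2_lt0_ray J Qd; exists a => // t /H/ltW.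
Qed.

(** The hypothesis makes [Q] negative wherever the free coordinate c is nonzero, and such directions
    are dense in the linearised cone. *)
Lemma ineq_ACQ c : (q <= c <= n)%N ->
  (forall d, ineq_linear d -> Q d <= - co d c ^+ 2) -> T = ineq_linear.
Proof.
move=> cn H; apply/seteqP; split=> [|d Ld]; first exact: ineq_tcone_sub.
have main x : ineq_linear x -> co x c != 0 -> T x.
  move=> Lx x0; apply: ineq_tcone_neg => //.
  by rewrite (le_lt_trans (H _ Lx)) // oppr_lt0 exprn_even_gt0.
have [d0|] := eqVneq (co d c) 0; last exact: main.
apply: tcone_closed => e e0; exists (d + (e / 2) *: bv c).
have e2 : 0 < e / 2 by rewrite divr_gt0.
split.
  apply: main; first exact: ineq_linear_free.
  by rewrite coD coZ d0 co_bv ?eqxx ?mulr1 ?add0r ?gt_eqF //; lia.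
rewrite addrAC subrr add0r normrZ gtr0_norm // (@le_lt_trans _ _ (e / 2)) //.
  by rewrite ler_piMr ?norm_bv // ltW.
by rewrite ltr_pdivrMr // ltr_pMr // ltr1n.
Qed.

(** A step [a] larger than 1 + |Q d| + 2 |d_j| along the negative axis makes [Q] negative in both
    senses, so [d] is the midpoint of two tangent directions. *)
Lemma ineq_GCQ_neg j : (q <= j <= n)%N ->
  (forall x a, Q (x + a *: bv j) = Q x - a * (2 * co x j + a)) ->
  polar T = polar ineq_linear.
Proof.
move=> jn Qj; apply: polar_eq; first exact: ineq_tcone_sub.
move=> v Pv d Ld; pose a := 1 + `|Q d| + 2 * `|co d j|.
have a1 : 1 <= a by rewrite /a -addrA lerDl addr_ge0 // mulr_ge0.
have big (s : R) : s ^+ 2 = 1 -> Q (d + (s * a) *: bv j) < 0.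
  move=> s2; rewrite Qj.
  have -> : s * a * (2 * co d j + s * a) = a * (s * (2 * co d j)) + s ^+ 2 * a ^+ 2 by ring.
  have sn : `|s| = 1.
    by apply/eqP; rewrite -(@eqrXn2 _ 2) // expr1n real_normK ?num_real // s2.
  have h1 : - (2 * `|co d j|) <= s * (2 * co d j).
    rewrite -[leRHS]opprK lerN2 (le_trans (ler_norm _)) // normrN !normrM sn mul1r.
    by rewrite ger0_norm.
  have h2 : a * - (2 * `|co d j|) <= a * (s * (2 * co d j)) by rewrite ler_wpM2l // (le_trans _ a1).
  have h3 : a ^+ 2 = a * (1 + `|Q d| + 2 * `|co d j|) by [].
  have h4 : `|Q d| <= a * `|Q d| by rewrite ler_peMl.
  have h5 := ler_norm (Q d); rewrite s2 mul1r; lra.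
have Tp (s : R) : s ^+ 2 = 1 -> dot v d + s * (a * dot v (bv j)) <= 0.
  move=> s2; rewrite mulrA -dotZr -dotDr; apply: Pv; apply: ineq_tcone_neg; last exact: big.
  exact: ineq_linear_free.
have := Tp 1 (expr1n _ _); have := Tp (-1) (sqrr_sign _ 1).
by lra.
Qed.

(** Counterpart of [eq_GCQ_shear]: a polar vector vanishes on [bv c], so [d] may be moved along
    [bv c] to the level Q = -1, where it is tangent. *)
Lemma ineq_GCQ_shear c (m : 'rV[R]_n -> R) b : (q <= c <= n)%N ->
  T (bv c) -> T (- bv c) ->
  (forall x a, Q (x + a *: bv c) = Q x + a * m x) ->
  (forall x a, m (x + a *: b) = m x + a * m b) -> ineq_linear b -> m b != 0 ->
  polar T = polar ineq_linear.
Proof.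
move=> cn T1 T2 Qc mb Lb mb0; apply: polar_eq; first exact: ineq_tcone_sub.
move=> v Pv.
have vc : dot v (bv c) = 0.
  apply/eqP; rewrite eq_le; apply/andP; split; first exact: (Pv _ T1).
  by have := Pv _ T2; rewrite -/(dot _ _) -scaleN1r dotZr mulN1r oppr_le0.
have main d : ineq_linear d -> m d != 0 -> dot v d <= 0.
  move=> Ld md; pose a := (- Q d - 1) / m d.
  have Td : T (d + a *: bv c).
    apply: ineq_tcone_neg; first exact: ineq_linear_free.
    by rewrite Qc /a divfK // addrA subrr sub0r oppr_lt0.
  by have := Pv _ Td; rewrite -/(dot _ _) dotDr dotZr vc mulr0 addr0.
move=> d Ld; have [md|] := eqVneq (m d) 0; last exact: main.
apply: dot_le0_closed => e e0; have [h h0 Hh] := small_step b e0.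
exists (d + h *: b); split; last exact: Hh.
  apply: main; first by apply: ineq_linearD => //; apply: ineq_linearZ => //; exact: ltW.
  by rewrite mb md add0r mulf_neq0 // gt_eqF.
Qed.

End InequalityProblem.

(** * Linearised cones from first-order jets, and ACQ under MFCQ *)

Section FirstOrderJets.
Context {R : realType}.

Lemma linear_rV_mulmx n m (A : 'I_m -> 'rV[R]_n -> R) (x : 'rV[R]_n) i :
  (forall i a x y, A i (a *: x + y) = a * A i x + A i y) ->
  (x *m (\matrix_(k, i) A i (delta_mx 0 k))) 0 i = A i x.
Proof.
move=> lA; have A0 : A i 0 = 0.
  by have := lA i 0 0 0; rewrite scale0r addr0 mul0r add0r => h; have := lA i 1 0 0; rewrite scale1r addr0 mul1r; lra.
rewrite {2}[x]row_sum_delta mxE.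
have -> : A i (\sum_(j < n) x 0 j *: delta_mx 0 j) = \sum_(j < n) x 0 j * A i (delta_mx 0 j).
  elim/big_ind2 : _ => // [a b c d <- <-|k _].
    by have := lA i 1 b d; rewrite scale1r mul1r.
  by have := lA i (x 0 k) (delta_mx 0 k) 0; rewrite addr0 A0 addr0.
by apply: eq_bigr => k _; rewrite mxE.
Qed.

(** The estimate at x = 0 contains [f 0 = 0], so one hypothesis gives both the Jacobian and the
    activity of all constraints. *)
Definition jet1 n m (f : 'rV[R]_n -> 'rV[R]_m) (E : 'M[R]_(n, m)) :=
  exists2 K : R, 0 <= K & forall x, `|x| <= 1 -> `|f x - x *m E| <= K * `|x| ^+ 2.

Lemma jet1_0 n m (f : 'rV[R]_n -> 'rV[R]_m) E : jet1 f E -> f 0 = 0.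
Proof.
move=> [K K0 /(_ 0)]; rewrite normr0 mul0mx subr0 expr0n mulr0 => /(_ ler01).
by rewrite normr_le0 => /eqP.
Qed.

Lemma jet1_jacobian n m (f : 'rV[R]_n -> 'rV[R]_m) E : jet1 f E ->
  differentiable f 0 /\ 'J f 0 = E.
Proof.
move=> J; have f0 := jet1_0 J; have [K K0 HK] := J.
pose L : {linear 'rV[R]_n -> 'rV[R]_m} := mulmxr E.
have cL : continuous L by exact: mulmxr_continuous.
have D : f \o shift (0 : 'rV[R]_n) = cst (f 0) + L +o_ (0 : 'rV[R]_n) id.
  apply/eqaddoP => e e0.
  have N1 : \forall x \near (0 : 'rV[R]_n), `|x| < Num.min 1 (e / (K + 1)).
    apply/nbhs_norm0P; exists (Num.min 1 (e / (K + 1))) => //=.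
    by rewrite lt_min ltr01 divr_gt0 // ltr_wpDl.
  apply: filterS N1 => x; rewrite lt_min => /andP[x1 xe].
  rewrite !fctE /= addr0 f0 add0r (le_trans (HK _ (ltW x1)))// expr2 mulrA.
  rewrite ler_wpM2r // (@le_trans _ _ ((K + 1) * `|x|)) //.
    by rewrite ler_wpM2r // lerDl.
  by rewrite mulrC -ler_pdivlMr ?ltr_wpDl // ltW.
have dE := diff_unique cL D.
split; first by apply/diff_locallyP; rewrite dE.
by apply/row_matrixP => i; rewrite !rowE -diffJ dE.
Qed.

Lemma jet1_linearized_cone n q r (g : 'rV[R]_n -> 'rV[R]_q) (h : 'rV[R]_n -> 'rV[R]_r) E E' :
  jet1 g E -> jet1 h E' ->
  linearized_cone g h = [set d | (forall i, (d *m E) 0 i <= 0) /\ d *m E' = 0].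
Proof.
move=> Jg Jh; have aT := active_all (jet1_0 Jg).
have [_ JE] := jet1_jacobian Jg; have [_ JE'] := jet1_jacobian Jh.
apply/seteqP; split=> d; rewrite /linearized_cone /= (diffJ h) (diffJ g) JE JE'.
  by move=> [Hg Hh]; split=> // i; apply: Hg; rewrite aT inE.
by move=> [Hg Hh]; split.
Qed.

Lemma tcone_feasible_linear n q (g : 'rV[R]_n -> 'rV[R]_q) E d i :
  jet1 g E -> tcone (feasible g (@no_constraint R n)) d -> (d *m E) 0 i <= 0.
Proof.
move=> [K K0 HK] T; have [M M0 HM] := mulmx_bound E.
apply/ler_addgt0Pl => e e0; rewrite addr0.
pose N := `|d| + 1; have N0 : 0 < N by rewrite ltr_wpDl.
have C0 : 0 < K * N + M by rewrite ltr_wpDl // mulr_ge0 // ltW.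
pose a := Num.min 1 (e / (K * N + M)).
have a0 : 0 < a by rewrite lt_min ltr01 divr_gt0.
have [t [y [t0 [Fy _] ty yd]]] := T a a0.
have [a1 ae] : a <= 1 /\ a <= e / (K * N + M) by rewrite /a !ge_min !lexx /= orbT.
have yN : `|y| <= N.
  have -> : y = d + (y - d) by rewrite addrC subrK.
  by rewrite (le_trans (ler_normD _ _))// lerD2l (le_trans (ltW yd)).
have h1 : `|(g (t *: y) - (t *: y) *m E) 0 i| <= K * `|t *: y| ^+ 2.
  by rewrite (le_trans (coord_norm_le _ _ _))// HK // (le_trans (ltW ty)).
have h2 : (y *m E) 0 i <= K * N * a.
  rewrite -(ler_pM2l t0) (@le_trans _ _ (K * `|t *: y| ^+ 2)) //.
    have := Fy i; have := h1; rewrite -scalemxAl !mxE ler_norml => /andP[].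
    by lra.
  rewrite (_ : K * `|t *: y| ^+ 2 = t * (K * `|y| * `|t *: y|)); last first.
    by rewrite normrZ gtr0_norm //; ring.
  by rewrite ler_pM2l // ler_pM ?mulr_ge0 ?ler_wpM2l // ltW.
have h3 : `|((d - y) *m E) 0 i| <= M * a.
  rewrite (le_trans (coord_norm_le _ _ _))// (le_trans (HM _))// ler_pM2l //.
  by rewrite distrC ltW.
have h4 : (d *m E) 0 i = (y *m E) 0 i + ((d - y) *m E) 0 i.
  by rewrite mulmxBl; move: (d *m E) (y *m E) => A B; rewrite !mxE; ring.
rewrite h4 (@le_trans _ _ (K * N * a + M * a)) //.
  by rewrite lerD // (le_trans (ler_norm _)).
by rewrite -mulrDl mulrC -ler_pdivlMr.
Qed.

(* Under MFCQ the open cone [d *m E < 0] is non-empty, hence dense in the linearized cone. *)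
Lemma interior_direction_ACQ n q (g : 'rV[R]_n -> 'rV[R]_q) E (u : 'rV[R]_n) :
  jet1 g E -> (forall i, (u *m E) 0 i < 0) -> ACQ g (@no_constraint R n).
Proof.
move=> J Hu; have Jh : jet1 (@no_constraint R n) (0 : 'M[R]_(n, 0)).
  by exists 0 => // x _; rewrite mul0r mulmx0 subr0 normr0.
rewrite /ACQ tangent_coneE (jet1_linearized_cone J Jh).
apply/seteqP; split=> [d T|d [Hd _]].
  split=> [i|]; first exact: tcone_feasible_linear T.
  by rewrite mulmx0.
have strict w : (forall i, (w *m E) 0 i < 0) -> tcone (feasible g (@no_constraint R n)) w.
  move=> Hw; apply: tcone_ray; have [K K0 HK] := J.
  have : exists2 b : R, 0 < b & forall i, (w *m E) 0 i <= - b.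
    (* The initial value -1 keeps the maximum negative, also when there is no constraint. *)
    pose b := \big[Num.max/(-1)]_(i < q) (w *m E) 0 i.
    exists (- b) => [|i]; last by rewrite opprK /b le_bigmax.
    by rewrite oppr_gt0 /b; apply/bigmax_ltP; split.
  move=> [b b0 Hb]; pose N := `|w| + 1; have N0 : 0 < N by rewrite ltr_wpDl.
  have C0 : 0 < (K + 1) * N ^+ 2 by rewrite mulr_gt0 ?exprn_gt0 // ltr_wpDl.
  exists (Num.min N^-1 (b / ((K + 1) * N ^+ 2))).
    by rewrite lt_min invr_gt0 N0 divr_gt0.
  move=> t; rewrite lt_min => /and3P[t0 tN tb]; split=> [i|j]; last by case: j.
  have wN : `|w| <= N by rewrite lerDl.
  have tw : `|t *: w| <= 1.
    rewrite normrZ gtr0_norm // (@le_trans _ _ (t * N)) ?ler_pM2l //.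
    by rewrite -ler_pdivlMr // mul1r ltW.
  have h1 : `|(g (t *: w) - (t *: w) *m E) 0 i| <= K * `|t *: w| ^+ 2.
    by rewrite (le_trans (coord_norm_le _ _ _))// HK.
  have h2 : K * `|t *: w| ^+ 2 <= t * b.
    rewrite normrZ gtr0_norm // exprMn (@le_trans _ _ (t * (t * ((K + 1) * N ^+ 2)))) //.
      rewrite (_ : K * (t ^+ 2 * `|w| ^+ 2) = t * (t * (K * `|w| ^+ 2))); last by ring.
      rewrite ler_pM2l // ler_pM2l // ler_pM ?exprn_ge0 ?lerDl //.
      by rewrite lerXn2r ?nnegrE // ltW.
    by rewrite ler_pM2l // -ler_pdivlMr // ltW.
  have h3 : t * (w *m E) 0 i <= t * - b by rewrite ler_pM2l.
  move: h1 h3; rewrite -scalemxAl; move: (w *m E) => W.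
  by rewrite !mxE ler_norml => /andP[_]; lra.
apply: tcone_closed => e e0; have [h h0 Hh] := small_step u e0.
exists (d + h *: u); split; last exact: Hh.
  apply: strict => i; rewrite mulmxDl -scalemxAl mxE [X in _ + X]mxE.
  by rewrite -[ltRHS]addr0 ler_ltD // pmulr_rlt0.
Qed.

End FirstOrderJets.

(** * The constraint maps of the lists, reduced to the two abstract problems *)

Section ListMaps.
Context {R : realType}.

Definition reg_mx n q : 'M[R]_(n, q) := \matrix_(k, i) co (delta_mx 0 k : 'rV[R]_n) i.+1.

Lemma mul_reg_mx n q (x : 'rV[R]_n) i : (x *m reg_mx n q) 0 i = co x i.+1.
Proof.
apply: (@linear_rV_mulmx R n q (fun i x => co x i.+1)) => j a y z.
by rewrite coD coZ.
Qed.

Lemma jet1_reg_ineq n q : jet1 (@reg_ineq R n q) (reg_mx n q).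
Proof.
exists 0 => // x _; rewrite mul0r (_ : _ - _ = 0) ?normr0 //.
by apply/rowP => i; rewrite !mxE -mul_reg_mx mxE subrr.
Qed.

Lemma jet1_no_constraint n : jet1 (@no_constraint R n) 0.
Proof. by exists 0 => // x _; rewrite mul0r mulmx0 subr0 normr0. Qed.

Lemma jet1_one_constraint n (f : 'rV[R]_n -> R) :
  order2 f -> jet1 (one_constraint f) 0.
Proof.
move=> [K K0 HK]; exists K => // x x1; rewrite mulmx0 subr0.
apply: norm_le_coord => [|i j]; first by rewrite mulr_ge0 // exprn_ge0.
by rewrite mxE HK.
Qed.

Definition gB_lin n q l1 l (i : 'I_q) (x : 'rV[R]_n) : R :=
  if (i.+1 < q)%N then co x i.+1
  else \sum_(1 <= j < l1.+1) co x j - \sum_(l1.+1 <= j < l.+1) co x j.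

Definition gB_mx n q l1 l : 'M[R]_(n, q) := \matrix_(k, i) gB_lin l1 l i (delta_mx 0 k).

Lemma mul_gB_mx n q l1 l (x : 'rV[R]_n) i : (x *m gB_mx n q l1 l) 0 i = gB_lin l1 l i x.
Proof.
apply: linear_rV_mulmx => j a y z; rewrite /gB_lin; case: ifP => _.
  by rewrite coD coZ.
have S (s t : nat) : \sum_(s <= k < t) co (a *: y + z) k =
    a * \sum_(s <= k < t) co y k + \sum_(s <= k < t) co z k.
  by rewrite mulr_sumr -big_split; apply: eq_bigr => k _; rewrite coD coZ.
by rewrite !S; ring.
Qed.

Lemma jet1_gB n q l1 l (f : 'rV[R]_n -> R) :
  order2 f -> jet1 (@gB R n q l1 l f) (gB_mx n q l1 l).
Proof.
move=> [K K0 HK]; exists K => // x x1.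
apply: norm_le_coord => [|i j]; first by rewrite mulr_ge0 // exprn_ge0.
rewrite ord1 mxE [X in _ + X]mxE mul_gB_mx mxE /gB_lin; case: ifP => _.
  by rewrite subrr normr0 mulr_ge0 // exprn_ge0.
by rewrite addrAC subrr add0r HK.
Qed.

(** This makes List A the case [q] = 0 of the equality problem on an orthant. *)
Lemma no_constraint_reg n : @no_constraint R n = @reg_ineq R n 0.
Proof. by apply/funext => x; apply/rowP; case. Qed.

Lemma orthant_regP n q (x : 'rV[R]_n) :
  (forall i : 'I_q, co x i.+1 <= 0) <-> orthant q x.
Proof.
split=> [H [//|i] /andP[_ iq]|H i]; first exact: (H (Ordinal iq)).
by apply: H; rewrite ltn_ord.
Qed.

Section EqualityList.
Variables (n q : nat) (f Q : 'rV[R]_n -> R).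
Hypothesis J : jet2 f Q.

Lemma eq_feasibleE : feasible (@reg_ineq R n q) (one_constraint f) = eq_feasible q f.
Proof.
apply/seteqP; split=> x [H1 H2]; split.
- by apply/orthant_regP => i; have := H1 i; rewrite mxE.
- by have := H2 ord0; rewrite mxE.
- by move=> i; rewrite mxE; move: i; apply/orthant_regP.
- by move=> j; rewrite mxE.
Qed.

Lemma eq_linearizedE : linearized_cone (@reg_ineq R n q) (one_constraint f) = orthant q.
Proof.
rewrite (jet1_linearized_cone (@jet1_reg_ineq n q) (jet1_one_constraint (jet2_order2 J))).
apply/seteqP; split=> d.
  by move=> [H _]; apply/orthant_regP => i; rewrite -mul_reg_mx.
move=> H; split=> [i|]; last by rewrite mulmx0.
by rewrite mul_reg_mx; move: i; apply/orthant_regP.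
Qed.

Lemma eq_ACQE : ACQ (@reg_ineq R n q) (one_constraint f) <->
  tcone (eq_feasible q f) = orthant q.
Proof. by rewrite /ACQ tangent_coneE eq_feasibleE eq_linearizedE. Qed.

Lemma eq_GCQE : GCQ (@reg_ineq R n q) (one_constraint f) <->
  polar (tcone (eq_feasible q f)) = polar (orthant q).
Proof. by rewrite /GCQ tangent_coneE eq_feasibleE eq_linearizedE. Qed.

End EqualityList.

Section InequalityList.
Variables (n q l : nat) (f Q : 'rV[R]_n -> R).
Hypothesis J : jet2 f Q.
Hypothesis lq : (l < q)%N.

Lemma ineq_feasibleE : feasible (@gB R n q 0 l f) (@no_constraint R n) = ineq_feasible q l f.
Proof.
apply/seteqP; split=> x [H1 H2]; split.
- move=> [//|i] /andP[_ iq].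
  have := H1 (Ordinal (ltnW iq)); by rewrite mxE /= iq.
- have q1 : (q.-1 < q)%N by lia.
  have := H1 (Ordinal q1); rewrite mxE /= (_ : (q.-1.+1 < q)%N = false); last first.
    by apply/negbTE; lia.
  by rewrite (@big_geq _ _ _ 1 1) // sub0r.
- move=> i; rewrite mxE; case: ifP => iq; first by apply: H1; rewrite iq.
  by rewrite big_geq // sub0r.
- by case.
Qed.

Lemma ineq_linearizedE :
  linearized_cone (@gB R n q 0 l f) (@no_constraint R n) = ineq_linear q l.
Proof.
rewrite (jet1_linearized_cone (@jet1_gB n q 0 l _ (jet2_order2 J)) (@jet1_no_constraint n)).
apply/seteqP; split=> d.
  move=> [H _].
  have le0 i : (1 <= i < q)%N -> co d i <= 0.
    case: i => // i /andP[_ iq].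
    by have := H (Ordinal (ltnW iq)); rewrite mul_gB_mx /gB_lin /= iq.
  split=> // j jl.
  have q1 : (q.-1 < q)%N by lia.
  have := H (Ordinal q1); rewrite mul_gB_mx /gB_lin /= (_ : (q.-1.+1 < q)%N = false); last first.
    by apply/negbTE; lia.
  rewrite big_geq // sub0r oppr_le0 => S0.
  have Sj : \sum_(1 <= i < l.+1) co d i <= co d j.
    rewrite (bigD1_seq j) /= ?mem_index_iota ?iota_uniq //.
    rewrite -[leRHS]addr0 lerD2l big_seq_cond; apply: sumr_le0 => i /andP[].
    by rewrite mem_index_iota => il _; apply: le0; lia.
  by apply/eqP; rewrite eq_le le0 /= ?(le_trans S0) //; lia.
move=> [H1 H2]; split=> [i|]; last by rewrite mulmx0.
rewrite mul_gB_mx /gB_lin; case: ifP => iq; first by apply: H1; rewrite iq.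
rewrite big_geq // big_nat big1 ?subr0 // => j jl; apply: H2; lia.
Qed.

Lemma ineq_ACQE : ACQ (@gB R n q 0 l f) (@no_constraint R n) <->
  tcone (ineq_feasible q l f) = ineq_linear q l.
Proof. by rewrite /ACQ tangent_coneE ineq_feasibleE ineq_linearizedE. Qed.

Lemma ineq_GCQE : GCQ (@gB R n q 0 l f) (@no_constraint R n) <->
  polar (tcone (ineq_feasible q l f)) = polar (ineq_linear q l).
Proof. by rewrite /GCQ tangent_coneE ineq_feasibleE ineq_linearizedE. Qed.

Lemma ineq_ACQ_le0 d : ACQ (@gB R n q 0 l f) (@no_constraint R n) ->
  ineq_linear q l d -> Q d <= 0.
Proof.
move=> /ineq_ACQE E Ld; apply: (@ineq_tconeQ R n q l lq f Q J).
by rewrite E.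
Qed.

End InequalityList.

(** Since l_1 > 0, the coordinate x_1 enters the last linear form with sign +; making it very
    negative outweighs the terms with sign -. *)
Lemma gB_interior_direction n q l1 l : (1 <= q)%N -> (l < q)%N -> (q.-1 <= n)%N ->
  (0 < l1 <= l)%N ->
  exists u : 'rV[R]_n, forall i, (u *m gB_mx n q l1 l) 0 i < 0.
Proof.
move=> q0 lq qn /andP[l10 l1l].
(* All the coordinates below [q] are -1, and the first is lowered by a further [q], which exceeds
   the number l - l_1 of opposite terms. *)
pose u : 'rV[R]_n := (- 1) *: (\sum_(1 <= j < q) bv j) + (- q%:R) *: bv 1.
have couE i : (1 <= i < q)%N -> co u i = - 1 - q%:R * (i == 1%N)%:R.
  move=> iq; rewrite coD !coZ co_bv; last by lia.
  rewrite (_ : co _ i = 1) ?mulr1 ?mulNr //.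
  rewrite (_ : co (\sum_(1 <= j < q) bv j) i = \sum_(1 <= j < q) (i == j)%:R).
    rewrite (bigD1_seq i) /= ?mem_index_iota ?iota_uniq // eqxx big1 ?addr0 // => j ji.
    by rewrite eq_sym (negbTE ji).
  rewrite big_nat_cond [RHS]big_nat_cond.
  elim/big_ind2 : _ => [|a b c d <- <-|j].
  - by rewrite /co big1 // => k _; rewrite mxE.
  - by rewrite coD.
  - by rewrite andbT => jq; rewrite co_bv //; lia.
exists u => i; rewrite mul_gB_mx /gB_lin; case: ifP => iq.
  by rewrite couE //; case: eqP => _; have := ler0n R q; lra.
have -> : \sum_(1 <= j < l1.+1) co u j = - l1%:R - q%:R.
  rewrite (eq_big_nat _ _ (F2 := fun j => - 1 - q%:R * (j == 1%N)%:R)); last first.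
    by move=> j jl; apply: couE; lia.
  rewrite sumrB sumr_const_nat -mulr_sumr (bigD1_seq 1%N) /= ?mem_index_iota ?iota_uniq //.
  rewrite big1 ?addr0 ?mulr1 => [|j /negbTE -> //].
  by rewrite subn1 /= mulNrn.
have -> : \sum_(l1.+1 <= j < l.+1) co u j = - (l - l1)%:R.
  rewrite (eq_big_nat _ _ (F2 := fun j => - 1)); last first.
    move=> j jl; rewrite couE; last by lia.
    by rewrite (_ : (j == 1%N) = false) ?mulr0 ?subr0 //; apply/eqP; lia.
  by rewrite sumr_const_nat mulNrn subSS.
have : ((l - l1)%:R : R) < q%:R by rewrite ltr_nat; lia.
have : (0 : R) <= l1%:R by rewrite ler0n.
lra.
Qed.

End ListMaps.

(** * Inequality constraints: List B *)

Section Signs.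
Context {R : realType}.

Lemma sgn_sqr (e : R) : sgn e -> e ^+ 2 = 1.
Proof. by case=> ->; rewrite ?sqrrN expr1n. Qed.

Lemma sgn_le0 (e : R) : sgn e -> e <= 0 -> e = -1.
Proof. by case=> // ->; rewrite ler10. Qed.

Lemma sgn_neq1 (e : R) : sgn e -> e <> 1 -> e = -1.
Proof. by case. Qed.

Lemma sgn_N1_neq1 : (-1 : R) <> 1.
Proof. by move=> E; have := @ltr01 R; rewrite -E oppr_gt0 ltr10. Qed.

Lemma sgn_exprN1 k : sgn ((-1) ^+ k : R).
Proof.
elim: k => [|k IH]; first by left.
by rewrite exprS mulN1r; case: IH => ->; [right|left; rewrite opprK].
Qed.

Lemma sgn_neq_exprS (e : R) k : sgn e -> e <> (-1) ^+ k.+1 -> e = (-1) ^+ k.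
Proof.
rewrite exprS mulN1r; case: (sgn_exprN1 k) => -> [->|->] H //; case: H => //.
by rewrite opprK.
Qed.

Lemma not_all_eq1 (eps : nat -> R) a b : sgns eps ->
  ~ all_eq eps a b 1 <-> exists j, (a <= j <= b)%N /\ eps j = -1.
Proof.
move=> se; split=> [H|[j [ab ej]] H]; last first.
  by have := H j ab; rewrite ej; exact: sgn_N1_neq1.
apply: contrapT => H'; apply: H => j ab.
by have [//|ej] := se j; case: H'; exists j.
Qed.

Lemma both_signsP (eps : nat -> R) a b : sgns eps ->
  both_signs eps a b <-> (exists j, (a <= j <= b)%N /\ eps j = 1) /\
                         (exists j, (a <= j <= b)%N /\ eps j = -1).
Proof.
move=> se; split=> [E|[[i [iab ei]] [j [jab ej]]]].
  split.
    have : [set eps j | j in [set j | (a <= j <= b)%N]] 1 by rewrite E; left.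
    by move=> [j jab <-]; exists j.
  have : [set eps j | j in [set j | (a <= j <= b)%N]] (-1) by rewrite E; right.
  by move=> [j jab <-]; exists j.
apply/seteqP; split=> [_ [k kab <-]|_ [->|->]]; first exact: se.
  by exists i.
by exists j.
Qed.

Lemma not_both_signs (eps : nat -> R) a b : sgns eps -> ~ both_signs eps a b ->
  exists2 s : R, sgn s & all_eq eps a b s.
Proof.
move=> se H; have [H1|H1] := pselect (all_eq eps a b 1); first by exists 1 => //; left.
exists (-1); first by right.
move=> j jab; have [ej|//] := se j; case: H; apply/both_signsP => //; split.
  by exists j.
by apply/not_all_eq1.
Qed.

End Signs.

Section Coordinates2.
Context {R : realType}.
Variable n : nat.
Implicit Types (x d : 'rV[R]_n).

Lemma co0 i : co (0 : 'rV[R]_n) i = 0.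
Proof. by rewrite /co big1 // => k _; rewrite mxE. Qed.

Lemma co_add x s j i : (1 <= j <= n)%N -> co (x + s *: bv j) i = co x i + s * (i == j)%:R.
Proof. by move=> jn; rewrite coD coZ co_bv. Qed.

Lemma co_add_ne x s j i : (1 <= j <= n)%N -> i != j -> co (x + s *: bv j) i = co x i.
Proof. by move=> jn /negbTE ij; rewrite co_add // ij mulr0 addr0. Qed.

Lemma sq0 eps a : sq eps a (0 : 'rV[R]_n) = 0.
Proof. by rewrite /sq big1 // => k _; rewrite co0 expr0n mulr0. Qed.

Lemma sq_add eps a x s j : (a <= j <= n)%N -> (1 <= j)%N ->
  sq eps a (x + s *: bv j) = sq eps a x + eps j * (s * (2 * co x j + s)).
Proof.
move=> aj j1; rewrite /sq (bigD1_seq j) ?mem_index_iota ?iota_uniq //=.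
rewrite [in RHS](bigD1_seq j) ?mem_index_iota ?iota_uniq //=.
rewrite co_add ?eqxx /=; last by lia.
rewrite (eq_bigr (fun i => eps i * co x i ^+ 2)) => [|i ij]; first by ring.
by rewrite co_add_ne //; lia.
Qed.

Lemma sq_add_out eps a x s j : (1 <= j < a)%N -> (j <= n)%N ->
  sq eps a (x + s *: bv j) = sq eps a x.
Proof.
move=> ja jn; apply: eq_big_nat => i ia; rewrite co_add_ne //; first by lia.
by apply/eqP; lia.
Qed.

Lemma sqE eps a x : (a <= n)%N -> sq eps a x = eps a * co x a ^+ 2 + sq eps a.+1 x.
Proof. by move=> an; rewrite /sq big_ltn. Qed.

Lemma sq_definite eps a s x : (a <= n)%N -> s ^+ 2 = 1 -> all_eq eps a n s ->
  co x n ^+ 2 <= s * sq eps a x.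
Proof.
move=> an s2 H; rewrite /sq mulr_sumr (bigD1_seq n) ?mem_index_iota ?iota_uniq //=; last by lia.
rewrite H; last by lia.
rewrite mulrA -expr2 s2 mul1r lerDl big_seq_cond; apply: sumr_ge0 => i /andP[].
rewrite mem_index_iota => ia _; rewrite H; last by lia.
by rewrite mulrA -expr2 s2 mul1r sqr_ge0.
Qed.

(** The separating vector is [bv n + v0]: on [T] the hypothesis gives |d_n| <= - v0.d, so it is
    nonpositive there, while at [bv n] it takes the value 1. *)
Lemma polar_neq_definite (T L : set 'rV[R]_n) v0 : (1 <= n)%N -> L (bv n) ->
  dot v0 (bv n) = 0 ->
  (forall d, T d -> co d n ^+ 2 <= dot v0 d ^+ 2 /\ dot v0 d <= 0) ->
  polar T <> polar L.
Proof.
move=> n1 Ln v0n H; apply: (@polar_neq _ _ _ _ (bv n + v0) (bv n)) => //.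
  move=> d /H[H1 H2]; rewrite dotDl dot_bv; last by lia.
  have : `|co d n| <= - dot v0 d.
    by rewrite -(ler0_norm H2) -ler_sqr ?nnegrE // !real_normK ?num_real.
  by have := ler_norm (co d n); lra.
by rewrite dotDl v0n addr0 dot_bv ?co_bv ?eqxx //; lia.
Qed.

Lemma tcone_dot_le0 (F : set 'rV[R]_n) v : (forall x, F x -> dot v x <= 0) ->
  forall d, tcone F d -> dot v d <= 0.
Proof.
move=> H d T; apply: dot_le0_closed => e e0; have [t [y [t0 Fy _ yd]]] := T e e0.
by exists y; split=> //; have := H _ Fy; rewrite dotZr pmulr_rle0.
Qed.

(** With [pow_split], this treats k = 2 and k >= 3 uniformly: the power belongs to the quadratic
    part in the first case and to the remainder in the second. *)
Lemma order3_pow c i k : (2 <= k)%N ->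
  order3 (fun x => (if k == 2%N then 0 else c) * co x i ^+ k).
Proof.
move=> k2; case: eqP => k2'.
  by apply: order3_ext (@order3_0 R n) => x; rewrite mul0r.
by apply: order3Z; apply: order3_exp; lia.
Qed.

Lemma pow_split c i k x : c * co x i ^+ k =
  (if k == 2%N then c else 0) * co x i ^+ 2 + (if k == 2%N then 0 else c) * co x i ^+ k.
Proof. by case: eqP => [->|_]; rewrite mul0r ?addr0 ?add0r. Qed.

End Coordinates2.

(** * Inequality criteria for a quadratic part with a free diagonal summand *)

Section InequalitySplit.
Context {R : realType}.
Variables (n q l a : nat) (f P : 'rV[R]_n -> R) (eps : nat -> R).
Hypotheses (lq : (l < q)%N) (qa : (q <= a)%N) (an : (a <= n)%N) (se : sgns eps).
Hypothesis J : jet2 f (fun x => P x + sq eps a x).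
Hypothesis Pinv : forall x s j, (a <= j <= n)%N -> P (x + s *: bv j) = P x.
Let g := @gB R n q 0 l f.

Lemma split_P0 : P 0 = 0.
Proof.
have [[_ h _] _] := J; have := h 0 0; rewrite scale0r sq0 addr0 => ->.
by rewrite expr0n mul0r.
Qed.

Lemma ineq_ACQ_nec : ACQ g (@no_constraint R n) ->
  all_eq eps a n (-1) /\ forall d, ineq_linear q l d -> sq eps a d = 0 -> P d <= 0.
Proof.
move=> A; split=> [j jn|d Ld d0]; last first.
  by have := ineq_ACQ_le0 J lq A Ld; rewrite d0 addr0.
have L : ineq_linear q l (0 + 1 *: bv j : 'rV[R]_n).
  by rewrite add0r; apply: ineq_linear_bv => //; lia.
have := ineq_ACQ_le0 J lq A L; rewrite Pinv // split_P0 add0r sq_add //; last by lia.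
by rewrite sq0 co0 mulr0 !add0r !mul1r mulr1; exact: sgn_le0.
Qed.

Lemma ineq_ACQ_suf : all_eq eps a n (-1) -> (forall d, ineq_linear q l d -> P d <= 0) ->
  ACQ g (@no_constraint R n).
Proof.
move=> H HP; apply/(ineq_ACQE J lq); apply: (@ineq_ACQ _ _ _ _ lq _ _ J n); first by lia.
move=> d /HP Pd; have := @sq_definite R n eps a (-1) d an (sgn_sqr (or_intror erefl)) H.
lra.
Qed.

Lemma ineq_GCQ_suf : ~ all_eq eps a n 1 -> GCQ g (@no_constraint R n).
Proof.
move=> /not_all_eq1-/(_ se)[j [jn ej]]; apply/(ineq_GCQE J lq).
apply: (@ineq_GCQ_neg _ _ _ _ lq _ _ J j); first by lia.
move=> x s; rewrite Pinv // sq_add // ?ej; last by lia.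
by ring.
Qed.

(** If all the free signs are 1, then Q d <= 0 gives d_n^2 <= -P d, and the bound by the square of
    v0.d is what [polar_neq_definite] asks for. *)
Lemma ineq_GCQ_iff v0 : dot v0 (bv n) = 0 ->
  (forall d, ineq_linear q l d -> - P d <= dot v0 d ^+ 2 /\ dot v0 d <= 0) ->
  GCQ g (@no_constraint R n) <-> ~ all_eq eps a n 1.
Proof.
move=> v0n Hv; split=> [G H|]; last exact: ineq_GCQ_suf.
have := G => /(ineq_GCQE J lq).
apply: (polar_neq_definite _ _ v0n); first by lia.
  by rewrite -[bv n]scale1r; apply: ineq_linear_bv => //; lia.
move=> d Td; have Ld := ineq_tcone_sub lq J Td; have := ineq_tconeQ lq J Td.
have [h1 h2] := Hv d Ld => h3; split=> //.
have := @sq_definite R n eps a 1 d an (expr1n _ _) H; lra.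
Qed.

End InequalitySplit.

(* Rewrites the boolean tests on numerals-and-offsets indices that [co_add] produces. *)
Ltac natdec := repeat match goal with
  | |- context [nat_of_bool (@eq_op _ ?i ?j)] =>
      first [ rewrite (_ : (@eq_op nat i j) = true); [|by apply/eqP; lia]
            | rewrite (_ : (@eq_op nat i j) = false); [|by apply/eqP; lia] ]
  end; rewrite /= ?(mulr0, addr0, add0r, mulr1).

Ltac no_shift := by rewrite !co_add_ne //; (lia || (apply/eqP; lia)).

(** * List B, types (1,k) to (4,k) *)

Section ListB.
Context {R : realType}.

(** For k = 2 the term in x_q joins the free diagonal part, which then starts at [q]; for k >= 3 it
    is a remainder and the free part starts at [q.+1]. In both cases [P] and [v0] are 0. *)
Lemma B1_ACQ_GCQ (n q k : nat) (eps : nat -> R) :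
  (2 <= k <= 5)%N -> (1 <= q)%N -> (q.+1 <= n)%N -> sgns eps ->
  let g := @gB R n q 0 (q - 1) (B1 q k eps) in
  (ACQ g (@no_constraint R n) <->
   all_eq eps q n (-1) \/ ((3 <= k)%N /\ all_eq eps q.+1 n (-1))) /\
  (GCQ g (@no_constraint R n) <->
   (k = 2%N /\ ~ all_eq eps q n 1) \/ ~ all_eq eps q.+1 n 1).
Proof.
move=> k25 q1 qn se g; have lq : (q - 1 < q)%N by lia.
have S (s : R) : all_eq eps q n s -> all_eq eps q.+1 n s.
  by move=> H j jn; apply: H; lia.
have [k2|k3] : k = 2%N \/ (3 <= k)%N by lia.
  have J : jet2 (B1 q k eps) (fun x : 'rV[R]_n => 0 + sq eps q x).
    apply: (jet2_intro (r := fun=> 0)); last 1 first.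
    - by move=> x; rewrite /B1 k2 add0r addr0 [in RHS]sqE //; lia.
    - by apply: qformD; [exact: qform0|exact: qform_sq].
    - exact: order3_0.
  split.
    split=> [A|[H|[]]]; last by rewrite k2.
      by left; have [] := ineq_ACQ_nec lq (leqnn q) (ltnW qn) se J (fun _ _ _ _ => erefl) A.
    by apply: (ineq_ACQ_suf lq (leqnn q) (ltnW qn) J).
  rewrite (ineq_GCQ_iff lq (leqnn q) (ltnW qn) se J (fun _ _ _ _ => erefl) (v0 := 0)) //; last 2 first.
  - exact: dot0l.
  - by move=> d _; rewrite dot0l oppr0 sqr_ge0.
  by split=> [H|[[]//|H /S]]; [left|exact: H].
have J : jet2 (B1 q k eps) (fun x : 'rV[R]_n => 0 + sq eps q.+1 x).
  apply: (jet2_intro (r := fun x => eps q * co x q ^+ k)); last 1 first.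
  - by move=> x; rewrite /B1 add0r addrC.
  - by apply: qformD; [exact: qform0|exact: qform_sq].
  - by apply: order3Z; exact: order3_exp.
split.
  split=> [A|H].
    by right; have [] := ineq_ACQ_nec lq (leqnSn q) qn se J (fun _ _ _ _ => erefl) A.
  apply: (ineq_ACQ_suf lq (leqnSn q) qn J) => //.
  by case: H => [/S|[]].
rewrite (ineq_GCQ_iff lq (leqnSn q) qn se J (fun _ _ _ _ => erefl) (v0 := 0)) //; last 2 first.
- exact: dot0l.
- by move=> d _; rewrite dot0l oppr0 sqr_ge0.
by split=> [|[[k2]|//]]; [right|rewrite k2 in k3].
Qed.

Lemma B2_ACQ_GCQ (n q : nat) (eps : nat -> R) :
  (1 <= q)%N -> (q.+2 <= n)%N -> sgns eps ->
  let g := @gB R n q 0 (q - 1) (B2 q eps) in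
  (ACQ g (@no_constraint R n) <-> all_eq eps q.+2 n (-1)) /\
  (GCQ g (@no_constraint R n) <-> ~ all_eq eps q.+2 n 1).
Proof.
move=> q1 qn se g; have lq : (q - 1 < q)%N by lia.
have J : jet2 (B2 q eps) (fun x : 'rV[R]_n => 0 + sq eps q.+2 x).
  apply: (jet2_intro (r := fun x => co x q ^+ 3 + eps q.+1 * (co x q.+1 * co x q.+1 * co x q))); last 1 first.
  - by move=> x; rewrite /B2; ring.
  - by apply: qformD; [exact: qform0|exact: qform_sq].
  - by apply: order3D; [exact: order3_exp|apply: order3Z; exact: order3_co3].
have qa : (q <= q.+2)%N by lia.
split.
  split=> [A|H]; first by have [] := ineq_ACQ_nec lq qa qn se J (fun _ _ _ _ => erefl) A.
  by apply: (ineq_ACQ_suf lq qa qn J).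
rewrite (ineq_GCQ_iff lq qa qn se J (fun _ _ _ _ => erefl) (v0 := 0)) //.
- exact: dot0l.
- by move=> d _; rewrite dot0l oppr0 sqr_ge0.
Qed.

Lemma B3_ACQ_GCQ (n q k : nat) (eps : nat -> R) :
  (2 <= k <= 4)%N -> (2 <= q)%N -> (q <= n)%N -> sgns eps ->
  let g := @gB R n q 0 (q - 2) (B3 q k eps) in
  (ACQ g (@no_constraint R n) <->
   all_eq eps (q - 1) n (-1) \/ ((3 <= k)%N /\ all_eq eps q n (-1))) /\
  (GCQ g (@no_constraint R n) <-> ~ all_eq eps q n 1).
Proof.
move=> k24 q2 qn se g; have lq : (q - 2 < q)%N by lia.
pose P (x : 'rV[R]_n) := (if k == 2%N then eps (q - 1)%N else 0) * co x (q - 1) ^+ 2.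
have J : jet2 (B3 q k eps) (fun x : 'rV[R]_n => P x + sq eps q x).
  apply: (jet2_intro (r := fun x => (if k == 2%N then 0 else eps (q - 1)%N) * co x (q - 1) ^+ k)); last 1 first.
  - by move=> x; rewrite /B3 pow_split /P addrAC.
  - by apply: qformD; [apply: qformZ; exact: qform_sqr|exact: qform_sq].
  - by apply: order3_pow; lia.
have Pinv x s j : (q <= j <= n)%N -> P (x + s *: bv j) = P x.
  by move=> jn; rewrite /P; no_shift.
split.
  split=> [A|H].
    have [H1 H2] := ineq_ACQ_nec lq (leqnn q) qn se J Pinv A.
    have [k2|k3] : k = 2%N \/ (3 <= k)%N by lia.
      left=> j jn; have [jq|jq] : j = (q - 1)%N \/ (q <= j)%N by lia.
        have := H2 (0 + (-1) *: bv (q - 1)); rewrite sq_add_out ?sq0; try lia.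
        rewrite /P k2 eqxx co_add; last by lia.
        rewrite co0; natdec; rewrite sqrrN expr1n mulr1 jq => H3.
        by apply: sgn_le0 => //; apply: H3 => //; apply: ineq_linear_neg; rewrite ?ler01 //; lia.
      by apply: H1; lia.
    by right.
  apply: (ineq_ACQ_suf lq (leqnn q) qn J).
    by case: H => [H|[]] // j jn; apply: H; lia.
  move=> d _; rewrite /P; case: eqP => k2; last by rewrite mul0r.
  case: H => [H|[]]; last by rewrite k2.
  by rewrite H; [rewrite mulN1r oppr_le0 sqr_ge0|lia].
apply: (ineq_GCQ_iff lq (leqnn q) qn se J Pinv (v0 := bv (q - 1))).
  by rewrite dot_bv ?co_bv; try lia; natdec.
move=> d [Ld _]; rewrite dot_bv; last by lia.
split; last by apply: Ld; lia.
rewrite /P; case: eqP => _; last by rewrite mul0r oppr0 sqr_ge0.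
by have [->|->] := se (q - 1)%N; have := sqr_ge0 (co d (q - 1)); lra.
Qed.

Lemma tcone_add_neg n q l (f Q : 'rV[R]_n -> R) d u : (l < q)%N -> jet2 f Q ->
  (forall s, 0 < s -> ineq_linear q l (d + s *: u) /\ Q (d + s *: u) < 0) ->
  tcone (ineq_feasible q l f) d.
Proof.
move=> lq J H; apply: tcone_closed => e e0; have [h h0 Hh] := small_step u e0.
exists (d + h *: u); split; last exact: Hh.
  by have [Lh Qh] := H h h0; exact: (ineq_tcone_neg J).
Qed.

(** ACQ fails because x_{q-1} x_q is 1 at -e_{q-1} - e_q. With a positive free part, e_q is always
    tangent, as a limit of e_q - s e_{q-1}; so GCQ depends on -e_q, where the sign of the term in
    x_q^k decides. *)
Lemma B4_ACQ_GCQ (n q k : nat) (eps : nat -> R) :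
  (3 <= k <= 4)%N -> (2 <= q)%N -> (q.+1 <= n)%N -> sgns eps ->
  let g := @gB R n q 0 (q - 2) (B4 q k eps) in
  ~ ACQ g (@no_constraint R n) /\
  (GCQ g (@no_constraint R n) <->
   ~ all_eq eps q.+1 n 1 \/ eps q = (-1) ^+ k.+1).
Proof.
move=> k34 q2 qn se g; have lq : (q - 2 < q)%N by lia.
pose P (x : 'rV[R]_n) := co x (q - 1) * co x q.
have J : jet2 (B4 q k eps) (fun x : 'rV[R]_n => P x + sq eps q.+1 x).
  apply: (jet2_intro (r := fun x => eps q * co x q ^+ k)); last 1 first.
  - by move=> x; rewrite /B4 /P; ring.
  - by apply: qformD; [exact: qform_co2|exact: qform_sq].
  - by apply: order3Z; apply: order3_exp; lia.
have Pinv x s j : (q.+1 <= j <= n)%N -> P (x + s *: bv j) = P x.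
  by move=> jn; rewrite /P; no_shift.
have Ln (s : R) : 0 <= s -> ineq_linear q (q - 2) (- s *: bv (q - 1) : 'rV[R]_n).
  by move=> s0; apply: ineq_linear_neg; lia || exact: s0.
split.
  move=> A; have [_ H] := ineq_ACQ_nec lq (leqnSn q) qn se J Pinv A.
  have := H (0 + (-1) *: bv (q - 1) + (-1) *: bv q); rewrite !sq_add_out ?sq0; try lia.
  rewrite /P !co_add; try lia; rewrite !co0; natdec.
  have -> : (-1 : R) * -1 = 1 by ring.
  move=> H'; suff : (1 : R) <= 0 by rewrite ler10.
  by apply: H' => //; apply: (ineq_linear_free lq); [lia|exact: (Ln 1)].
split=> [G|].
  apply: contrapT => /not_orP[/contrapT H eq]; have ek := sgn_neq_exprS (se q) eq.
  (* For this sign of [eps q], x_q < 0 would make all terms of the last constraint nonnegative and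
     the power positive; so x_q >= 0 on the feasible set, although -e_q is a linearised
     direction. *)
  move/(ineq_GCQE J lq): G; apply: (@polar_neq _ _ _ _ ((-1) *: bv q) ((-1) *: bv q)).
  - apply: tcone_dot_le0 => x Fx; rewrite dotZl dot_bv; last by lia.
    have fx := ineq_feasible_le0 lq Fx; have [Fx1 _] := Fx.
    have x1 : co x (q - 1) <= 0 by apply: Fx1; lia.
    have S := @sq_definite R n eps q.+1 1 x qn (expr1n _ _) H.
    rewrite mulN1r oppr_le0 leNgt; apply/negP => c0.
    have h1 : 0 < eps q * co x q ^+ k by rewrite ek -exprMn mulN1r exprn_gt0 // oppr_gt0.
    have h2 : 0 <= co x (q - 1) * co x q by rewrite mulr_le0 // ltW.
    move: fx; rewrite /B4; have := sqr_ge0 (co x n); lra.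
  - by apply: ineq_linear_bv => //; lia.
  - by rewrite dotZl dotZr dot_bv ?co_bv ?eqxx; try lia; rewrite mulr1 mulrNN mulr1.
have [H _|H] := pselect (~ all_eq eps q.+1 n 1).
  exact: (ineq_GCQ_suf lq (leqnSn q) qn se J Pinv).
case=> // ek; apply/(ineq_GCQE J lq).
apply: (@ineq_GCQ_shear _ _ _ _ lq _ _ J q (fun x => co x (q - 1)) (-1 *: bv (q - 1))).
- by lia.
- apply: (tcone_add_neg (u := -1 *: bv (q - 1)) lq J) => s s0; split.
    rewrite scalerA mulrN1; apply: ineq_linearD; last by apply: Ln; exact: ltW.
    by rewrite -[bv q]scale1r; apply: ineq_linear_bv => //; lia.
  rewrite scalerA mulrN1 -[bv q]add0r -[X in 0 + X]scale1r !sq_add_out ?sq0; try lia.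
  by rewrite /P !co_add; try lia; rewrite !co0; natdec; rewrite oppr_lt0.
- rewrite -scaleN1r; apply: ineq_tcone_ray; first by apply: ineq_linear_bv => //; lia.
  exists 1 => // t /andP[t0 _]; rewrite scalerA mulrN1 -[X in B4 _ _ _ X]add0r /B4.
  rewrite sq_add_out ?sq0 ?co_add; try lia; rewrite !co0; natdec.
  have tk : 0 < t ^+ k by rewrite exprn_gt0.
  rewrite (_ : _ + _ = - t ^+ k) ?oppr_le0 ?ltW // ek.
  have k34' : k = 3%N \/ k = 4%N by lia.
  by case: k34' => ->; ring.
- move=> x s; rewrite /P sq_add_out; try lia.
  by rewrite !co_add; try lia; natdec; ring.
- by move=> x s; rewrite coD coZ.
- by apply: (Ln 1).
- by rewrite coZ co_bv ?eqxx ?mulr1 ?oppr_eq0 ?oner_eq0 //; lia.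
Qed.

End ListB.

(** * List B, types (5) to (9) *)

Section ListBTwoInequalities.
Context {R : realType}.

Lemma B5_ACQ_GCQ (n q : nat) (eps : nat -> R) :
  (2 <= q)%N -> (q.+1 <= n)%N -> sgns eps ->
  let g := @gB R n q 0 (q - 2) (B5 q eps) in
  (ACQ g (@no_constraint R n) <->
   eps (q - 1)%N = -1 /\ all_eq eps q.+1 n (-1)) /\
  (GCQ g (@no_constraint R n) <-> ~ all_eq eps q.+1 n 1).
Proof.
move=> q2 qn se g; have lq : (q - 2 < q)%N by lia.
pose P (x : 'rV[R]_n) := eps (q - 1)%N * co x (q - 1) ^+ 2.
have J : jet2 (B5 q eps) (fun x : 'rV[R]_n => P x + sq eps q.+1 x).
  apply: (jet2_intro (r := fun x => co x q ^+ 3)); last 1 first.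
  - by move=> x; rewrite /B5 /P addrAC.
  - by apply: qformD; [apply: qformZ; exact: qform_sqr|exact: qform_sq].
  - exact: order3_exp.
have Pinv x s j : (q.+1 <= j <= n)%N -> P (x + s *: bv j) = P x.
  by move=> jn; rewrite /P; no_shift.
split.
  split=> [A|[e1 H]].
    have [H1 H2] := ineq_ACQ_nec lq (leqnSn q) qn se J Pinv A; split=> //.
    have := H2 (0 + (-1) *: bv (q - 1)); rewrite sq_add_out ?sq0; try lia.
    rewrite /P co_add; last by lia.
    rewrite co0; natdec; rewrite sqrrN expr1n mulr1 => H3.
    by apply: sgn_le0 => //; apply: H3 => //; apply: ineq_linear_neg; rewrite ?ler01 //; lia.
  apply: (ineq_ACQ_suf lq (leqnSn q) qn J) => // d _.
  by rewrite /P e1 mulN1r oppr_le0 sqr_ge0.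
apply: (ineq_GCQ_iff lq (leqnSn q) qn se J Pinv (v0 := bv (q - 1))).
  by rewrite dot_bv ?co_bv; try lia; natdec.
move=> d [Ld _]; rewrite dot_bv; last by lia.
split; last by apply: Ld; lia.
by rewrite /P; have [->|->] := se (q - 1)%N; have := sqr_ge0 (co d (q - 1)); lra.
Qed.

(** The factor 1 + |a| is the K of the separating form. As x and y have the same sign, (x + y)^2
    dominates x^2 + y^2 as well as xy. *)
Lemma quad2_bound (d1 d2 a x y : R) : sgn d1 -> sgn d2 -> x <= 0 -> y <= 0 ->
  `|d1 * x ^+ 2 + d2 * y ^+ 2 + a * (y * x)| <= ((1 + `|a|) * (x + y)) ^+ 2 /\
  (1 + `|a|) * (x + y) <= 0.
Proof.
move=> s1 s2 x0 y0; have K0 : 0 <= `|a| by [].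
split; last by rewrite mulr_ge0_le0 //; lra.
have xy := mulr_le0 y0 x0; have x2 := sqr_ge0 x; have y2 := sqr_ge0 y.
have h1 : `|a * (y * x)| <= `|a| * (y * x) by rewrite normrM (ger0_norm xy).
have h2 : `|d1 * x ^+ 2| <= x ^+ 2.
  by case: s1 => ->; rewrite ?mulN1r ?mul1r ?normrN ger0_norm.
have h3 : `|d2 * y ^+ 2| <= y ^+ 2.
  by case: s2 => ->; rewrite ?mulN1r ?mul1r ?normrN ger0_norm.
have := ler_normD (d1 * x ^+ 2 + d2 * y ^+ 2) (a * (y * x)).
have := ler_normD (d1 * x ^+ 2) (d2 * y ^+ 2).
have h6 : 0 <= `|a| * (x ^+ 2 + y ^+ 2) by rewrite mulr_ge0 // addr_ge0.
have h7 : 0 <= `|a| * (y * x) by rewrite mulr_ge0.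
have h8 : 0 <= `|a| ^+ 2 * (x + y) ^+ 2 by rewrite mulr_ge0 ?sqr_ge0.
lra.
Qed.

Lemma B6_ACQ_GCQ (n q : nat) (d1 d2 a : R) (eps : nat -> R) :
  (3 <= q)%N -> (q <= n)%N -> sgn d1 -> sgn d2 -> cond1 d1 d2 a -> sgns eps ->
  let g := @gB R n q 0 (q - 3) (B6 q d1 d2 a eps) in
  (ACQ g (@no_constraint R n) <->
   [/\ d1 = -1, d2 = -1, a < 2 & all_eq eps q n (-1)]) /\
  (GCQ g (@no_constraint R n) <-> ~ all_eq eps q n 1).
Proof.
move=> q3 qn s1 s2 c1 se g; have lq : (q - 3 < q)%N by lia.
pose P (x : 'rV[R]_n) := d1 * co x (q - 1) ^+ 2 + d2 * co x (q - 2) ^+ 2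
  + a * (co x (q - 2) * co x (q - 1)).
have J : jet2 (B6 q d1 d2 a eps) (fun x : 'rV[R]_n => P x + sq eps q x).
  apply: (jet2_intro (r := fun=> 0)); last 1 first.
  - by move=> x; rewrite /B6 /P; ring.
  - apply: qformD; last exact: qform_sq.
    by do 2?[apply: qformD]; apply: qformZ; (exact: qform_sqr || exact: qform_co2).
  - exact: order3_0.
have Pinv x s j : (q <= j <= n)%N -> P (x + s *: bv j) = P x.
  by move=> jn; rewrite /P; no_shift.
have Ln (s t : R) : 0 <= s -> 0 <= t ->
    ineq_linear q (q - 3) (0 + - s *: bv (q - 1) + - t *: bv (q - 2) : 'rV[R]_n).
  by move=> s0 t0; rewrite add0r; apply: ineq_linearD; apply: ineq_linear_neg; (lia || assumption).
split.
  split=> [A|[d1E d2E a2 H]].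
    have [H1 H2] := ineq_ACQ_nec lq (leqnn q) qn se J Pinv A.
    have T (s t : R) : 0 <= s -> 0 <= t -> d1 * s ^+ 2 + d2 * t ^+ 2 + a * (t * s) <= 0.
      move=> s0 t0; have := H2 _ (Ln s t s0 t0).
      rewrite !sq_add_out ?sq0; try lia.
      by rewrite /P !co_add; try lia; rewrite !co0; natdec; rewrite !sqrrN mulrNN; exact.
    have d1E : d1 = -1.
      by apply: sgn_le0 => //; have := T 1 0 ler01 (lexx _); rewrite expr1n expr0n mul0r !mulr0 mulr1 !addr0.
    have d2E : d2 = -1.
      by apply: sgn_le0 => //; have := T 0 1 (lexx _) ler01; rewrite expr1n expr0n !mulr0 mulr1 addr0 add0r.
    (* Testing at (1, 1) gives a <= 2 only; equality would make the form degenerate, against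
       [cond1]. *)
    split=> //; rewrite lt_neqAle; apply/andP; split.
      by apply: contraTneq c1 => ->; rewrite /cond1 d1E d2E negbK; apply/eqP; ring.
    have := T 1 1 ler01 ler01; rewrite d1E d2E !expr1n !mulr1; lra.
  apply: (ineq_ACQ_suf lq (leqnn q) qn J) => // d [Ld _].
  have x0 : co d (q - 1) <= 0 by apply: Ld; lia.
  have y0 : co d (q - 2) <= 0 by apply: Ld; lia.
  have := mulr_le0 y0 x0; have := sqr_ge0 (co d (q - 1) - co d (q - 2)).
  rewrite /P d1E d2E => h1 h2; have h3 : a * (co d (q - 2) * co d (q - 1)) <= 2 * (co d (q - 2) * co d (q - 1)).
    by rewrite ler_wpM2r // ltW.
  lra.
apply: (ineq_GCQ_iff lq (leqnn q) qn se J Pinv (v0 := (1 + `|a|) *: (bv (q - 1) + bv (q - 2)))).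
  by rewrite dotZl dotDl !dot_bv ?co_bv; try lia; natdec.
move=> d [Ld _]; rewrite dotZl dotDl !dot_bv; try lia.
have x0 : co d (q - 1) <= 0 by apply: Ld; lia.
have y0 : co d (q - 2) <= 0 by apply: Ld; lia.
have [h1 h2] := quad2_bound a s1 s2 x0 y0; split=> //.
by have := ler_norm (- P d); rewrite normrN; rewrite /P in h1 *; lra.
Qed.

Lemma B7_ACQ_GCQ (n q : nat) (e' : R) (eps : nat -> R) :
  (3 <= q)%N -> (q <= n)%N -> sgn e' -> sgns eps ->
  let g := @gB R n q 0 (q - 3) (B7 q e' eps) in
  (ACQ g (@no_constraint R n) <->
   eps (q - 2)%N = -1 /\ all_eq eps q n (-1)) /\
  (GCQ g (@no_constraint R n) <-> ~ all_eq eps q n 1).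
Proof.
move=> q3 qn s1 se g; have lq : (q - 3 < q)%N by lia.
pose P (x : 'rV[R]_n) := eps (q - 2)%N * (co x (q - 2) ^+ 2 + 2 * e' * (co x (q - 2) * co x (q - 1))
  + e' ^+ 2 * co x (q - 1) ^+ 2).
have J : jet2 (B7 q e' eps) (fun x : 'rV[R]_n => P x + sq eps q x).
  apply: (jet2_intro (r := fun x => eps (q - 1)%N * co x (q - 1) ^+ 3)); last 1 first.
  - by move=> x; rewrite /B7 /P; ring.
  - apply: qformD; last exact: qform_sq.
    apply: qformZ; apply: qformD; last by apply: qformZ; exact: qform_sqr.
    by apply: qformD; [exact: qform_sqr|apply: qformZ; exact: qform_co2].
  - by apply: order3Z; exact: order3_exp.
have Pinv x s j : (q <= j <= n)%N -> P (x + s *: bv j) = P x.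
  by move=> jn; rewrite /P; no_shift.
split.
  split=> [A|[e1 H]].
    have [H1 H2] := ineq_ACQ_nec lq (leqnn q) qn se J Pinv A; split=> //.
    have := H2 (0 + (-1) *: bv (q - 2)); rewrite sq_add_out ?sq0; try lia.
    rewrite /P !co_add; try lia.
    rewrite !co0; natdec; rewrite sqrrN expr1n expr0n !mulr0 !addr0 mulr1 => H3.
    by apply: sgn_le0 => //; apply: H3 => //; apply: ineq_linear_neg; rewrite ?ler01 //; lia.
  apply: (ineq_ACQ_suf lq (leqnn q) qn J) => // d _.
  rewrite /P e1 mulN1r oppr_le0.
  by have := sqr_ge0 (co d (q - 2) + e' * co d (q - 1)); lra.
apply: (ineq_GCQ_iff lq (leqnn q) qn se J Pinv (v0 := bv (q - 1) + bv (q - 2))).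
  by rewrite dotDl !dot_bv ?co_bv; try lia; natdec.
move=> d [Ld _]; rewrite dotDl !dot_bv; try lia.
have x0 : co d (q - 1) <= 0 by apply: Ld; lia.
have y0 : co d (q - 2) <= 0 by apply: Ld; lia.
rewrite /P; move: (co d (q - 1)) (co d (q - 2)) x0 y0 => x y x0 y0.
split; last by lra.
have xy := mulr_le0 y0 x0; have := sqr_ge0 (x + y); have := sqr_ge0 (x - y).
by have [->|->] := se (q - 2)%N; case: s1 => ->; rewrite ?sqrrN expr1n; lra.
Qed.

Lemma B8_ACQ_GCQ (n q : nat) (e' : R) (eps : nat -> R) :
  (3 <= q)%N -> (q <= n)%N -> sgn e' -> sgns eps ->
  let g := @gB R n q 0 (q - 3) (B8 q e' eps) in
  (ACQ g (@no_constraint R n) <->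
   [/\ eps (q - 1)%N = -1, e' = -1 & all_eq eps q n (-1)]) /\
  (GCQ g (@no_constraint R n) <-> ~ all_eq eps q n 1).
Proof.
move=> q3 qn s1 se g; have lq : (q - 3 < q)%N by lia.
pose P (x : 'rV[R]_n) := eps (q - 1)%N * co x (q - 1) ^+ 2 + e' * (co x (q - 2) * co x (q - 1)).
have J : jet2 (B8 q e' eps) (fun x : 'rV[R]_n => P x + sq eps q x).
  apply: (jet2_intro (r := fun x => eps (q - 2)%N * co x (q - 2) ^+ 3)); last 1 first.
  - by move=> x; rewrite /B8 /P; ring.
  - apply: qformD; last exact: qform_sq.
    by apply: qformD; apply: qformZ; [exact: qform_sqr|exact: qform_co2].
  - by apply: order3Z; exact: order3_exp.
have Pinv x s j : (q <= j <= n)%N -> P (x + s *: bv j) = P x.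
  by move=> jn; rewrite /P; no_shift.
have Ln (s t : R) : 0 <= s -> 0 <= t ->
    ineq_linear q (q - 3) (0 + - s *: bv (q - 1) + - t *: bv (q - 2) : 'rV[R]_n).
  by move=> s0 t0; rewrite add0r; apply: ineq_linearD; apply: ineq_linear_neg; (lia || assumption).
split.
  split=> [A|[e1 e'1 H]].
    have [H1 H2] := ineq_ACQ_nec lq (leqnn q) qn se J Pinv A.
    have T (s t : R) : 0 <= s -> 0 <= t -> eps (q - 1)%N * s ^+ 2 + e' * (t * s) <= 0.
      move=> s0 t0; have := H2 _ (Ln s t s0 t0).
      rewrite !sq_add_out ?sq0; try lia.
      by rewrite /P !co_add; try lia; rewrite !co0; natdec; rewrite !sqrrN mulrNN; exact.
    have e1 : eps (q - 1)%N = -1.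
      by apply: sgn_le0 => //; have := T 1 0 ler01 (lexx _); rewrite expr1n mul0r !mulr0 mulr1 addr0.
    split=> //; case: s1 => // e'1.
    (* With e' = 1 the form -s^2 + ts is positive at s = 1, t = 2. *)
    by have := T 1 2 ler01 (ler0n _ _); rewrite e1 e'1 expr1n; lra.
  apply: (ineq_ACQ_suf lq (leqnn q) qn J) => // d [Ld _].
  have x0 : co d (q - 1) <= 0 by apply: Ld; lia.
  have y0 : co d (q - 2) <= 0 by apply: Ld; lia.
  by rewrite /P e1 e'1; have := mulr_le0 y0 x0; have := sqr_ge0 (co d (q - 1)); lra.
apply: (ineq_GCQ_iff lq (leqnn q) qn se J Pinv (v0 := bv (q - 1) + bv (q - 2))).
  by rewrite dotDl !dot_bv ?co_bv; try lia; natdec.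
move=> d [Ld _]; rewrite dotDl !dot_bv; try lia.
have x0 : co d (q - 1) <= 0 by apply: Ld; lia.
have y0 : co d (q - 2) <= 0 by apply: Ld; lia.
rewrite /P; move: (co d (q - 1)) (co d (q - 2)) x0 y0 => x y x0 y0.
split; last by lra.
have xy := mulr_le0 y0 x0; have := sqr_ge0 x; have := sqr_ge0 y.
by have [->|->] := se (q - 1)%N; case: s1 => ->; lra.
Qed.

(** If e01 or e02 is 1, tilting e_q slightly along the matching negative axis makes [P] negative, so
    e_q is tangent; -e_q is tangent through the cubic term. The shear argument then yields GCQ
    whatever the free signs. *)
Lemma B9_ACQ_GCQ (n q : nat) (e01 e02 e12 : R) (eps : nat -> R) :
  (3 <= q)%N -> (q.+1 <= n)%N -> sgn e01 -> sgn e02 -> sgn e12 -> sgns eps ->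
  let g := @gB R n q 0 (q - 3) (B9 q e01 e02 e12 eps) in
  ~ ACQ g (@no_constraint R n) /\
  (GCQ g (@no_constraint R n) <->
   [\/ ~ all_eq eps q.+1 n 1, e01 = 1 | e02 = 1]).
Proof.
move=> q3 qn s01 s02 s12 se g; have lq : (q - 3 < q)%N by lia.
pose P (x : 'rV[R]_n) := e01 * (co x (q - 1) * co x q) + e02 * (co x (q - 2) * co x q)
  + e12 * (co x (q - 2) * co x (q - 1)).
have J : jet2 (B9 q e01 e02 e12 eps) (fun x : 'rV[R]_n => P x + sq eps q.+1 x).
  apply: (jet2_intro (r := fun x => co x q ^+ 3)); last 1 first.
  - by move=> x; rewrite /B9 /P; ring.
  - apply: qformD; last exact: qform_sq.
    by apply: qformD; [apply: qformD|]; apply: qformZ; exact: qform_co2.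
  - exact: order3_exp.
have Pinv x s j : (q.+1 <= j <= n)%N -> P (x + s *: bv j) = P x.
  by move=> jn; rewrite /P; no_shift.
have Ln c (s : R) : (q - 3 < c < q)%N -> 0 <= s ->
    ineq_linear q (q - 3) (- s *: bv c : 'rV[R]_n).
  by move=> cq s0; apply: ineq_linear_neg; (lia || assumption).
have Lq (s : R) : ineq_linear q (q - 3) (s *: bv q : 'rV[R]_n).
  by apply: ineq_linear_bv => //; lia.
split.
  move=> A; have [_ H] := ineq_ACQ_nec lq (leqnSn q) qn se J Pinv A.
  have := H (0 + (-1) *: bv (q - 1) + (- e01) *: bv q); rewrite !sq_add_out ?sq0; try lia.
  rewrite /P !co_add; try lia; rewrite !co0; natdec.
  rewrite !mul0r !mulr0 !addr0 mulrNN mul1r -expr2 (sgn_sqr s01).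
  move=> H'; suff : (1 : R) <= 0 by rewrite ler10.
  by apply: H' => //; apply: (ineq_linear_free lq); [lia|apply: (Ln _ 1); rewrite ?ler01 //; lia].
split=> [G|].
  apply: contrapT => N.
  have H : all_eq eps q.+1 n 1 by apply: contrapT => H; apply: N; constructor 1.
  have n1 : e01 <> 1 by move=> e; apply: N; constructor 2.
  have n2 : e02 <> 1 by move=> e; apply: N; constructor 3.
  have E1 := sgn_neq1 s01 n1; have E2 := sgn_neq1 s02 n2.
  move/(ineq_GCQE J lq): G.
  (* The sign of x_q alone does not separate, since e12 ab may be negative (a, b, c stand for
     x_{q-1}, x_{q-2}, x_q). If c > -a - b, then -(a + b) c >= (a + b)^2, which absorbs that term
     and contradicts feasibility. *)
  apply: (@polar_neq _ _ _ _ (bv (q - 1) + bv (q - 2) + bv q) (1 *: bv q)) => //.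
  - apply: tcone_dot_le0 => x Fx; rewrite !dotDl !dot_bv; try lia.
    have fx := ineq_feasible_le0 lq Fx; have [Fx1 _] := Fx.
    have x1 : co x (q - 1) <= 0 by apply: Fx1; lia.
    have x2 : co x (q - 2) <= 0 by apply: Fx1; lia.
    have S := @sq_definite R n eps q.+1 1 x qn (expr1n _ _) H.
    move: fx; rewrite /B9 E1 E2; have := sqr_ge0 (co x n).
    move: S x1 x2; move: (sq eps q.+1 x) (co x n) (co x (q - 1)) (co x (q - 2)) (co x q).
    move=> S y a b c Sy a0 b0 y0 fx; rewrite leNgt; apply/negP => abc.
    have ab := mulr_le0 a0 b0.
    have c0 : 0 < c by lra.
    have c3 : 0 < c ^+ 3 by rewrite exprn_gt0.
    have h1 : (- a - b) * (- a - b) <= c * (- a - b) by apply: ler_wpM2r; lra.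
    have h2 : - (a * b) <= e12 * b * a by case: s12 => ->; lra.
    have h3 := sqr_ge0 a; have h4 := sqr_ge0 b; lra.
  - by rewrite dotZr !dotDl !dot_bv ?co_bv; try lia; natdec.
have [H _|H] := pselect (~ all_eq eps q.+1 n 1).
  exact: (ineq_GCQ_suf lq (leqnSn q) qn se J Pinv).
move=> H1; have {}H1 : e01 = 1 \/ e02 = 1 by case: H1 => //; [left|right].
apply/(ineq_GCQE J lq).
apply: (@ineq_GCQ_shear _ _ _ _ lq _ _ J q
         (fun x => e01 * co x (q - 1) + e02 * co x (q - 2)) (-1 *: bv (q - 1))).
- by lia.
- have [c [cq cE]] : exists c, (q - 3 < c < q)%N /\ forall s : R, 0 < s -> P (0 + 1 *: bv q + (- s) *: bv c) < 0.
    case: H1 => E; [exists (q - 1)%N|exists (q - 2)%N]; (split=> [|s s0]; first by lia);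
      rewrite /P !co_add; try lia; rewrite !co0; natdec;
      by rewrite E ?mul0r ?mulr0 ?addr0 ?add0r mul1r oppr_lt0.
  apply: (tcone_add_neg (u := -1 *: bv c) lq J) => s s0; rewrite scalerA mulrN1; split.
    by apply: ineq_linearD; [rewrite -[bv q]scale1r|apply: Ln => //; exact: ltW].
  have := cE s s0; rewrite add0r scale1r => h.
  rewrite -[bv q]add0r -[X in 0 + X]scale1r !sq_add_out ?sq0; try lia.
  by rewrite add0r scale1r addr0.
- rewrite -scaleN1r; apply: ineq_tcone_ray => //.
  exists 1 => // t /andP[t0 _]; rewrite scalerA mulrN1 -[X in B9 _ _ _ _ _ X]add0r /B9.
  rewrite sq_add_out ?sq0 ?co_add; try lia; rewrite !co0; natdec.
  by rewrite ?mulr0 ?mul0r ?addr0 exprNn -signr_odd /= expr1 mulN1r oppr_le0 exprn_ge0 // ltW.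
- move=> x s; rewrite /P sq_add_out; try lia.
  by rewrite !co_add; try lia; natdec; ring.
- by move=> x s; rewrite !coD !coZ; ring.
- by apply: (Ln _ 1); rewrite ?ler01 //; lia.
- rewrite !coZ !co_bv; try lia; natdec.
  by rewrite ?mulr0 ?addr0 mulrN1 oppr_eq0; case: s01 => ->; rewrite ?oppr_eq0 oner_eq0.
Qed.

End ListBTwoInequalities.

(** * Ternary copositivity and List B, type (10) *)

Section ListBThreeInequalities.
Context {R : realType}.

(** A copositivity criterion for x^2 + y^2 + z^2 - u xy - v xz - w yz in which x is the variable
    shared by the coefficients [u] and [v]. *)
Definition pair_cond (u v w : R) : Prop :=
  [/\ u <= 0, v <= 0 & w < 2] \/
  [/\ 0 < u < 2, 0 < v < 2 &
      w + u * v / 2 < 2 * Num.sqrt ((1 - u ^+ 2 / 4) * (1 - v ^+ 2 / 4))].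

(* Completing the square in the first variable leaves a binary form whose
   nonnegativity on the quadrant is AM-GM. *)
Lemma pair_cond_copositive (u v w : R) : pair_cond u v w -> forall x y z : R,
  0 <= x -> 0 <= y -> 0 <= z ->
  u * (x * y) + v * (x * z) + w * (y * z) <= x ^+ 2 + y ^+ 2 + z ^+ 2.
Proof.
move=> K x y z x0 y0 z0.
have xy := mulr_ge0 x0 y0; have xz := mulr_ge0 x0 z0; have yz := mulr_ge0 y0 z0.
case: K => [[u0 v0 w2]|[/andP[u0 u2] /andP[v0 v2]]].
  have h1 := mulr_le0_ge0 u0 xy; have h2 := mulr_le0_ge0 v0 xz.
  have h3 : w * (y * z) <= 2 * (y * z) by rewrite ler_wpM2r // ltW.
  by have := sqr_ge0 (y - z); have := sqr_ge0 x; lra.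
set p := 1 - u ^+ 2 / 4; set r := 1 - v ^+ 2 / 4 => H.
have p0 : 0 <= p.
  have : u ^+ 2 <= 2 ^+ 2 by rewrite lerXn2r ?nnegrE // ltW.
  by rewrite /p; lra.
have r0 : 0 <= r.
  have : v ^+ 2 <= 2 ^+ 2 by rewrite lerXn2r ?nnegrE // ltW.
  by rewrite /r; lra.
have h3 : (w + u * v / 2) * (y * z) <= 2 * Num.sqrt (p * r) * (y * z).
  by rewrite ler_wpM2r // ltW.
have h4 : 2 * Num.sqrt (p * r) * (y * z) <= p * y ^+ 2 + r * z ^+ 2.
  rewrite sqrtrM // -[in p * _](sqr_sqrtr p0) -[in r * _](sqr_sqrtr r0).
  by have := sqr_ge0 (Num.sqrt p * y - Num.sqrt r * z); lra.
have := sqr_ge0 (x - (u * y + v * z) / 2).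
move: h3 h4; rewrite /p /r; lra.
Qed.

(** Converse of [pair_cond_copositive] for nondegenerate forms, the first variable being chosen so
    that [u] and [v] fall on the same side of 0. Nondegeneracy turns the weak inequalities obtained
    from test vectors into strict ones. *)
Lemma copositive_pair_cond (u v w : R) :
  (forall x y z : R, 0 <= x -> 0 <= y -> 0 <= z ->
     u * (x * y) + v * (x * z) + w * (y * z) <= x ^+ 2 + y ^+ 2 + z ^+ 2) ->
  u != 2 -> v != 2 -> w != 2 ->
  -4 + u * v * w + u ^+ 2 + v ^+ 2 + w ^+ 2 != 0 ->
  (u <= 0) = (v <= 0) -> pair_cond u v w.
Proof.
move=> H u2 v2 w2 D uv.
have u2' : u < 2.
  by rewrite lt_neqAle u2 /=; have := H 1 1 0 ler01 ler01 (lexx _); lra.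
have v2' : v < 2.
  by rewrite lt_neqAle v2 /=; have := H 1 0 1 ler01 (lexx _) ler01; lra.
have w2' : w < 2.
  by rewrite lt_neqAle w2 /=; have := H 0 1 1 (lexx _) ler01 ler01; lra.
have [u0|u0] := lerP u 0; first by left; split=> //; rewrite -uv.
have v0 : 0 < v by rewrite ltNge -uv -ltNge.
right; rewrite u0 v0; split=> //; set p := 1 - u ^+ 2 / 4; set r := 1 - v ^+ 2 / 4.
have p0 : 0 < p.
  have : u ^+ 2 < 2 ^+ 2 by rewrite ltrXn2r ?nnegrE // ltW.
  by rewrite /p; lra.
have r0 : 0 < r.
  have : v ^+ 2 < 2 ^+ 2 by rewrite ltrXn2r ?nnegrE // ltW.
  by rewrite /r; lra.
have s0 : 0 < Num.sqrt (p * r) by rewrite sqrtr_gt0 mulr_gt0.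
have s2 : Num.sqrt (p * r) ^+ 2 = p * r by rewrite sqr_sqrtr // mulr_ge0 // ltW.
rewrite lt_neqAle; apply/andP; split.
  (* Equality would mean (w + uv/2)^2 = 4pr, which is the vanishing of the determinant in [D]. *)
  apply: contraNneq D => E.
  have : (w + u * v / 2) ^+ 2 = 4 * (p * r) by rewrite E exprMn s2; ring.
  by rewrite /p /r => E2; apply/eqP; lra.
(* The point of equality in both steps of the converse: x makes the completed square vanish, and y =
   sqrt r, z = sqrt p give equality in AM-GM. *)
have := H ((u * Num.sqrt r + v * Num.sqrt p) / 2) (Num.sqrt r) (Num.sqrt p).
have sr := sqrtr_ge0 r; have sp := sqrtr_ge0 p.
have x0 : 0 <= (u * Num.sqrt r + v * Num.sqrt p) / 2.
  by rewrite divr_ge0 // addr_ge0 // mulr_ge0 // ltW.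
move=> /(_ x0 sr sp) H'.
have E1 : Num.sqrt r ^+ 2 = r by rewrite sqr_sqrtr // ltW.
have E2 : Num.sqrt p ^+ 2 = p by rewrite sqr_sqrtr // ltW.
have E3 : Num.sqrt r * Num.sqrt p = Num.sqrt (p * r) by rewrite mulrC sqrtrM // ltW.
have H2 : (w + u * v / 2) * (Num.sqrt r * Num.sqrt p) <= p * Num.sqrt r ^+ 2 + r * Num.sqrt p ^+ 2.
  by rewrite /p /r in H' *; lra.
rewrite E1 E2 E3 in H2.
have H3 : (w + u * v / 2) * Num.sqrt (p * r) <= 2 * Num.sqrt (p * r) * Num.sqrt (p * r).
  rewrite (_ : 2 * Num.sqrt (p * r) * Num.sqrt (p * r) = 2 * Num.sqrt (p * r) ^+ 2); last by ring.
  by rewrite s2; lra.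
by rewrite -(ler_pM2r s0).
Qed.

Lemma quad3_bound (d : nat -> R) (a12 a13 a23 x y z : R) : sgns d ->
  x <= 0 -> y <= 0 -> z <= 0 ->
  `|d 1%N * x ^+ 2 + d 2%N * y ^+ 2 + d 3%N * z ^+ 2
    + (a12 * (x * y) + a13 * (x * z) + a23 * (y * z))|
  <= ((1 + (`|a12| + `|a13| + `|a23|)) * (x + y + z)) ^+ 2 /\
  (1 + (`|a12| + `|a13| + `|a23|)) * (x + y + z) <= 0.
Proof.
move=> sd x0 y0 z0; set K := `|a12| + `|a13| + `|a23|.
have K0 : 0 <= K by rewrite /K !addr_ge0.
split; last by rewrite mulr_ge0_le0 //; lra.
have xy := mulr_le0 x0 y0; have xz := mulr_le0 x0 z0; have yz := mulr_le0 y0 z0.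
have x2 := sqr_ge0 x; have y2 := sqr_ge0 y; have z2 := sqr_ge0 z.
pose S := x * y + x * z + y * z; have S0 : 0 <= S by rewrite !addr_ge0.
have ab (a t : R) : 0 <= t -> t <= S -> `|a| <= K -> `|a * t| <= `|a| * S.
  by move=> t0 tS aK; rewrite normrM (ger0_norm t0) ler_wpM2l.
have b (e t : R) : 0 <= t -> sgn e -> `|e * t| <= t.
  by move=> t0 [->|->]; rewrite ?mulN1r ?mul1r ?normrN ger0_norm.
have n12 : 0 <= `|a12| by []. have n13 : 0 <= `|a13| by []. have n23 : 0 <= `|a23| by [].
have h1 : `|a12 * (x * y)| <= `|a12| * S by apply: ab; rewrite /S /K //; lra.
have h2 : `|a13 * (x * z)| <= `|a13| * S by apply: ab; rewrite /S /K //; lra.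
have h3 : `|a23 * (y * z)| <= `|a23| * S by apply: ab; rewrite /S /K //; lra.
have h4 := b _ _ x2 (sd 1%N); have h5 := b _ _ y2 (sd 2%N); have h6 := b _ _ z2 (sd 3%N).
have t1 := ler_normD (d 1%N * x ^+ 2 + d 2%N * y ^+ 2 + d 3%N * z ^+ 2)
    (a12 * (x * y) + a13 * (x * z) + a23 * (y * z)).
have t2 := ler_normD (d 1%N * x ^+ 2 + d 2%N * y ^+ 2) (d 3%N * z ^+ 2).
have t3 := ler_normD (d 1%N * x ^+ 2) (d 2%N * y ^+ 2).
have t4 := ler_normD (a12 * (x * y) + a13 * (x * z)) (a23 * (y * z)).
have t5 := ler_normD (a12 * (x * y)) (a13 * (x * z)).
have e1 : `|a12| * S + `|a13| * S + `|a23| * S = K * S by rewrite /K; ring.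
have q1 : 0 <= K * (x ^+ 2 + y ^+ 2 + z ^+ 2) by rewrite mulr_ge0 // !addr_ge0.
have q2 : 0 <= K ^+ 2 * (x + y + z) ^+ 2 by rewrite mulr_ge0 ?sqr_ge0.
have q3 : 0 <= K * S by rewrite mulr_ge0.
have -> : ((1 + K) * (x + y + z)) ^+ 2 =
   (x ^+ 2 + y ^+ 2 + z ^+ 2) + 2 * S + 2 * (K * (x ^+ 2 + y ^+ 2 + z ^+ 2)) + 4 * (K * S)
   + K ^+ 2 * (x + y + z) ^+ 2 by rewrite /S; ring.
lra.
Qed.

Lemma B10_ACQ_GCQ (n q : nat) (d : nat -> R) (a : nat -> nat -> R) (e0 : R)
    (eps : nat -> R) :
  (4 <= q)%N -> (q <= n)%N -> sgns d -> cond2 d a -> sgn e0 -> sgns eps ->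
  let g := @gB R n q 0 (q - 4) (B10 q d a e0 eps) in
  let al := fun i j : nat => if (i < j)%N then a i j else a j i in
  (ACQ g (@no_constraint R n) <->
   [/\ all_eq d 1 3 (-1), all_eq eps q n (-1) &
       exists i j k : nat,
         perm_eq [:: i; j; k] [:: 1; 2; 3]%N /\
         ([/\ al i j <= 0, al i k <= 0 & al j k < 2] \/
          [/\ 0 < al i j < 2, 0 < al i k < 2 &
              al j k + al i j * al i k / 2
              < 2 * Num.sqrt ((1 - al i j ^+ 2 / 4)
                              * (1 - al i k ^+ 2 / 4))])]) /\
  (GCQ g (@no_constraint R n) <-> ~ all_eq eps q n 1).
Proof.
move=> q4 qn sd [c2 c3] s0 se g al; have lq : (q - 4 < q)%N by lia.
pose P (x : 'rV[R]_n) := d 1%N * co x (q - 3) ^+ 2 + d 2%N * co x (q - 2) ^+ 2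
  + d 3%N * co x (q - 1) ^+ 2
  + (a 1%N 2%N * (co x (q - 3) * co x (q - 2)) + a 1%N 3%N * (co x (q - 3) * co x (q - 1))
     + a 2%N 3%N * (co x (q - 2) * co x (q - 1))).
have J : jet2 (B10 q d a e0 eps) (fun x : 'rV[R]_n => P x + sq eps q x).
  apply: (jet2_intro (r := fun x => e0 * (co x (q - 3) * co x (q - 2) * co x (q - 1)))); last 1 first.
  - move=> x; rewrite /B10 /P /index_iota /= !big_cons !big_nil /=.
    have -> : (q - 4 + 1 = q - 3)%N by lia.
    have -> : (q - 4 + 2 = q - 2)%N by lia.
    have -> : (q - 4 + 3 = q - 1)%N by lia.
    by ring.
  - apply: qformD; last exact: qform_sq.
    apply: qformD.
      by do 2?[apply: qformD]; apply: qformZ; exact: qform_sqr.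
    by do 2?[apply: qformD]; apply: qformZ; exact: qform_co2.
  - by apply: order3Z; exact: order3_co3.
have Pinv x s j : (q <= j <= n)%N -> P (x + s *: bv j) = P x.
  by move=> jn; rewrite /P; no_shift.
have Ln (r s t : R) : 0 <= r -> 0 <= s -> 0 <= t ->
    ineq_linear q (q - 4) (0 + - r *: bv (q - 3) + - s *: bv (q - 2) + - t *: bv (q - 1) : 'rV[R]_n).
  move=> r0 t0 u0; rewrite add0r.
  by do 2?[apply: ineq_linearD]; apply: ineq_linear_neg; (lia || assumption).
split.
  split=> [A|[d1 H [i [j [k [pm C]]]]]].
    have [H1 H2] := ineq_ACQ_nec lq (leqnn q) qn se J Pinv A.
    have T (r s t : R) : 0 <= r -> 0 <= s -> 0 <= t ->
        d 1%N * r ^+ 2 + d 2%N * s ^+ 2 + d 3%N * t ^+ 2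
        + (a 1%N 2%N * (r * s) + a 1%N 3%N * (r * t) + a 2%N 3%N * (s * t)) <= 0.
      move=> r0 t0 u0; have := H2 _ (Ln r s t r0 t0 u0).
      rewrite !sq_add_out ?sq0; try lia.
      by rewrite /P !co_add; try lia; rewrite !co0; natdec; rewrite !sqrrN !mulrNN; exact.
    have d1E : d 1%N = -1 by apply: sgn_le0 => //; have := T 1 0 0 ler01 (lexx _) (lexx _); lra.
    have d2E : d 2%N = -1 by apply: sgn_le0 => //; have := T 0 1 0 (lexx _) ler01 (lexx _); lra.
    have d3E : d 3%N = -1 by apply: sgn_le0 => //; have := T 0 0 1 (lexx _) (lexx _) ler01; lra.
    split=> //.
      by move=> j j3; have [->|[->|->]] : j = 1%N \/ j = 2%N \/ j = 3%N by lia.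
    have ne i j : (1 <= i < j)%N && (j <= 3)%N -> a i j != 2.
      move=> ij; have := c2 i j ij; apply: contraNneq => ->.
      have dE m : (1 <= m <= 3)%N -> d m = -1.
        by move=> m3; have [->|[->|->]] : m = 1%N \/ m = 2%N \/ m = 3%N by lia.
      by rewrite !dE; [apply/eqP; ring|lia|lia].
    have n12 : a 1%N 2%N != 2 by exact: ne.
    have n13 : a 1%N 3%N != 2 by exact: ne.
    have n23 : a 2%N 3%N != 2 by exact: ne.
    rewrite d1E d2E d3E in c3.
    (* Of the three coefficients, two lie on the same side of 0; the index they share is taken as
       i. *)
    have [E|E] := eqVneq (a 1%N 2%N <= 0) (a 1%N 3%N <= 0).
      exists 1%N, 2%N, 3%N; split=> //; rewrite /al /=.
      apply: copositive_pair_cond => //.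
        by move=> x y z x0 y0 z0; have := T x y z x0 y0 z0; rewrite d1E d2E d3E; lra.
      by apply: contraNneq c3 => h; apply/eqP; lra.
    have [E'|E'] := eqVneq (a 1%N 2%N <= 0) (a 2%N 3%N <= 0).
      exists 2%N, 1%N, 3%N; split=> //; rewrite /al /=.
      apply: copositive_pair_cond => //.
        by move=> x y z x0 y0 z0; have := T y x z y0 x0 z0; rewrite d1E d2E d3E; lra.
      by apply: contraNneq c3 => h; apply/eqP; lra.
    exists 3%N, 1%N, 2%N; split=> //; rewrite /al /=.
    apply: copositive_pair_cond => //.
    - by move=> x y z x0 y0 z0; have := T y z x y0 z0 x0; rewrite d1E d2E d3E; lra.
    - by apply: contraNneq c3 => h; apply/eqP; lra.
    - by move: E E'; case: (a 1%N 2%N <= 0); case: (a 1%N 3%N <= 0); case: (a 2%N 3%N <= 0).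
  apply: (ineq_ACQ_suf lq (leqnn q) qn J) => // x [Lx _].
  have dE m : (1 <= m <= 3)%N -> d m = -1 by exact: d1.
  rewrite /P !dE //.
  have x0 : 0 <= - co x (q - 3) by rewrite oppr_ge0; apply: Lx; lia.
  have y0 : 0 <= - co x (q - 2) by rewrite oppr_ge0; apply: Lx; lia.
  have z0 : 0 <= - co x (q - 1) by rewrite oppr_ge0; apply: Lx; lia.
  have {}C : pair_cond (al i j) (al i k) (al j k) by [].
  have mem m : m \in [:: i; j; k] -> (m == 1%N) || ((m == 2%N) || (m == 3%N)).
    by rewrite (perm_mem pm) !inE.
  have mi : i \in [:: i; j; k] by rewrite !inE eqxx.
  have mj : j \in [:: i; j; k] by rewrite !inE eqxx orbT.
  have mk : k \in [:: i; j; k] by rewrite !inE eqxx !orbT.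
  case/or3P: (mem _ mi) => /eqP ei; case/or3P: (mem _ mj) => /eqP ej;
    case/or3P: (mem _ mk) => /eqP ek; move: pm C; rewrite ei ej ek /al //= => _ C.
  - by have := pair_cond_copositive C x0 y0 z0; lra.
  - by have := pair_cond_copositive C x0 z0 y0; lra.
  - by have := pair_cond_copositive C y0 x0 z0; lra.
  - by have := pair_cond_copositive C y0 z0 x0; lra.
  - by have := pair_cond_copositive C z0 x0 y0; lra.
  - by have := pair_cond_copositive C z0 y0 x0; lra.
pose Kc := 1 + (`|a 1%N 2%N| + `|a 1%N 3%N| + `|a 2%N 3%N|).
apply: (ineq_GCQ_iff lq (leqnn q) qn se J Pinv (v0 := Kc *: (bv (q - 3) + bv (q - 2) + bv (q - 1)))).
  by rewrite dotZl !dotDl !dot_bv ?co_bv; try lia; natdec.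
move=> x [Lx _]; rewrite dotZl !dotDl !dot_bv; try lia.
have x0 : co x (q - 3) <= 0 by apply: Lx; lia.
have y0 : co x (q - 2) <= 0 by apply: Lx; lia.
have z0 : co x (q - 1) <= 0 by apply: Lx; lia.
have [h1 h2] := quad3_bound (a 1%N 2%N) (a 1%N 3%N) (a 2%N 3%N) sd x0 y0 z0; split=> //.
by apply: le_trans h1; have := ler_norm (- P x); rewrite normrN.
Qed.

End ListBThreeInequalities.

(** * One equality constraint: Lists A and C *)

Section EqualitySplit.
Context {R : realType}.
Variable n : nat.

(** The exponent [k] separates the scale t^k of the point from the correction t of its direction: k
    = 2 balances a cubic against a square, k = 1 a quartic against a square. *)
Lemma tcone_curve (F : set 'rV[R]_n) d w k : (0 < k)%N ->
  (forall t : R, 0 < t -> F (t ^+ k *: (d + t *: w))) -> tcone F d.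
Proof.
move=> k0 H e e0; pose M := `|d| + `|w| + 1.
have M0 : 0 < M by rewrite ltr_wpDl // addr_ge0.
pose m := Num.min 1 (e / M); pose t := m / 2.
have m0 : 0 < m by rewrite lt_min ltr01 divr_gt0.
have t0 : 0 < t by rewrite divr_gt0.
have /andP[t1 te] : (t < 1) && (t < e / M).
  by rewrite -lt_min ltr_pdivrMr // ltr_pMr // ltr1n.
have tM : t * M < e by rewrite -ltr_pdivlMr.
have tw : t * `|w| <= t * M by rewrite ler_pM2l // /M addrAC lerDr addr_ge0.
exists (t ^+ k), (d + t *: w); split; [exact: exprn_gt0|exact: H| |]; last first.
  by rewrite addrAC subrr add0r normrZ gtr0_norm // (le_lt_trans tw).
apply: le_lt_trans tM; rewrite normrZ gtr0_norm ?exprn_gt0 //.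
have tk : t ^+ k <= t by rewrite -[leRHS]expr1; apply: ler_wiXn2l => //; exact: ltW.
apply: ler_pM => //; first by rewrite exprn_ge0 // ltW.
have := ler_normD d (t *: w); rewrite normrZ gtr0_norm //.
have : t * `|w| <= `|w| by rewrite ler_piMl // ltW.
by rewrite /M; lra.
Qed.

Variables (q : nat) (f Q : 'rV[R]_n -> R).
Hypothesis J : jet2 f Q.

Lemma eq_tcone_sign_change d u w :
  (forall h, 0 < h -> [/\ orthant q (d + h *: u), orthant q (d + h *: w) &
     Q (d + h *: u) * Q (d + h *: w) < 0]) -> tcone (eq_feasible q f) d.
Proof.
move=> H; apply: (eq_tcone_sign J) => e e0; pose h := e / (`|u| + `|w| + 1) / 2.
have K0 : 0 < `|u| + `|w| + 1 by rewrite ltr_wpDl // addr_ge0.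
have h0 : 0 < h by rewrite !divr_gt0.
have he : h * (`|u| + `|w| + 1) < e.
  rewrite (_ : h * _ = e / 2); last by rewrite /h; field; rewrite gt_eqF.
  by rewrite ltr_pdivrMr // ltr_pMr // ltr1n.
have near z : `|z| <= `|u| + `|w| + 1 -> `|d + h *: z - d| < e.
  move=> zK; rewrite addrAC subrr add0r normrZ gtr0_norm // (le_lt_trans _ he) //.
  by rewrite ler_pM2l.
have nu : `|u| <= `|u| + `|w| + 1 by rewrite -addrA lerDl addr_ge0.
have nw : `|w| <= `|u| + `|w| + 1 by rewrite addrAC lerDr addr_ge0.
have [Ou Ow] := H h h0.
have [Q0|Q0] := ltrP 0 (Q (d + h *: u)) => QQ.
  exists (d + h *: u), (d + h *: w); split=> //; [exact: near|exact: near|split=> //].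
  by rewrite -(pmulr_rlt0 _ Q0).
have Q1 : Q (d + h *: u) < 0.
  by rewrite lt_neqAle Q0 andbT; apply: contraTneq QQ => ->; rewrite mul0r ltxx.
exists (d + h *: w), (d + h *: u); split=> //; [exact: near|exact: near|split=> //].
by rewrite -(nmulr_rlt0 _ Q1).
Qed.

Variables (a : nat) (P : 'rV[R]_n -> R) (eps : nat -> R).
Hypotheses (qa : (q < a)%N) (an : (a <= n)%N) (se : sgns eps).
Hypothesis QE : forall x, Q x = P x + sq eps a x.
Hypothesis Pinv : forall x s j, (a <= j <= n)%N -> P (x + s *: bv j) = P x.

Let Q0 : Q 0 = 0.
Proof.
by have [[_ h _] _] := J; have := h 0 0; rewrite scale0r expr0n mul0r.
Qed.

Let Qadd x s j : (a <= j <= n)%N -> Q (x + s *: bv j) = Q x + eps j * (s * (2 * co x j + s)).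
Proof. by move=> jn; rewrite !QE Pinv // sq_add //; [ring|lia]. Qed.

(** The last axis is a free direction of the orthant, and [Q] is 1 or -1 on it. *)
Lemma eq_split_not_ACQ : ~ ACQ (@reg_ineq R n q) (one_constraint f).
Proof.
move/(eq_ACQE q J); apply: (eq_not_ACQ J (j := n)); first by lia.
rewrite -[bv n]scale1r -[X in Q X]add0r Qadd; last by lia.
rewrite Q0 co0 mulr0 !add0r !mul1r mulr1.
by case: (se n) => ->; rewrite ?oppr_eq0 oner_eq0.
Qed.

Lemma eq_split_GCQ : both_signs eps a n -> GCQ (@reg_ineq R n q) (one_constraint f).
Proof.
move=> /both_signsP-/(_ se)[[i [ia ei]] [j [ja ej]]]; apply/(eq_GCQE q J).
apply: (eq_GCQ_both_signs J (i := i) (j := j)); try lia.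
- by move=> x s; rewrite Qadd // ei mul1r.
- by move=> x s; rewrite Qadd // ej mulN1r.
Qed.

Lemma eq_tcone_definite s d : sgn s -> all_eq eps a n s ->
  tcone (eq_feasible q f) d -> co d n ^+ 2 <= `|P d|.
Proof.
move=> ss H Td; have := sq_definite d an (sgn_sqr ss) H.
have := eq_tconeQ J Td; rewrite QE => /eqP; rewrite addr_eq0 => /eqP E h.
rewrite (le_trans h) // E normrN.
case: ss => ->; first by rewrite mul1r ler_norm.
by rewrite mulN1r -normrN ler_norm.
Qed.

(** Here a tangent direction satisfies Q = 0, so a definite free part of either sign gives d_n^2 <=
    |P d|; this is why |P| replaces -P. *)
Lemma eq_split_GCQ_iff v0 : dot v0 (bv n) = 0 ->
  (forall d, orthant q d -> `|P d| <= dot v0 d ^+ 2 /\ dot v0 d <= 0) ->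
  GCQ (@reg_ineq R n q) (one_constraint f) <-> both_signs eps a n.
Proof.
move=> v0n Hv; split=> [G|]; last exact: eq_split_GCQ.
apply: contrapT => /not_both_signs-/(_ se)[s ss H].
have := G => /(eq_GCQE q J); apply: (polar_neq_definite _ _ v0n); first by lia.
  by rewrite -[bv n]scale1r; apply: orthant_bv; lia.
move=> d Td; have [h1 h2] := Hv d (eq_tcone_sub Td); split=> //.
exact: le_trans (eq_tcone_definite ss H Td) h1.
Qed.

Variables (c : nat) (m : 'rV[R]_n -> R).
Hypothesis ca : (q < c < a)%N.
Hypothesis Pc : forall x s, P (x + s *: bv c) = P x + s * m x.
Hypothesis m0 : m 0 = 0.

Let P0 : P 0 = 0.
Proof. by have := Q0; rewrite QE sq0 addr0. Qed.

Lemma eq_split_curve s t r : P (r *: (s *: bv c + t *: bv n)) = 0 /\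
  sq eps a (r *: (s *: bv c + t *: bv n) : 'rV[R]_n) = eps n * (r * t) ^+ 2.
Proof.
have cn : (1 <= c <= n)%N by lia. have aa : (a <= n <= n)%N by lia.
rewrite scalerDr !scalerA -[_ + _]add0r addrA; split.
  by rewrite Pinv // Pc P0 m0 mulr0 addr0.
rewrite sq_add //; last by lia.
rewrite sq_add_out //; try lia.
rewrite sq0 co_add // co0 add0r add0r (_ : (n == c) = false) ?mulr0 ?mulr0 ?add0r ?expr2 //.
by apply/eqP; lia.
Qed.

Variables (b : nat) (mb : R).
Hypotheses (bq : (1 <= b <= q)%N) (mb0 : mb != 0).
Hypothesis mD : forall x s, m (x + s *: bv b) = m x + s * mb.

(** Here [m] is the factor of x_c in [P], and [mb] its coefficient at the inequality variable x_b;
    the admissible direction that makes [m] nonzero is -e_b. *)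
Lemma eq_split_shear : tcone (eq_feasible q f) (bv c) ->
  tcone (eq_feasible q f) (- bv c) -> GCQ (@reg_ineq R n q) (one_constraint f).
Proof.
have cn : (1 <= c <= n)%N by lia.
have mbE : m (-1 *: bv b) = - mb by rewrite -[_ *: _]add0r mD m0 mulN1r add0r.
move=> T1 T2; apply/(eq_GCQE q J).
apply: (eq_GCQ_shear J (c := c) (m := m) (b := -1 *: bv b)) => //; first by lia.
- by move=> x s; rewrite !QE Pc sq_add_out; [rewrite addrAC|lia|lia].
- by move=> x s; rewrite scalerA mD mbE mulrN1 mulNr mulrN.
- move=> i iq; rewrite coZ co_bv; last by lia.
  by rewrite mulN1r oppr_le0 ler0n.
- by rewrite mbE oppr_eq0.
Qed.

(** With a free part definite of sign [s], the direction -s e_c is reached by balancing the cubic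
    against x_n^2, and s e_c by a sign change of [Q], for which the coefficient [mb = 1] has the
    right sign. *)
Lemma eq_split_shear_cubic s : mb = 1 -> (forall t, P (t *: bv b) = 0) ->
  (forall x, f x = co x c ^+ 3 + Q x) -> sgn s -> all_eq eps a n s ->
  GCQ (@reg_ineq R n q) (one_constraint f).
Proof.
move=> mb1 Pb fE ss H; have cn : (1 <= c <= n)%N by lia.
have en : eps n = s by apply: H; lia.
have s2 := sgn_sqr ss.
(* Along t^2 (-s e_c + t e_n) the cubic gives -s^3 t^6 and the free square s t^6, which cancel. *)
have T1 : tcone (eq_feasible q f) (- s *: bv c).
  apply: (@tcone_curve _ _ (bv n) 2) => // t t0; split.
    apply: orthantZ; first exact: sqr_ge0.
    by apply: orthant_free; [lia|apply: orthant_bv; lia].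
  have [E1 E2] := eq_split_curve (- s) t (t ^+ 2).
  rewrite fE QE E1 E2 coZ coD !coZ !co_bv; try lia.
  rewrite eqxx (_ : (c == n) = false); last by apply/eqP; lia.
  rewrite en /= mulr1 mulr0 addr0 add0r (_ : _ + _ = t ^+ 6 * (s * (1 - s ^+ 2))); last by ring.
  by rewrite s2 subrr !mulr0.
(* Near s e_c, a step h along -e_b gives Q = -s h and a step h along e_n gives Q = s h^2, of
   opposite signs. *)
have T2 : tcone (eq_feasible q f) (s *: bv c).
  apply: (@eq_tcone_sign_change _ (-1 *: bv b) (bv n)) => h h0; split.
  - apply: orthantD; first by apply: orthant_bv; lia.
    move=> i iq; rewrite !coZ co_bv; last by lia.
    by rewrite mulN1r mulrN oppr_le0 mulr_ge0 // ltW.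
  - by apply: orthant_free; [lia|apply: orthant_bv; lia].
  - have -> : Q (s *: bv c + h *: (-1 *: bv b)) = - s * h.
      rewrite addrC scalerA mulrN1 QE Pc Pb sq_add_out; try lia.
      rewrite -[_ *: bv b]add0r mD m0 mb1 sq_add_out ?sq0; try lia.
      by ring.
    have -> : Q (s *: bv c + h *: bv n) = s * h ^+ 2.
      rewrite Qadd; last by lia.
      rewrite -[_ *: bv c]add0r QE Pc P0 m0 sq_add_out ?sq0; try lia.
      rewrite co_add // co0 (_ : (n == c) = false) ?en; last by apply/eqP; lia.
      by rewrite /= mulr0; ring.
    have -> : - s * h * (s * h ^+ 2) = - (s ^+ 2 * h ^+ 3) by ring.
    by rewrite s2 mul1r oppr_lt0 exprn_gt0.
apply: eq_split_shear; case: ss => sE; move: T1 T2; rewrite sE ?opprK scale1r scaleN1r //.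
Qed.

End EqualitySplit.

(** * List A: the quadratic part is a free diagonal form *)

Section ListA.
Context {R : realType}.

Lemma eq_GCQ_null_iff n q (f : 'rV[R]_n -> R) a eps : (q < a)%N -> (a <= n)%N -> sgns eps ->
  jet2 f (fun x => 0 + sq eps a x) ->
  ~ ACQ (@reg_ineq R n q) (one_constraint f) /\
  (GCQ (@reg_ineq R n q) (one_constraint f) <-> both_signs eps a n).
Proof.
move=> qa an se J; split.
  exact: (eq_split_not_ACQ J qa an se (fun=> erefl) (fun _ _ _ _ => erefl)).
apply: (eq_split_GCQ_iff J qa an se (fun=> erefl) (fun _ _ _ _ => erefl) (v0 := 0)).
  exact: dot0l.
by move=> d _; rewrite dot0l normr0 sqr_ge0.
Qed.

Lemma A1_ACQ_GCQ (n k : nat) (eps : nat -> R) :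
  (2 <= k <= 5)%N -> (2 <= n)%N -> sgns eps ->
  ~ ACQ (@no_constraint R n) (one_constraint (@A1 R n k eps)) /\
  (GCQ (@no_constraint R n) (one_constraint (@A1 R n k eps)) <->
   (k = 2%N /\ (exists j, (2 <= j <= n)%N /\ eps j = -1)) \/
   ((3 <= k)%N /\ both_signs eps 2 n)).
Proof.
move=> k25 n2 se; rewrite no_constraint_reg.
have [k2|k3] : k = 2%N \/ (3 <= k)%N by lia.
  (* The square of x_1 becomes one more free variable, of sign 1, so that a single sign -1 among the
     others already gives both signs. *)
  pose e j : R := if j == 1%N then 1 else eps j.
  have se' : sgns e by move=> j; rewrite /e; case: eqP => _; [left|].
  have J : jet2 (A1 k eps) (fun x : 'rV[R]_n => 0 + sq e 1 x).
    apply: (jet2_intro (r := fun=> 0)); last 1 first.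
    - move=> x; rewrite /A1 k2 add0r addr0 [in RHS]sqE; last by lia.
      rewrite /e eqxx mul1r; congr (_ + _); apply: eq_big_nat => j jn.
      by rewrite (_ : (j == 1%N) = false) //; apply/eqP; lia.
    - by apply: qformD; [exact: qform0|exact: qform_sq].
    - exact: order3_0.
  have [N G] := eq_GCQ_null_iff (ltn0Sn 0) (ltnW n2) se' J; split=> //.
  rewrite G; split=> [/both_signsP-/(_ se')[_ [j [jn ej]]]|[[_ [j [jn ej]]]|[]]]; last by rewrite k2.
    left; split=> //; exists j; move: ej; rewrite /e; case: eqP => [_ /esym/sgn_N1_neq1 //|j1 ej].
    by split=> //; lia.
  apply/both_signsP => //; split; first by exists 1%N; split; [lia|rewrite /e eqxx].
  exists j; split; first by lia.
  by rewrite /e ej; case: eqP => // j1; lia.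
have J : jet2 (A1 k eps) (fun x : 'rV[R]_n => 0 + sq eps 2 x).
  apply: (jet2_intro (r := fun x => co x 1 ^+ k)); last 1 first.
  - by move=> x; rewrite /A1 add0r addrC.
  - by apply: qformD; [exact: qform0|exact: qform_sq].
  - exact: order3_exp.
have [N G] := eq_GCQ_null_iff (ltn0Sn 1) n2 se J; split=> //.
by rewrite G; split=> [|[[k2]|[]//]]; [right|rewrite k2 in k3].
Qed.

Lemma A2_ACQ_GCQ (n : nat) (eps : nat -> R) : (4 <= n)%N -> sgns eps ->
  ~ ACQ (@no_constraint R n) (one_constraint (@A2 R n eps)) /\
  (GCQ (@no_constraint R n) (one_constraint (@A2 R n eps)) <->
   exists j, (4 <= j <= n)%N /\ eps j = -1).
Proof.
move=> n4 se; rewrite no_constraint_reg; have n3 := ltnW n4.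
(* The square of x_3 supplies the sign 1 of the free part, which starts at 3. *)
pose e j : R := if j == 3%N then 1 else eps j.
have se' : sgns e by move=> j; rewrite /e; case: eqP => _; [left|].
have J : jet2 (A2 eps) (fun x : 'rV[R]_n => 0 + sq e 3 x).
  apply: (jet2_intro (r := fun x => co x 1 ^+ 3 + eps 2%N * (co x 1 * co x 2 * co x 2))); last 1 first.
  - move=> x; rewrite /A2 add0r (sqE e x n3) (_ : e 3%N = 1) // (_ : sq e 4 x = sq eps 4 x); first by ring.
    apply: eq_big_nat => j jn; rewrite /e (_ : (j == 3%N) = false) //; apply/eqP; lia.
  - by apply: qformD; [exact: qform0|exact: qform_sq].
  - by apply: order3D; [exact: order3_exp|apply: order3Z; exact: order3_co3].
have [N G] := eq_GCQ_null_iff (ltn0Sn 2) n3 se' J; split=> //.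
rewrite G; split=> [/both_signsP-/(_ se')[_ [j [jn ej]]]|[j [jn ej]]].
  exists j; move: ej; rewrite /e; case: eqP => [_ /esym/sgn_N1_neq1 //|j3 ej].
  by split=> //; lia.
apply/both_signsP => //; split; first by exists 3%N; split; [lia|rewrite /e eqxx].
exists j; split; first by lia.
by rewrite /e ej; case: eqP => // j3; lia.
Qed.

End ListA.

(** * List C *)

Section ListC.
Context {R : realType}.

Lemma C1_ACQ_GCQ (n k : nat) (eps : nat -> R) :
  (2 <= k <= 4)%N -> (2 <= n)%N -> sgns eps ->
  ~ ACQ (@reg_ineq R n 1) (one_constraint (@C1 R n k eps)) /\
  (GCQ (@reg_ineq R n 1) (one_constraint (@C1 R n k eps)) <-> both_signs eps 2 n).
Proof.
move=> k24 n2 se; pose P (x : 'rV[R]_n) := (if k == 2%N then 1 else 0) * co x 1 ^+ 2.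
have J : jet2 (C1 k eps) (fun x : 'rV[R]_n => P x + sq eps 2 x).
  apply: (jet2_intro (r := fun x => (if k == 2%N then 0 else 1) * co x 1 ^+ k)); last 1 first.
  - by move=> x; rewrite /C1 -(mul1r (co x 1 ^+ k)) [in LHS](pow_split 1 1 k x) /P addrAC mul1r.
  - by apply: qformD; [apply: qformZ; exact: qform_sqr|exact: qform_sq].
  - by apply: order3_pow; lia.
have Pinv x s j : (2 <= j <= n)%N -> P (x + s *: bv j) = P x.
  by move=> jn; rewrite /P; no_shift.
split; first exact: (eq_split_not_ACQ J (ltnSn 1) n2 se (fun=> erefl) Pinv).
apply: (eq_split_GCQ_iff J (ltnSn 1) n2 se (fun=> erefl) Pinv (v0 := bv 1)).
  by rewrite dot_bv ?co_bv; try lia; natdec.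
move=> d Od; rewrite dot_bv; last by lia.
split; last by apply: Od.
rewrite /P; case: eqP => _; last by rewrite mul0r normr0 sqr_ge0.
by rewrite mul1r ger0_norm ?sqr_ge0.
Qed.

Lemma C2_ACQ_GCQ (n : nat) (eps : nat -> R) : (3 <= n)%N -> sgns eps ->
  ~ ACQ (@reg_ineq R n 1) (one_constraint (@C2 R n eps)) /\
  (GCQ (@reg_ineq R n 1) (one_constraint (@C2 R n eps)) <-> both_signs eps 3 n).
Proof.
move=> n3 se; pose P (x : 'rV[R]_n) := co x 1 ^+ 2.
have J : jet2 (C2 eps) (fun x : 'rV[R]_n => P x + sq eps 3 x).
  apply: (jet2_intro (r := fun x => co x 2 ^+ 3)); last 1 first.
  - by move=> x; rewrite /C2 /P; ring.
  - by apply: qformD; [exact: qform_sqr|exact: qform_sq].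
  - exact: order3_exp.
have Pinv x s j : (3 <= j <= n)%N -> P (x + s *: bv j) = P x.
  by move=> jn; rewrite /P; no_shift.
have q3 : (1 < 3)%N by [].
split; first exact: (eq_split_not_ACQ J q3 n3 se (fun=> erefl) Pinv).
apply: (eq_split_GCQ_iff J q3 n3 se (fun=> erefl) Pinv (v0 := bv 1)).
  by rewrite dot_bv ?co_bv; try lia; natdec.
move=> d Od; rewrite dot_bv; last by lia.
by split; [rewrite ger0_norm ?sqr_ge0|apply: Od].
Qed.

(** Both signs in the free part settle GCQ directly. Otherwise the question is whether e_2 and -e_2
    are both tangent: if so, the shear applies, and if not, the sign of x_2 on the feasible set
    separates. *)
Lemma C3_ACQ_GCQ (n k : nat) (eps : nat -> R) :
  (3 <= k <= 4)%N -> (3 <= n)%N -> sgns eps ->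
  ~ ACQ (@reg_ineq R n 1) (one_constraint (@C3 R n k eps)) /\
  (GCQ (@reg_ineq R n 1) (one_constraint (@C3 R n k eps)) <->
   (~~ odd k /\ (exists j, (3 <= j <= n)%N /\ eps j = -1)) \/
   (odd k /\ (eps 1%N = 1 \/ both_signs eps 3 n))).
Proof.
move=> k34 n3 se; pose P (x : 'rV[R]_n) := eps 1%N * (co x 1 * co x 2).
have QE x : P x + sq eps 3 x = P x + sq eps 3 x by [].
have fE x : @C3 R n k eps x = co x 2 ^+ k + (P x + sq eps 3 x).
  by rewrite /C3 /P; ring.
have J : jet2 (C3 k eps) (fun x : 'rV[R]_n => P x + sq eps 3 x).
  apply: (jet2_intro (r := fun x => co x 2 ^+ k)); last 1 first.
  - by move=> x; rewrite fE addrC.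
  - by apply: qformD; [apply: qformZ; exact: qform_co2|exact: qform_sq].
  - by apply: order3_exp; lia.
have Pinv x s j : (3 <= j <= n)%N -> P (x + s *: bv j) = P x.
  by move=> jn; rewrite /P; no_shift.
have q3 : (1 < 3)%N by [].
have both : both_signs eps 3 n -> GCQ (@reg_ineq R n 1) (one_constraint (C3 k eps)).
  exact: (eq_split_GCQ J q3 n3 se QE Pinv).
split; first exact: (eq_split_not_ACQ J q3 n3 se QE Pinv).
pose m (x : 'rV[R]_n) := eps 1%N * co x 1.
have Pc x s : P (x + s *: bv 2) = P x + s * m x.
  by rewrite /P /m !co_add; try lia; natdec; ring.
have m0 : m 0 = 0 by rewrite /m co0 mulr0.
have mD x s : m (x + s *: bv 1) = m x + s * eps 1%N.
  by rewrite /m !co_add; try lia; natdec; ring.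
have e1 : eps 1%N != 0 by case: (se 1%N) => ->; rewrite ?oppr_eq0 oner_eq0.
have fail (v w : 'rV[R]_n) : (forall x, eq_feasible 1 (C3 k eps) x -> dot v x <= 0) ->
    orthant 1 w -> 0 < dot v w -> ~ GCQ (@reg_ineq R n 1) (one_constraint (C3 k eps)).
  move=> Hv Ow vw /(eq_GCQE 1 J); apply: (@polar_neq _ _ _ _ v w) => // d; exact: tcone_dot_le0.
have [k3|k4] : k = 3%N \/ k = 4%N by lia.
  subst k; split=> [G|[[odd3 _]|[_ [e1E|B]]]]; [|by []| |exact: both]; last first.
    have [|/(not_both_signs se)[s ss H]] := pselect (both_signs eps 3 n); first exact: both.
    apply: (eq_split_shear_cubic J q3 n3 QE Pinv (isT : (1 < 2 < 3)%N) Pc m0 (isT : (1 <= 1 <= 1)%N) e1 mD e1E _ fE ss H).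
    by move=> t; rewrite /P !coZ !co_bv; try lia; natdec.
  right; split=> //; have [e1E|e1E] := se 1%N; first by left.
  right; apply: contrapT => /(not_both_signs se)[s ss H].
  (* If s x_2 > 0, then s times the equation is a sum of nonnegative terms with a positive cubic; so
     s x_2 <= 0 on the feasible set. *)
  have s2 := sgn_sqr ss; apply: (fail (s *: bv 2) (s *: bv 2)) G.
  - move=> x [Ox]; rewrite fE /P e1E mulN1r => fx; rewrite dotZl dot_bv; last by lia.
    have x1 : co x 1 <= 0 by apply: Ox.
    have S := sq_definite x n3 s2 H; rewrite leNgt; apply/negP => c0.
    have h1 : 0 < (s * co x 2) ^+ 3 by rewrite exprn_gt0.
    have h2 : 0 <= - co x 1 * (s * co x 2) by rewrite mulr_ge0 ?oppr_ge0 // ltW.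
    have : s * (co x 2 ^+ 3 + (- (co x 1 * co x 2) + sq eps 3 x)) = 0 by rewrite fx mulr0.
    have : (s * co x 2) ^+ 3 = s ^+ 2 * (s * co x 2 ^+ 3) by ring.
    by rewrite s2; have := sqr_ge0 (co x n); lra.
  - by apply: orthant_bv; lia.
  - by rewrite dotZl dot_bv ?coZ ?co_bv; try lia; natdec; rewrite -expr2 s2.
subst k; split=> [G|[[_ [j [jn ej]]]|[odd4 _]]]; last by [].
  left; split=> //; apply/(not_all_eq1 _ _ se) => H.
  (* With a positive free part, -eps_1 x_2 > 0 would make every term of the equation nonnegative and
     x_2^4 positive. *)
  apply: (fail (- eps 1%N *: bv 2) (- eps 1%N *: bv 2)) G.
  - move=> x [Ox]; rewrite fE /P => fx; rewrite dotZl dot_bv; last by lia.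
    have x1 : co x 1 <= 0 by apply: Ox.
    have S := sq_definite x n3 (expr1n _ _) H; rewrite leNgt; apply/negP => c0.
    have h2 : 0 <= - co x 1 * (- eps 1%N * co x 2) by rewrite mulr_ge0 ?oppr_ge0 // ltW.
    have h1 : 0 < co x 2 ^+ 4.
      by rewrite exprn_even_gt0 //=; apply: contraTneq c0 => ->; rewrite mulr0 ltxx.
    by have := sqr_ge0 (co x n); lra.
  - by apply: orthant_bv; lia.
  - rewrite dotZl dot_bv ?coZ ?co_bv; try lia; natdec.
    by rewrite mulrNN -expr2 (sgn_sqr (se _)).
have [|/(not_both_signs se)[s ss H]] := pselect (both_signs eps 3 n); first exact: both.
have en : eps n = -1 by rewrite -ej !H //; lia.
(* Along t (s' e_2 + t e_n) the quartic gives t^4 and the negative free square -t^4, whichever the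
   sign s'. *)
have curve s' : s' ^+ 2 = 1 -> tcone (eq_feasible 1 (C3 4 eps)) (s' *: bv 2 : 'rV[R]_n).
  move=> s2; apply: (@tcone_curve _ _ _ _ (bv n) 1) => // t t0; rewrite expr1; split.
    apply: orthantZ; first exact: ltW.
    by apply: orthant_free; [lia|apply: orthant_bv; lia].
  have [E1 E2] := eq_split_curve J q3 n3 QE Pinv (isT : (1 < 2 < 3)%N) Pc m0 s' t t.
  rewrite fE E1 E2 coZ coD !coZ !co_bv; try lia; natdec.
  rewrite en (_ : _ + _ = t ^+ 4 * ((s' ^+ 2) ^+ 2 - 1)); last by ring.
  by rewrite s2 expr1n subrr mulr0.
apply: (eq_split_shear J q3 n3 QE (isT : (1 < 2 < 3)%N) Pc m0 (isT : (1 <= 1 <= 1)%N) e1 mD).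
- by rewrite -[bv 2]scale1r; apply: curve; rewrite expr1n.
- by rewrite -[bv 2]scale1r -scaleNr; apply: curve; rewrite sqrrN expr1n.
Qed.

Lemma C4_ACQ_GCQ (n : nat) (d1 d2 a : R) (eps : nat -> R) :
  (3 <= n)%N -> sgn d1 -> sgn d2 -> sgns eps ->
  ~ ACQ (@reg_ineq R n 2) (one_constraint (@C4 R n d1 d2 a eps)) /\
  (GCQ (@reg_ineq R n 2) (one_constraint (@C4 R n d1 d2 a eps)) <-> both_signs eps 3 n).
Proof.
move=> n3 s1 s2 se.
pose P (x : 'rV[R]_n) := d1 * co x 1 ^+ 2 + d2 * co x 2 ^+ 2 + a * (co x 2 * co x 1).
have J : jet2 (C4 d1 d2 a eps) (fun x : 'rV[R]_n => P x + sq eps 3 x).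
  apply: (jet2_intro (r := fun=> 0)); last 1 first.
  - by move=> x; rewrite /C4 /P; ring.
  - apply: qformD; last exact: qform_sq.
    by do 2?[apply: qformD]; apply: qformZ; (exact: qform_sqr || exact: qform_co2).
  - exact: order3_0.
have Pinv x s j : (3 <= j <= n)%N -> P (x + s *: bv j) = P x.
  by move=> jn; rewrite /P; no_shift.
split; first exact: (eq_split_not_ACQ J (ltnSn 2) n3 se (fun=> erefl) Pinv).
apply: (eq_split_GCQ_iff J (ltnSn 2) n3 se (fun=> erefl) Pinv (v0 := (1 + `|a|) *: (bv 1 + bv 2))).
  by rewrite dotZl dotDl !dot_bv ?co_bv; try lia; natdec.
move=> d Od; rewrite dotZl dotDl !dot_bv; try lia.
by apply: quad2_bound => //; exact: Od.
Qed.

Lemma C5_ACQ_GCQ (n : nat) (eps : nat -> R) : (3 <= n)%N -> sgns eps ->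
  ~ ACQ (@reg_ineq R n 2) (one_constraint (@C5 R n eps)) /\
  (GCQ (@reg_ineq R n 2) (one_constraint (@C5 R n eps)) <-> both_signs eps 3 n).
Proof.
move=> n3 se.
pose P (x : 'rV[R]_n) := eps 1%N * co x 2 ^+ 2 + eps 2%N * (co x 1 * co x 2).
have J : jet2 (C5 eps) (fun x : 'rV[R]_n => P x + sq eps 3 x).
  apply: (jet2_intro (r := fun x => co x 1 ^+ 3)); last 1 first.
  - by move=> x; rewrite /C5 /P; ring.
  - apply: qformD; last exact: qform_sq.
    by apply: qformD; apply: qformZ; [exact: qform_sqr|exact: qform_co2].
  - exact: order3_exp.
have Pinv x s j : (3 <= j <= n)%N -> P (x + s *: bv j) = P x.
  by move=> jn; rewrite /P; no_shift.
split; first exact: (eq_split_not_ACQ J (ltnSn 2) n3 se (fun=> erefl) Pinv).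
apply: (eq_split_GCQ_iff J (ltnSn 2) n3 se (fun=> erefl) Pinv (v0 := bv 1 + bv 2)).
  by rewrite dotDl !dot_bv ?co_bv; try lia; natdec.
move=> d Od; rewrite dotDl !dot_bv; try lia.
have x0 : co d 1 <= 0 by exact: Od. have y0 : co d 2 <= 0 by exact: Od.
have xy := mulr_le0 x0 y0; have x2 := sqr_ge0 (co d 1); have y2 := sqr_ge0 (co d 2).
by rewrite /P; case: (se 1%N) (se 2%N) => -> [] ->; split; try lra; rewrite ler_norml; apply/andP; split; lra.
Qed.

Lemma C6_ACQ_GCQ (n : nat) (eps : nat -> R) : (3 <= n)%N -> sgns eps ->
  ~ ACQ (@reg_ineq R n 2) (one_constraint (@C6 R n eps)) /\
  (GCQ (@reg_ineq R n 2) (one_constraint (@C6 R n eps)) <-> both_signs eps 3 n).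
Proof.
move=> n3 se.
pose P (x : 'rV[R]_n) := co x 1 ^+ 2 + 2 * eps 1%N * (co x 1 * co x 2) + eps 1%N ^+ 2 * co x 2 ^+ 2.
have J : jet2 (C6 eps) (fun x : 'rV[R]_n => P x + sq eps 3 x).
  apply: (jet2_intro (r := fun x => eps 2%N * co x 2 ^+ 3)); last 1 first.
  - by move=> x; rewrite /C6 /P; ring.
  - apply: qformD; last exact: qform_sq.
    apply: qformD; last by apply: qformZ; exact: qform_sqr.
    by apply: qformD; [exact: qform_sqr|apply: qformZ; exact: qform_co2].
  - by apply: order3Z; exact: order3_exp.
have Pinv x s j : (3 <= j <= n)%N -> P (x + s *: bv j) = P x.
  by move=> jn; rewrite /P; no_shift.
split; first exact: (eq_split_not_ACQ J (ltnSn 2) n3 se (fun=> erefl) Pinv).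
apply: (eq_split_GCQ_iff J (ltnSn 2) n3 se (fun=> erefl) Pinv (v0 := bv 1 + bv 2)).
  by rewrite dotDl !dot_bv ?co_bv; try lia; natdec.
move=> d Od; rewrite dotDl !dot_bv; try lia.
have x0 : co d 1 <= 0 by exact: Od. have y0 : co d 2 <= 0 by exact: Od.
have xy := mulr_le0 x0 y0; have x2 := sqr_ge0 (co d 1 - co d 2).
have y2 := sqr_ge0 (co d 1 + co d 2).
by rewrite /P; case: (se 1%N) => ->; split; try lra; rewrite ler_norml; apply/andP; split; lra.
Qed.

(** A coefficient [eps 1] or [eps 2] equal to 1 makes e_3 and -e_3 tangent even when all the free
    squares have the same sign, by [eq_split_shear_cubic]; hence the three alternatives. *)
Lemma C7_ACQ_GCQ (n : nat) (eps : nat -> R) : (4 <= n)%N -> sgns eps ->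
  ~ ACQ (@reg_ineq R n 2) (one_constraint (@C7 R n eps)) /\
  (GCQ (@reg_ineq R n 2) (one_constraint (@C7 R n eps)) <->
   [\/ both_signs eps 4 n, eps 1%N = 1 | eps 2%N = 1]).
Proof.
move=> n4 se.
pose P (x : 'rV[R]_n) := eps 1%N * (co x 2 * co x 3) + eps 2%N * (co x 3 * co x 1)
  + eps 3%N * (co x 1 * co x 2).
have QE x : P x + sq eps 4 x = P x + sq eps 4 x by [].
have fE x : @C7 R n eps x = co x 3 ^+ 3 + (P x + sq eps 4 x).
  by rewrite /C7 /P; ring.
have J : jet2 (C7 eps) (fun x : 'rV[R]_n => P x + sq eps 4 x).
  apply: (jet2_intro (r := fun x => co x 3 ^+ 3)); last 1 first.
  - by move=> x; rewrite fE addrC.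
  - apply: qformD; last exact: qform_sq.
    by apply: qformD; [apply: qformD|]; apply: qformZ; exact: qform_co2.
  - exact: order3_exp.
have Pinv x s j : (4 <= j <= n)%N -> P (x + s *: bv j) = P x.
  by move=> jn; rewrite /P; no_shift.
have q4 : (2 < 4)%N by [].
split; first exact: (eq_split_not_ACQ J q4 n4 se QE Pinv).
have [B|/(not_both_signs se)[s ss H]] := pselect (both_signs eps 4 n).
  split=> _; [exact: Or31|exact: (eq_split_GCQ J q4 n4 se QE Pinv)].
pose m (x : 'rV[R]_n) := eps 1%N * co x 2 + eps 2%N * co x 1.
have Pc x t : P (x + t *: bv 3) = P x + t * m x.
  by rewrite /P /m !co_add; try lia; natdec; ring.
have m0 : m 0 = 0 by rewrite /m !co0 !mulr0 addr0.
have shear b mb : (1 <= b <= 2)%N -> mb = 1 -> (forall x t, m (x + t *: bv b) = m x + t * mb) ->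
    GCQ (@reg_ineq R n 2) (one_constraint (C7 eps)).
  move=> b2 mb1 mD; have mb0 : mb != 0 by rewrite mb1 oner_eq0.
  apply: (eq_split_shear_cubic J q4 n4 QE Pinv (isT : (2 < 3 < 4)%N) Pc m0 b2 mb0 mD mb1 _ fE ss H).
  move=> t; rewrite /P !coZ !co_bv; try lia.
  have [bE|bE] : b = 1%N \/ b = 2%N by lia.
    by rewrite bE /= !(mulr0, mul0r, addr0).
  by rewrite bE /= !(mulr0, mul0r, addr0).
have [e1|e1] := se 1%N.
  split=> _; first exact: Or32.
  by apply: (shear 2 (eps 1%N)) => // x t; rewrite /m !co_add; try lia; natdec; ring.
have [e2|e2] := se 2%N.
  split=> _; first exact: Or33.
  by apply: (shear 1 (eps 2%N)) => // x t; rewrite /m !co_add; try lia; natdec; ring.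
split=> [/(eq_GCQE 2 J) E|[B|E|E]]; last 3 first.
- exact: (eq_split_GCQ J q4 n4 se QE Pinv).
- by case: (@sgn_N1_neq1 R); rewrite -e1 E.
- by case: (@sgn_N1_neq1 R); rewrite -e2 E.
have s2 := sgn_sqr ss.
(* If s x_3 > -(x_1 + x_2), the mixed terms in s times the equation are at least (x_1 + x_2)^2,
   which absorbs the product x_1 x_2; what remains is positive. *)
exfalso; apply: (@polar_neq _ _ _ _ (bv 1 + bv 2 + s *: bv 3) (s *: bv 3)) E.
- apply: tcone_dot_le0 => x [Ox]; rewrite fE /P e1 e2 => fx.
  rewrite !dotDl dotZl !dot_bv; try lia.
  have a0 : co x 1 <= 0 by exact: Ox. have b0 : co x 2 <= 0 by exact: Ox.
  have S := sq_definite x n4 s2 H; have S0 := sqr_ge0 (co x n).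
  rewrite leNgt; apply/negP => c0.
  have ab := mulr_le0 a0 b0.
  have c1 : 0 < s * co x 3 by lra.
  have h1 : 0 < (s * co x 3) ^+ 3 by rewrite exprn_gt0.
  have h2 : (co x 1 + co x 2) ^+ 2 <= - (co x 1 + co x 2) * (s * co x 3).
    by rewrite -sqrrN expr2 ler_wpM2l //; lra.
  have h3 : - (co x 1 * co x 2) <= s * eps 3%N * (co x 1 * co x 2).
    by case: ss (se 3%N) => -> [] ->; lra.
  have a2 := sqr_ge0 (co x 1); have b2 := sqr_ge0 (co x 2).
  have : (s * co x 3) ^+ 3 = s ^+ 2 * (s * co x 3 ^+ 3) by ring.
  have := congr1 (fun z => s * z) fx; rewrite s2 mulr0; lra.
- by apply: orthant_bv; lia.
- rewrite !dotDl dotZl !dot_bv ?coZ ?co_bv; try lia; natdec.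
  by rewrite -expr2 s2.
Qed.

Lemma C8_ACQ_GCQ (n : nat) (d : nat -> R) (a : nat -> nat -> R) (eps : nat -> R) :
  (4 <= n)%N -> sgns d -> sgns eps ->
  ~ ACQ (@reg_ineq R n 3) (one_constraint (@C8 R n d a eps)) /\
  (GCQ (@reg_ineq R n 3) (one_constraint (@C8 R n d a eps)) <-> both_signs eps 4 n).
Proof.
move=> n4 sd se.
pose P (x : 'rV[R]_n) := d 1%N * co x 1 ^+ 2 + d 2%N * co x 2 ^+ 2 + d 3%N * co x 3 ^+ 2
  + (a 1%N 2%N * (co x 1 * co x 2) + a 1%N 3%N * (co x 1 * co x 3) + a 2%N 3%N * (co x 2 * co x 3)).
have J : jet2 (C8 d a eps) (fun x : 'rV[R]_n => P x + sq eps 4 x).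
  apply: (jet2_intro (r := fun x => eps 1%N * (co x 1 * co x 2 * co x 3))); last 1 first.
  - by move=> x; rewrite /C8 /P /index_iota /= !big_cons !big_nil /=; ring.
  - apply: qformD; last exact: qform_sq.
    by do 3?[apply: qformD]; apply: qformZ; (exact: qform_sqr || exact: qform_co2).
  - by apply: order3Z; exact: order3_co3.
have Pinv x s j : (4 <= j <= n)%N -> P (x + s *: bv j) = P x.
  by move=> jn; rewrite /P; no_shift.
split; first exact: (eq_split_not_ACQ J (ltnSn 3) n4 se (fun=> erefl) Pinv).
pose Kc := 1 + (`|a 1%N 2%N| + `|a 1%N 3%N| + `|a 2%N 3%N|).
apply: (eq_split_GCQ_iff J (ltnSn 3) n4 se (fun=> erefl) Pinv (v0 := Kc *: (bv 1 + bv 2 + bv 3))).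
  by rewrite dotZl !dotDl !dot_bv ?co_bv; try lia; natdec.
move=> x Ox; rewrite dotZl !dotDl !dot_bv; try lia.
by apply: quad3_bound => //; exact: Ox.
Qed.

End ListC.

(** * Invariants of the normal forms *)

Section Order2.
Context {R : realType}.
Variable n : nat.
Implicit Types (f g : 'rV[R]_n -> R) (x : 'rV[R]_n) (c : R).

Lemma order2_ext f g : f =1 g -> order2 f -> order2 g.
Proof. by move=> /funext ->. Qed.

Lemma order2_qform f : qform f -> order2 f.
Proof. by move=> [_ _ [K K0 HK]]; exists K. Qed.

Lemma order2_order3 f : order3 f -> order2 f.
Proof.
move=> [_ [K K0 HK]]; exists K => // x x1; rewrite (le_trans (HK x x1)) // ler_wpM2l //.
by rewrite exprS ler_piMl // exprn_ge0.
Qed.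

Lemma order2D f g : order2 f -> order2 g -> order2 (fun x => f x + g x).
Proof.
move=> [K1 K10 k1] [K2 K20 k2]; exists (K1 + K2) => [|x x1]; first by rewrite addr_ge0.
by rewrite (le_trans (ler_normD _ _))// mulrDl lerD // ?k1 ?k2.
Qed.

Lemma order2_sum (I : Type) (s : seq I) (F : I -> 'rV[R]_n -> R) :
  (forall i, order2 (F i)) -> order2 (fun x => \sum_(i <- s) F i x).
Proof.
move=> H; elim: s => [|i s IH].
  by apply: (@order2_ext (fun=> 0)) => [x|]; [rewrite big_nil|exact/order2_qform/qform0].
by apply: order2_ext (order2D (H i) IH) => x; rewrite big_cons.
Qed.

Lemma order2_pow i k : (2 <= k)%N -> order2 (fun x => co x i ^+ k).
Proof.
rewrite leq_eqVlt => /predU1P[<-|k3]; first exact/order2_qform/qform_sqr.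
exact/order2_order3/order3_exp.
Qed.

Lemma order2_Zpow c i k : (2 <= k)%N -> order2 (fun x => c * co x i ^+ k).
Proof.
rewrite leq_eqVlt => /predU1P[<-|k3]; first exact/order2_qform/qformZ/qform_sqr.
exact/order2_order3/order3Z/order3_exp.
Qed.

Lemma order2_co2 i j : order2 (fun x => co x i * co x j).
Proof. exact/order2_qform/qform_co2. Qed.

Lemma order2_Zco2 c i j : order2 (fun x => c * co x i * co x j).
Proof.
have := order2_qform (qformZ c (@qform_co2 R n i j)).
by apply: order2_ext => x; rewrite mulrA.
Qed.

Lemma order2_Zco3 c i j k : order2 (fun x => c * co x i * co x j * co x k).
Proof.
have := order2_order3 (order3Z c (@order3_co3 R n i j k)).
by apply: order2_ext => x; rewrite !mulrA.
Qed.

Lemma order2_Zco12 c i j : order2 (fun x => c * co x i * co x j ^+ 2).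
Proof. by apply: order2_ext (order2_Zco3 c i j j) => x; ring. Qed.

Lemma order2_binomial c i j : order2 (fun x => (co x i + c * co x j) ^+ 2).
Proof.
have := order2D (order2_pow i (leqnn 2)) (order2D (order2_Zco2 (2 * c) i j)
  (order2_Zpow (c ^+ 2) j (leqnn 2))).
by apply: order2_ext => x; ring.
Qed.

Lemma order2_Zbinomial (c' : R) c i j : order2 (fun x => c' * (co x i + c * co x j) ^+ 2).
Proof.
have [K K0 HK] := order2_binomial c i j; exists (`|c'| * K) => [|x x1].
  by rewrite mulr_ge0.
by rewrite normrM -mulrA ler_wpM2l // HK.
Qed.

Lemma order2_sq eps a : order2 (fun x => sq eps a x).
Proof. exact/order2_qform/qform_sq. Qed.

End Order2.

Ltac order2_tac := repeat first
  [ exact: order2_sq | apply: order2D | apply: order2_sum => ? | exact: order2_binomial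
  | exact: order2_Zbinomial | exact: order2_Zco12 | exact: order2_Zco3 | exact: order2_Zco2
  | exact: order2_co2 | apply: order2_pow; lia | apply: order2_Zpow; lia ].

(** * LICQ and MFCQ on the lists, and the remaining uniform statements *)

Section NormalForms.
Context {R : realType}.

Lemma listA_order2 n (h : 'rV[R]_n -> 'rV[R]_1) :
  listA h -> exists2 f, h = one_constraint f & order2 f.
Proof.
case=> [k eps k25 _ _|eps _ _]; eexists; try reflexivity.
- by rewrite /A1; order2_tac.
- by rewrite /A2; order2_tac.
Qed.

Lemma listC_order2 n q (h : 'rV[R]_n -> 'rV[R]_1) :
  listC q h -> exists2 f, h = one_constraint f & order2 f.
Proof.
case=> [k eps k24 _ _|eps _ _|k eps k34 _ _|d1 d2 a eps _ _ _ _ _|eps _ _|eps _ _|eps _ _|d a eps _ _ _ _];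
  eexists; try reflexivity.
- by rewrite /C1; order2_tac.
- by rewrite /C2; order2_tac.
- by rewrite /C3; order2_tac.
- by rewrite /C4; order2_tac.
- by rewrite /C5; order2_tac.
- by rewrite /C6; order2_tac.
- by rewrite /C7; order2_tac.
- by rewrite /C8; order2_tac.
Qed.

(** LICQ and MFCQ see only the linear part of the normal form, and so does the case l_1 > 0 of ACQ
    and GCQ; this lets the ten types be treated together. *)
Lemma listB_order2 n q l1 (g : 'rV[R]_n -> 'rV[R]_q) : listB l1 g ->
  exists l f, [/\ g = @gB R n q l1 l f, order2 f, (l < q)%N, (q.-1 <= n)%N & (l1 <= l)%N].
Proof.
have up m : (uphalf m <= m)%N by lia.
case=> [k eps k25 q1 qn _ l1q|eps q1 qn _ l1q|k eps k24 q2 qn _ l1q|k eps k34 q2 qn _ l1q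
  |eps q2 qn _ l1q|d1 d2 a eps q3 qn _ _ _ _ l1q|e' eps q3 qn _ _ l1q|e' eps q3 qn _ _ l1q
  |e01 e02 e12 eps q3 qn _ _ _ _ l1q|d a e0 eps q4 qn _ _ _ _ l1q];
  have l1l := leq_trans l1q (up _); eexists; eexists; split; (reflexivity || exact: l1l || lia || idtac).
- by rewrite /B1; order2_tac.
- by rewrite /B2; order2_tac.
- by rewrite /B3; order2_tac.
- by rewrite /B4; order2_tac.
- by rewrite /B5; order2_tac.
- by rewrite /B6; order2_tac.
- by rewrite /B7; order2_tac.
- by rewrite /B8; order2_tac.
- by rewrite /B9; order2_tac.
- by rewrite /B10; order2_tac.
Qed.

Lemma KG_singular_equality n q r (g gN : 'rV[R]_n -> 'rV[R]_q) (h hN : 'rV[R]_n -> 'rV[R]_r) E :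
  constraint_germ g h -> jet1 gN E -> jet1 hN 0 -> (0 < r)%N -> KG_equiv g h gN hN ->
  ~ LICQ g h /\ ~ MFCQ g h.
Proof.
move=> germ Jg Jh r0 KG; have [dg _] := jet1_jacobian Jg; have [dh JE] := jet1_jacobian Jh.
have g0 := jet1_0 Jg; have h0 := jet1_0 Jh; split; last first.
  exact: (KG_not_MFCQ germ dg dh g0 h0 KG r0 JE).
apply: (KG_not_LICQ germ dg dh g0 h0 KG (u := 0) (w := const_mx 1)) => d _.
rewrite JE mulmx0 => /rowP/(_ (Ordinal r0)); rewrite !mxE => /esym/eqP.
by rewrite oner_eq0.
Qed.

Section ListBInvariants.
Variables (n q l1 : nat) (g gN : 'rV[R]_n -> 'rV[R]_q) (h : 'rV[R]_n -> 'rV[R]_0).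
Hypotheses (germ : constraint_germ g h) (LB : listB l1 gN).
Hypothesis KG : KG_equiv g h gN (@no_constraint R n).

(** The linear part of the last inequality is a combination of the other rows, so the last unit
    vector is not a value of the differential. *)
Lemma KG_listB_not_LICQ : ~ LICQ g h.
Proof.
have [l [f [gE f2 lq qn l1l]]] := listB_order2 LB.
have J : jet1 gN (gB_mx n q l1 l) by rewrite gE; exact: jet1_gB.
have [dg JE] := jet1_jacobian J; have [dh _] := jet1_jacobian (@jet1_no_constraint R n).
have q1 : (q.-1 < q)%N by lia.
apply: (KG_not_LICQ germ dg dh (jet1_0 J) (jet1_0 (@jet1_no_constraint R n)) KG
  (u := \row_i (i == q.-1 :> nat)%:R) (w := 0)) => d; rewrite JE => dE _.
have lin (i : 'I_q) : gB_lin l1 l i d = (i == q.-1 :> nat)%:R.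
  by rewrite -mul_gB_mx dE mxE.
have d0 j : (1 <= j < q)%N -> co d j = 0.
  case: j => [//|j] /andP[_ jq]; have := lin (Ordinal (ltnW jq)); rewrite /gB_lin /= jq => ->.
  by rewrite (_ : (j == q.-1) = false) //; apply/eqP; lia.
have := lin (Ordinal q1); rewrite /gB_lin /= eqxx (_ : (q.-1.+1 < q)%N = false); last by lia.
have S a b : (0 < a)%N -> (b <= q)%N -> \sum_(a <= j < b) co d j = 0.
  by move=> a0 bq; rewrite big_nat big1 // => j jab; apply: d0; lia.
by rewrite !S //; try lia; rewrite subrr => /esym/eqP; rewrite oner_eq0.
Qed.

(** If l_1 = 0, a direction decreasing the first [q] - 1 inequalities makes the last linear form,
    minus a sum of nonpositive coordinates, nonnegative. *)
Lemma KG_listB_MFCQ : MFCQ g h <-> (0 < l1)%N.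
Proof.
have [l [f [gE f2 lq qn l1l]]] := listB_order2 LB.
have J : jet1 gN (gB_mx n q l1 l) by rewrite gE; exact: jet1_gB.
have [dg JE] := jet1_jacobian J; have [dh _] := jet1_jacobian (@jet1_no_constraint R n).
rewrite (KG_MFCQ germ dg dh (jet1_0 J) (jet1_0 (@jet1_no_constraint R n)) KG) // JE.
split=> [[d Hd]|l10]; last by apply: gB_interior_direction; lia.
rewrite lt0n; apply/eqP => l10.
have lin (i : 'I_q) : gB_lin l1 l i d < 0 by rewrite -mul_gB_mx.
have d0 j : (1 <= j < q)%N -> co d j <= 0.
  by case: j => [//|j] /andP[_ jq]; have := lin (Ordinal (ltnW jq)); rewrite /gB_lin /= jq => /ltW.
have q1 : (q.-1 < q)%N by lia.
have := lin (Ordinal q1); rewrite /gB_lin /= l10 (_ : (q.-1.+1 < q)%N = false); last by lia.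
rewrite big_geq // sub0r oppr_lt0 ltNge => /negP; apply.
by rewrite big_nat; apply: sumr_le0 => j jl; apply: d0; lia.
Qed.

End ListBInvariants.

Lemma listB_ACQ_GCQ n q l1 (g : 'rV[R]_n -> 'rV[R]_q) : listB l1 g -> (0 < l1)%N ->
  ACQ g (@no_constraint R n) /\ GCQ g (@no_constraint R n).
Proof.
move=> LB l10; have [l [f [gE f2 lq qn l1l]]] := listB_order2 LB.
have J : jet1 g (gB_mx n q l1 l) by rewrite gE; exact: jet1_gB.
have q1 : (1 <= q)%N by lia.
have l1b : (0 < l1 <= l)%N by rewrite l10.
have [u Hu] := @gB_interior_direction R n q l1 l q1 lq qn l1b.
have A := interior_direction_ACQ J Hu; split=> //.
by rewrite /GCQ A.
Qed.

Lemma listA_not_ACQ n (h : 'rV[R]_n -> 'rV[R]_1) : listA h -> ~ ACQ (@no_constraint R n) h.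
Proof.
case=> [k eps k25 n2 se|eps n4 se]; first by have [] := A1_ACQ_GCQ k25 n2 se.
by have [] := A2_ACQ_GCQ n4 se.
Qed.

Lemma listC_not_ACQ n q (h : 'rV[R]_n -> 'rV[R]_1) : listC q h -> ~ ACQ (@reg_ineq R n q) h.
Proof.
case=> [k eps k24 n2 se|eps n3 se|k eps k34 n3 se|d1 d2 a eps n3 s1 s2 _ se|eps n3 se|eps n3 se
  |eps n4 se|d a eps n4 sd _ se].
- by have [] := C1_ACQ_GCQ k24 n2 se.
- by have [] := C2_ACQ_GCQ n3 se.
- by have [] := C3_ACQ_GCQ k34 n3 se.
- by have [] := C4_ACQ_GCQ a n3 s1 s2 se.
- by have [] := C5_ACQ_GCQ n3 se.
- by have [] := C6_ACQ_GCQ n3 se.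
- by have [] := C7_ACQ_GCQ n4 se.
- by have [] := C8_ACQ_GCQ a n4 sd se.
Qed.

End NormalForms.

Theorem theorem4p2 (R : realType) :
  (* (1) LICQ *)
  [/\ (forall (n q r : nat) (g : 'rV[R]_n -> 'rV[R]_q) (h : 'rV[R]_n -> 'rV[R]_r),
         constraint_germ g h ->
         (LICQ g h <->
          (#|active g| + r <= n)%N /\
          KG_equiv (active_part g) h
            (@reg_ineq R n #|active g|) (@reg_eq R n #|active g| r))),
      (forall (n q r : nat) (g : 'rV[R]_n -> 'rV[R]_q) (h : 'rV[R]_n -> 'rV[R]_r),
         constraint_germ g h -> n = (q + r)%N -> g 0 = 0 ->
         (LICQ g h <-> KG_equiv g h (@reg_ineq R n q) (@reg_eq R n q r))),
      (forall (n : nat) (g : 'rV[R]_n -> 'rV[R]_0) (h hA : 'rV[R]_n -> 'rV[R]_1),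
         constraint_germ g h -> listA hA ->
         KG_equiv g h (@no_constraint R n) hA -> ~ LICQ g h),
      (forall (n q l1 : nat) (g gN : 'rV[R]_n -> 'rV[R]_q) (h : 'rV[R]_n -> 'rV[R]_0),
         constraint_germ g h -> listB l1 gN ->
         KG_equiv g h gN (@no_constraint R n) -> ~ LICQ g h) &
      (forall (n q : nat) (g : 'rV[R]_n -> 'rV[R]_q) (h hC : 'rV[R]_n -> 'rV[R]_1),
         constraint_germ g h -> listC q hC ->
         KG_equiv g h (@reg_ineq R n q) hC -> ~ LICQ g h)] /\
  (* (2) MFCQ *)
  [/\ (forall (n q r : nat) (g : 'rV[R]_n -> 'rV[R]_q) (h : 'rV[R]_n -> 'rV[R]_r),
         constraint_germ g h -> (\rank ('J h (0 : 'rV[R]_n)%R) < r)%N -> ~ MFCQ g h),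
      (forall (n : nat) (g : 'rV[R]_n -> 'rV[R]_0) (h hA : 'rV[R]_n -> 'rV[R]_1),
         constraint_germ g h -> listA hA ->
         KG_equiv g h (@no_constraint R n) hA -> ~ MFCQ g h),
      (forall (n q : nat) (g : 'rV[R]_n -> 'rV[R]_q) (h hC : 'rV[R]_n -> 'rV[R]_1),
         constraint_germ g h -> listC q hC ->
         KG_equiv g h (@reg_ineq R n q) hC -> ~ MFCQ g h) &
      (forall (n q l1 : nat) (g gN : 'rV[R]_n -> 'rV[R]_q) (h : 'rV[R]_n -> 'rV[R]_0),
         constraint_germ g h -> listB l1 gN ->
         KG_equiv g h gN (@no_constraint R n) -> (MFCQ g h <-> (0 < l1)%N))] /\
  (* (3) List A *)
  [/\ (forall (n : nat) (h : 'rV[R]_n -> 'rV[R]_1),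
         listA h -> ~ ACQ (@no_constraint R n) h),
      (forall (n k : nat) (eps : nat -> R),
         (2 <= k <= 5)%N -> (2 <= n)%N -> sgns eps ->
         (GCQ (@no_constraint R n) (one_constraint (@A1 R n k eps)) <->
          (k = 2%N /\ (exists j, (2 <= j <= n)%N /\ eps j = -1)) \/
          ((3 <= k)%N /\ both_signs eps 2 n))) &
      (forall (n : nat) (eps : nat -> R),
         (4 <= n)%N -> sgns eps ->
         (GCQ (@no_constraint R n) (one_constraint (@A2 R n eps)) <->
          exists j, (4 <= j <= n)%N /\ eps j = -1))] /\
  (* (4) List B *)
  ((forall (n q l1 : nat) (g : 'rV[R]_n -> 'rV[R]_q),
      listB l1 g -> (0 < l1)%N ->
      ACQ g (@no_constraint R n) /\ GCQ g (@no_constraint R n)) /\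
   (* type (1,k) *)
   (forall (n q k : nat) (eps : nat -> R),
      (2 <= k <= 5)%N -> (1 <= q)%N -> (q.+1 <= n)%N -> sgns eps ->
      let g := @gB R n q 0 (q - 1) (B1 q k eps) in
      (ACQ g (@no_constraint R n) <->
       all_eq eps q n (-1) \/ ((3 <= k)%N /\ all_eq eps q.+1 n (-1))) /\
      (GCQ g (@no_constraint R n) <->
       (k = 2%N /\ ~ all_eq eps q n 1) \/ ~ all_eq eps q.+1 n 1)) /\
   (* type (2) *)
   (forall (n q : nat) (eps : nat -> R),
      (1 <= q)%N -> (q.+2 <= n)%N -> sgns eps ->
      let g := @gB R n q 0 (q - 1) (B2 q eps) in
      (ACQ g (@no_constraint R n) <-> all_eq eps q.+2 n (-1)) /\
      (GCQ g (@no_constraint R n) <-> ~ all_eq eps q.+2 n 1)) /\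
   (* type (3,k) *)
   (forall (n q k : nat) (eps : nat -> R),
      (2 <= k <= 4)%N -> (2 <= q)%N -> (q <= n)%N -> sgns eps ->
      let g := @gB R n q 0 (q - 2) (B3 q k eps) in
      (ACQ g (@no_constraint R n) <->
       all_eq eps (q - 1) n (-1) \/ ((3 <= k)%N /\ all_eq eps q n (-1))) /\
      (GCQ g (@no_constraint R n) <-> ~ all_eq eps q n 1)) /\
   (* type (4,k) *)
   (forall (n q k : nat) (eps : nat -> R),
      (3 <= k <= 4)%N -> (2 <= q)%N -> (q.+1 <= n)%N -> sgns eps ->
      let g := @gB R n q 0 (q - 2) (B4 q k eps) in
      ~ ACQ g (@no_constraint R n) /\
      (GCQ g (@no_constraint R n) <->
       ~ all_eq eps q.+1 n 1 \/ eps q = (-1) ^+ k.+1)) /\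
   (* type (5) *)
   (forall (n q : nat) (eps : nat -> R),
      (2 <= q)%N -> (q.+1 <= n)%N -> sgns eps ->
      let g := @gB R n q 0 (q - 2) (B5 q eps) in
      (ACQ g (@no_constraint R n) <->
       eps (q - 1)%N = -1 /\ all_eq eps q.+1 n (-1)) /\
      (GCQ g (@no_constraint R n) <-> ~ all_eq eps q.+1 n 1)) /\
   (* type (6) *)
   (forall (n q : nat) (d1 d2 a : R) (eps : nat -> R),
      (3 <= q)%N -> (q <= n)%N -> sgn d1 -> sgn d2 -> cond1 d1 d2 a -> sgns eps ->
      let g := @gB R n q 0 (q - 3) (B6 q d1 d2 a eps) in
      (ACQ g (@no_constraint R n) <->
       [/\ d1 = -1, d2 = -1, a < 2 & all_eq eps q n (-1)]) /\
      (GCQ g (@no_constraint R n) <-> ~ all_eq eps q n 1)) /\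
   (* type (7) *)
   (forall (n q : nat) (e' : R) (eps : nat -> R),
      (3 <= q)%N -> (q <= n)%N -> sgn e' -> sgns eps ->
      let g := @gB R n q 0 (q - 3) (B7 q e' eps) in
      (ACQ g (@no_constraint R n) <->
       eps (q - 2)%N = -1 /\ all_eq eps q n (-1)) /\
      (GCQ g (@no_constraint R n) <-> ~ all_eq eps q n 1)) /\
   (* type (8) *)
   (forall (n q : nat) (e' : R) (eps : nat -> R),
      (3 <= q)%N -> (q <= n)%N -> sgn e' -> sgns eps ->
      let g := @gB R n q 0 (q - 3) (B8 q e' eps) in
      (ACQ g (@no_constraint R n) <->
       [/\ eps (q - 1)%N = -1, e' = -1 & all_eq eps q n (-1)]) /\
      (GCQ g (@no_constraint R n) <-> ~ all_eq eps q n 1)) /\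
   (* type (9) *)
   (forall (n q : nat) (e01 e02 e12 : R) (eps : nat -> R),
      (3 <= q)%N -> (q.+1 <= n)%N -> sgn e01 -> sgn e02 -> sgn e12 -> sgns eps ->
      let g := @gB R n q 0 (q - 3) (B9 q e01 e02 e12 eps) in
      ~ ACQ g (@no_constraint R n) /\
      (GCQ g (@no_constraint R n) <->
       [\/ ~ all_eq eps q.+1 n 1, e01 = 1 | e02 = 1])) /\
   (* type (10) *)
   (forall (n q : nat) (d : nat -> R) (a : nat -> nat -> R) (e0 : R)
      (eps : nat -> R),
      (4 <= q)%N -> (q <= n)%N -> sgns d -> cond2 d a -> sgn e0 -> sgns eps ->
      let g := @gB R n q 0 (q - 4) (B10 q d a e0 eps) in
      let al := fun i j : nat => if (i < j)%N then a i j else a j i in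
      (ACQ g (@no_constraint R n) <->
       [/\ all_eq d 1 3 (-1), all_eq eps q n (-1) &
           exists i j k : nat,
             perm_eq [:: i; j; k] [:: 1; 2; 3]%N /\
             ([/\ al i j <= 0, al i k <= 0 & al j k < 2] \/
              [/\ 0 < al i j < 2, 0 < al i k < 2 &
                  al j k + al i j * al i k / 2
                  < 2 * Num.sqrt ((1 - al i j ^+ 2 / 4)
                                  * (1 - al i k ^+ 2 / 4))])]) /\
      (GCQ g (@no_constraint R n) <-> ~ all_eq eps q n 1))) /\
  (* (5) List C *)
  ((forall (n q : nat) (h : 'rV[R]_n -> 'rV[R]_1),
      listC q h -> ~ ACQ (@reg_ineq R n q) h) /\
   (* type (1,k) *)
   (forall (n k : nat) (eps : nat -> R),
      (2 <= k <= 4)%N -> (2 <= n)%N -> sgns eps ->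
      (GCQ (@reg_ineq R n 1) (one_constraint (@C1 R n k eps)) <->
       both_signs eps 2 n)) /\
   (* type (2) *)
   (forall (n : nat) (eps : nat -> R),
      (3 <= n)%N -> sgns eps ->
      (GCQ (@reg_ineq R n 1) (one_constraint (@C2 R n eps)) <->
       both_signs eps 3 n)) /\
   (* type (3,k) *)
   (forall (n k : nat) (eps : nat -> R),
      (3 <= k <= 4)%N -> (3 <= n)%N -> sgns eps ->
      (GCQ (@reg_ineq R n 1) (one_constraint (@C3 R n k eps)) <->
       (~~ odd k /\ (exists j, (3 <= j <= n)%N /\ eps j = -1)) \/
       (odd k /\ (eps 1%N = 1 \/ both_signs eps 3 n)))) /\
   (* type (4) *)
   (forall (n : nat) (d1 d2 a : R) (eps : nat -> R),
      (3 <= n)%N -> sgn d1 -> sgn d2 -> cond1 d1 d2 a -> sgns eps ->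
      (GCQ (@reg_ineq R n 2) (one_constraint (@C4 R n d1 d2 a eps)) <->
       both_signs eps 3 n)) /\
   (* type (5) *)
   (forall (n : nat) (eps : nat -> R),
      (3 <= n)%N -> sgns eps ->
      (GCQ (@reg_ineq R n 2) (one_constraint (@C5 R n eps)) <->
       both_signs eps 3 n)) /\
   (* type (6) *)
   (forall (n : nat) (eps : nat -> R),
      (3 <= n)%N -> sgns eps ->
      (GCQ (@reg_ineq R n 2) (one_constraint (@C6 R n eps)) <->
       both_signs eps 3 n)) /\
   (* type (7) *)
   (forall (n : nat) (eps : nat -> R),
      (4 <= n)%N -> sgns eps ->
      (GCQ (@reg_ineq R n 2) (one_constraint (@C7 R n eps)) <->
       [\/ both_signs eps 4 n, eps 1%N = 1 | eps 2%N = 1])) /\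
   (* type (8) *)
   (forall (n : nat) (d : nat -> R) (a : nat -> nat -> R) (eps : nat -> R),
      (4 <= n)%N -> sgns d -> cond2 d a -> sgns eps ->
      (GCQ (@reg_ineq R n 3) (one_constraint (@C8 R n d a eps)) <->
       both_signs eps 4 n))).
Proof.
split; first split.
- by move=> n q r g h; exact: LICQ_iff_regular.
- by move=> n q r g h; exact: LICQ_iff_regular_all_active.
- move=> n g h hA germ /listA_order2[f -> f2].
  by move=> /(KG_singular_equality germ (@jet1_no_constraint R n) (jet1_one_constraint f2) isT)[].
- by move=> n q l1 g gN h; exact: KG_listB_not_LICQ.
- move=> n q g h hC germ /listC_order2[f -> f2].
  by move=> /(KG_singular_equality germ (@jet1_reg_ineq R n q) (jet1_one_constraint f2) isT)[].
split; first split.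
- by move=> n q r g h _ + [E _]; rewrite E ltnn.
- move=> n g h hA germ /listA_order2[f -> f2].
  by move=> /(KG_singular_equality germ (@jet1_no_constraint R n) (jet1_one_constraint f2) isT)[].
- move=> n q g h hC germ /listC_order2[f -> f2].
  by move=> /(KG_singular_equality germ (@jet1_reg_ineq R n q) (jet1_one_constraint f2) isT)[].
- by move=> n q l1 g gN h; exact: KG_listB_MFCQ.
split; first split.
- exact: listA_not_ACQ.
- by move=> n k eps k25 n2 se; have [] := A1_ACQ_GCQ k25 n2 se.
- by move=> n eps n4 se; have [] := A2_ACQ_GCQ n4 se.
split.
  split; first exact: listB_ACQ_GCQ.
  split; first exact: B1_ACQ_GCQ.
  split; first exact: B2_ACQ_GCQ.
  split; first exact: B3_ACQ_GCQ.
  split; first exact: B4_ACQ_GCQ.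
  split; first exact: B5_ACQ_GCQ.
  split; first exact: B6_ACQ_GCQ.
  split; first exact: B7_ACQ_GCQ.
  split; first exact: B8_ACQ_GCQ.
  split; first exact: B9_ACQ_GCQ.
  exact: B10_ACQ_GCQ.
split; first exact: listC_not_ACQ.
split; first by move=> n k eps k24 n2 se; have [] := C1_ACQ_GCQ k24 n2 se.
split; first by move=> n eps n3 se; have [] := C2_ACQ_GCQ n3 se.
split; first by move=> n k eps k34 n3 se; have [] := C3_ACQ_GCQ k34 n3 se.
split; first by move=> n d1 d2 a eps n3 s1 s2 _ se; have [] := C4_ACQ_GCQ a n3 s1 s2 se.
split; first by move=> n eps n3 se; have [] := C5_ACQ_GCQ n3 se.
split; first by move=> n eps n3 se; have [] := C6_ACQ_GCQ n3 se.
split; first by move=> n eps n4 se; have [] := C7_ACQ_GCQ n4 se.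
by move=> n d a eps n4 sd _ se; have [] := C8_ACQ_GCQ a n4 sd se.
Qed.
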